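(* Let $V\in L^\infty(\mathbb{R}^+)$ be complex-valued with $V_I:=\operatorname{Im}V\ge 0$ almost everywhere. If $h\in\mathbb{C}$ with $\operatorname{Im}(h)>0$ and $k\in\operatorname{Ran}(V_I^{1/2})$ are such that $$\frac14\int_{\mathcal{E}}\frac{|k(x)|^2}{V_I(x)}\,dx<\operatorname{Im}(h),\qquad \mathcal{E}=\{x\in\mathbb{R}^+:V_I(x)\ne 0\},$$ then the operator $A_{h,k}$ in $L^2(\mathbb{R}^+)$ given by $$\mathcal{D}(A_{h,k})=\{f\in H^2(\mathbb{R}^+): f'(0)=hf(0)\},\qquad (A_{h,k}f)(x)=-f''(x)+V(x)f(x)+f(0)k(x),$$ is completely non-selfadjoint.
   Context: $\mathbb{R}^+=(0,\infty)$, $H^2(\mathbb{R}^+)$ is the usual Sobolev space; $V_I$ and $V_I^{1/2}$ also denote the corresponding multiplication operators on $L^2(\mathbb{R}^+)$, and $\operatorname{Ran}$ denotes the range. The inner product is linear in the second and anti-linear in the first component. A densely defined linear operator $A$ is dissipative if $\operatorname{Im}\langle u,Au\rangle\ge0$ for all $u\in\mathcal{D}(A)$, and maximally dissipative if moreover it has no non-trivial dissipative extension. Under the stated assumptions $A_{h,k}$ is maximally dissipative (known). A closed subspace $\mathcal{M}$ of a Hilbert space $\mathcal{H}$ is a reducing subspace of $A$ if $\mathcal{D}(A)=\mathcal{D}(A)\cap\mathcal{M}+\mathcal{D}(A)\cap\mathcal{M}^\perp$, $A(\mathcal{D}(A)\cap\mathcal{M})\subset\mathcal{M}$ and $A(\mathcal{D}(A)\cap\mathcal{M}^\perp)\subset\mathcal{M}^\perp$.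 A maximally dissipative operator $A$ is completely non-selfadjoint if there is no non-trivial (i.e. $\neq\{0\}$) reducing subspace $\mathcal{H}_1\subseteq\mathcal{H}$ such that the restriction of $A$ to $\mathcal{D}(A)\cap\mathcal{H}_1$ is selfadjoint in $\mathcal{H}_1$. *)

(* Defs.v *)
From HB Require Import structures.
From mathcomp Require Import all_boot all_order all_algebra generic_quotient.
From mathcomp Require Import ring_quotient.
From mathcomp Require Import all_classical all_reals all_analysis.
From mathcomp Require Import complex.

Set Implicit Arguments.
Unset Strict Implicit.
Unset Printing Implicit Defensive.
Import Order.TTheory GRing.Theory Num.Theory numFieldNormedType.Exports.

Local Open Scope classical_set_scope.
Local Open Scope ring_scope.
Local Open Scope complex_scope.
Local Open Scope quotient_scope.

Notation cRe := (@complex.Re _).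
Notation cIm := (@complex.Im _).

(* Only the values of [act] on [dom] are meaningful. *)
Record operator (H : Type) := Operator { dom : set H ; act : H -> H }.

Definition restrict_op (H : Type) (A : operator H) (M : set H) : operator H :=
  Operator (dom A `&` M) (act A).

Definition graph (H : Type) (A : operator H) : set (H * H) :=
  [set p | dom A p.1 /\ act A p.1 = p.2].

Section Hilbert.
Context (R : realType) (H : lmodType R[i]).
Variable ip : H -> H -> R[i].

Definition hnorm (x : H) : R := Num.sqrt (cRe (ip x x)).

Definition subspace (M : set H) : Prop :=
  M 0 /\ forall (a : R[i]) x y, M x -> M y -> M (a *: x + y).

Definition hclosed (M : set H) : Prop :=
  forall (u : nat -> H) (x : H), (forall n, M (u n)) ->
    (fun n => hnorm (u n - x)) @ \oo --> (0 : R) -> M x.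

Definition orthogonal_compl (M : set H) : set H :=
  [set x | forall y, M y -> ip y x = 0].

Definition reducing (A : operator H) (M : set H) : Prop :=
  [/\ subspace M,
      hclosed M,
      dom A = [set u + v | u in dom A `&` M
                         & v in dom A `&` orthogonal_compl M],
      act A @` (dom A `&` M) `<=` M
    & act A @` (dom A `&` orthogonal_compl M) `<=` orthogonal_compl M].

Definition dense_in (M D : set H) : Prop :=
  forall x, M x -> forall e : R, 0 < e -> exists2 y, D y & hnorm (x - y) < e.

Definition adjoint_graph_in (M : set H) (B : operator H) : set (H * H) :=
  [set p | [/\ M p.1, M p.2
             & forall u, dom B u -> ip p.1 (act B u) = ip p.2 u]].

(* [B], as an operator in the Hilbert space [M], equals its adjoint *)
Definition selfadjoint_in (M : set H) (B : operator H) : Prop :=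
  [/\ dom B `<=` M, act B @` dom B `<=` M, dense_in M (dom B)
    & adjoint_graph_in M B = graph B].

(* The notion is meant for maximally dissipative A; maximal dissipativity is
   not part of the predicate. *)
Definition completely_nonselfadjoint (A : operator H) : Prop :=
  ~ exists M : set H, [/\ reducing A M, M <> [set 0]
                        & selfadjoint_in M (restrict_op A M)].

End Hilbert.

Section Lp_functions.
Context (R : realType).

Definition Rpos : set R := [set x | 0 < x].

(* f |_ (0, oo) is in L^p(0, oo) iff the real and imaginary parts of f,
   extended by 0 outside (0, oo), are in L^p of the real line; [point : R]
   is 0 in the patch notation. *)
Definition Lp_fun (p : \bar R) : {pred R -> R[i]} := fun f =>
  ((cRe \o f) \_ Rpos \in Lfun (@lebesgue_measure R) p) &&
  ((cIm \o f) \_ Rpos \in Lfun (@lebesgue_measure R) p).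

Definition L2_fun : {pred R -> R[i]} := fun f => Lp_fun 2%:E f.

Lemma L2_fun_submod_closed : submod_closed L2_fun.
Proof.
have p1 : ((1 : \bar R) <= 2%:E)%E by rewrite lee_fin ler1n.
pose P := @Lfun_submod_closed _ _ _ (@lebesgue_measure R) 2%:E p1.
have [P0 PD] := P.
have PZ (a : R) (f : R -> R) : f \in Lfun (@lebesgue_measure R) 2%:E ->
    a *: f \in Lfun (@lebesgue_measure R) 2%:E.
  by move=> Pf; rewrite -[a *: f]addr0; exact: PD.
split.
  apply/andP; split.
    rewrite (_ : _ \_ _ = 0) //; apply/funext => x.
    by rewrite patchE; case: ifP.
  rewrite (_ : _ \_ _ = 0) //; apply/funext => x.
  by rewrite patchE; case: ifP.
move=> a f g /andP[fr fi] /andP[gr gi]; apply/andP; split.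
  rewrite (_ : _ \_ _ = cRe a *: ((cRe \o f) \_ Rpos) +
    ((- cIm a) *: ((cIm \o f) \_ Rpos) + (cRe \o g) \_ Rpos)).
    by apply: (PD) => //; exact: PD.
  apply/funext => x; rewrite !fctE !patchE; case: ifP => _.
    rewrite /=; case: a (f x) (g x) => [a b] [c d] [u v] /=.
    by rewrite /GRing.scale /= addrA mulNr.
  by rewrite !scaler0 !addr0.
rewrite (_ : _ \_ _ = cRe a *: ((cIm \o f) \_ Rpos) +
  (cIm a *: ((cRe \o f) \_ Rpos) + (cIm \o g) \_ Rpos)).
  by apply: (PD) => //; exact: PD.
apply/funext => x; rewrite !fctE !patchE; case: ifP => _.
  rewrite /=; case: a (f x) (g x) => [a b] [c d] [u v] /=.
  by rewrite /GRing.scale /= addrA.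
by rewrite !scaler0 !addr0.
Qed.

HB.instance Definition _ :=
  GRing.isSubmodClosed.Build R[i] (R -> R[i]) L2_fun L2_fun_submod_closed.

Record L2_fun_type := MkL2Fun
  { L2_fun_val :> R -> R[i] ; L2_fun_valP : L2_fun_val \in L2_fun }.

HB.instance Definition _ := [isSub for L2_fun_val].
HB.instance Definition _ := [Choice of L2_fun_type by <:].
HB.instance Definition _ := [SubChoice_isSubLmodule of L2_fun_type by <:].

Definition L2_null : {pred L2_fun_type} := fun f =>
  `[< {ae @lebesgue_measure R, forall x, 0 < x -> f x = 0} >].

Lemma L2_null_submod_closed : submod_closed L2_null.
Proof.
split; first by apply/asboolP; apply: aeW.
move=> a f g /asboolP f0 /asboolP g0; apply/asboolP.
move: f0 g0; apply: (@filterS2 _ _ (ae_filter_ringOfSetsType _)) => x fx gx x0.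
by rewrite /= !fctE fx// gx// scaler0 addr0.
Qed.

HB.instance Definition _ :=
  GRing.isSubmodClosed.Build R[i] L2_fun_type L2_null L2_null_submod_closed.

End Lp_functions.

Section L2_space.
Context (R : realType).

(* L^2(0, oo; C): square-integrable functions modulo a.e. equality *)
Definition L2 : Type := Quotient.quot (@L2_null R).

HB.instance Definition _ := GRing.Zmodule.on L2.
HB.instance Definition _ := EqQuotient.on L2.

Definition L2_scale (a : R[i]) (f : L2) : L2 := \pi_L2 (a *: repr f).

Lemma pi_L2_scale (a : R[i]) (f : L2_fun_type R) :
  L2_scale a (\pi_L2 f) = \pi_L2 (a *: f).
Proof.
apply/eqP; rewrite /L2_scale -Quotient.idealrBE -scalerBr rpredZ//.
by rewrite Quotient.idealrBE reprK.
Qed.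

Lemma L2_scaleA (a b : R[i]) (f : L2) :
  L2_scale a (L2_scale b f) = L2_scale (a * b) f.
Proof. by rewrite [L2_scale b f]/L2_scale pi_L2_scale scalerA. Qed.

Lemma L2_scale1 : left_id 1 L2_scale.
Proof. by move=> f; rewrite /L2_scale scale1r reprK. Qed.

Lemma L2_scaleDr : right_distributive L2_scale +%R.
Proof.
move=> a f g; rewrite -{1}[f]reprK -{1}[g]reprK -raddfD pi_L2_scale.
by rewrite scalerDr raddfD.
Qed.

Lemma L2_scaleDl (f : L2) : {morph L2_scale^~ f : a b / a + b}.
Proof. by move=> a b; rewrite /L2_scale scalerDl raddfD. Qed.

HB.instance Definition _ := GRing.Zmodule_isLmodule.Build R[i] L2
  L2_scaleA L2_scale1 L2_scaleDr L2_scaleDl.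

Definition fun_of_L2 (f : L2) : R -> R[i] := repr f.
Coercion fun_of_L2 : L2 >-> Funclass.

(* the class of f if f is square-integrable on (0, oo), and 0 otherwise *)
Definition toL2 (f : R -> R[i]) : L2 := \pi_L2 (insubd 0 f).

Definition cintegral (f : R -> R[i]) : R[i] :=
  (\int[lebesgue_measure]_(x in @Rpos R) cRe (f x)) +i*
  (\int[lebesgue_measure]_(x in @Rpos R) cIm (f x)).

Definition L2ip (f g : L2) : R[i] := cintegral (fun x => (f x)^* * g x).

Definition mulop (W : R -> R[i]) (f : L2) : L2 := toL2 (fun x => W x * f x).

(* C^1_c(0, oo); these test functions define the same weak derivatives as
   C^oo_c(0, oo) (cf. Brezis, Functional Analysis, Sobolev Spaces and Partial
   Differential Equations, Section 8.2) *)
Definition test_function (phi : R -> R) : Prop :=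
  [/\ forall x, derivable phi x 1,
      continuous (derive1 phi)
    & exists a b : R, 0 < a /\ forall x, phi x != 0 -> a <= x <= b].

Definition is_weak_derivative (f g : L2) : Prop :=
  forall phi : R -> R, test_function phi ->
    cintegral (fun x => f x * (derive1 phi x)%:C) =
    - cintegral (fun x => g x * (phi x)%:C).

Definition weak_derivative (f : L2) : L2 := xget 0 [set g | is_weak_derivative f g].

Definition H2 : set L2 := [set f | exists f1 f2 : L2,
  is_weak_derivative f f1 /\ is_weak_derivative f1 f2].

(* f(0) for f in H^1(0, oo), i.e. the value at 0 of the representative of f
   that is continuous on [0, oo) *)
Definition is_value_at0 (f : L2) (c : R[i]) : Prop :=
  exists g : R -> R[i],
    [/\ {within `[0, +oo[, continuous (cRe \o g)},
        {within `[0, +oo[, continuous (cIm \o g)},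
        {ae lebesgue_measure, forall x, 0 < x -> f x = g x}
      & g 0 = c].

Definition value_at0 (f : L2) : R[i] := xget 0 [set c | is_value_at0 f c].

Definition A_op (V : R -> R[i]) (h : R[i]) (k : L2) : operator L2 := {|
  dom := [set f | H2 f /\ value_at0 (weak_derivative f) = h * value_at0 f];
  act := fun f => - weak_derivative (weak_derivative f) + mulop V f
                  + value_at0 f *: k |}.

End L2_space.

(* Main.v *)
(* Let M be a reducing subspace on which A = A_{h,k} is selfadjoint, and f in
   D(A) and M.  Integrating by parts in Im <f, A f> = 0 and completing the square
   pointwise, the strict inequality forces f(0) = 0, hence f'(0) = 0, and
   V_I f = 0.  Thus re f solves - u'' + (Re V) u = re (A f) with zero Cauchy data,
   a Volterra equation.  If w_0, ..., w_m in D(A) and M satisfy A w_j = w_{j+1},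
   iterating the Volterra estimate in the weight exp(l x), l >= 1 of order
   ||Re V|| + r, bounds |int_0^x re w_0| by (2 / l^2)^m ||w_m|| exp(l x).
   Selfadjointness supplies such chains: weighted sums of the resolvents at the
   points r e^{2 i pi k / N} give w_0 within 2 N r ||A f|| of N r^2 f and
   ||w_m|| <= 2 N r^{m+1} ||A f||.  Letting m and then r tend to infinity yields
   int_0^x re f = 0 for all x, so re f = 0, and likewise im f = 0.  Hence D(A)
   and M, which is dense in M, is {0}. *)
Require Import Defs.
From mathcomp Require Import all_boot all_order all_algebra.
From mathcomp Require Import all_classical all_reals all_analysis.
From mathcomp Require Import measurable_realfun ess_sup_inf ring lra.
From mathcomp Require Import complex.
Set Implicit Arguments.
Unset Strict Implicit.
Unset Printing Implicit Defensive.
Import Order.TTheory GRing.Theory Num.Theory numFieldNormedType.Exports.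
Local Open Scope classical_set_scope.
Local Open Scope ring_scope.
Local Open Scope complex_scope.

(** On real parts the equation makes the restricted operator left invertible by a Volterra operator.
    In the weight exp(l x) that inverse has norm O(l^-2) with l at will, so it is quasinilpotent,
    while a part of a selfadjoint operator with spectrum in [-r, r] lengthens vectors by at most r
    per application. The two are compatible only on {0}. The obstacle is that powers of the operator
    cannot be applied to an arbitrary vector of the domain. Finite sums of resolvents play the role
    of spectral projections: by orthogonality of roots of unity the moments that would break the
    chain vanish exactly, so every link is an identity without quadrature error. The number N of
    nodes grows with the length of the chain, but cancels from the final estimate. Primitives are
    estimated instead of functions because only the L^2 norm of the last vector of a chain is known,
    and that norm controls its primitive pointwise. In the integration by parts the boundary term is
    the Wronskian of re f and im f; it is integrable, hence small along some sequence tending to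
    infinity, and no decay of f or f' is needed. *)

Section Complex.
Context (R : realType).
Implicit Types z w : R[i].

(** * Components and moduli of complex numbers, roots of unity *)

Lemma cReD z w : cRe (z + w) = cRe z + cRe w.
Proof. by case: z w => a b []. Qed.

Lemma cImD z w : cIm (z + w) = cIm z + cIm w.
Proof. by case: z w => a b []. Qed.

Lemma cReM z w : cRe (z * w) = cRe z * cRe w - cIm z * cIm w.
Proof. by case: z w => a b []. Qed.

Lemma cImM z w : cIm (z * w) = cRe z * cIm w + cIm z * cRe w.
Proof. by case: z w => a b []. Qed.

Lemma normcX z n : Normc.normc (z ^+ n) = Normc.normc z ^+ n.
Proof.
by elim: n => [|n IHn]; rewrite ?expr0 ?Normc.normc1// !exprS Normc.normcM IHn.
Qed.

Lemma normc_prim_root n z : n.-primitive_root z -> Normc.normc z = 1.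
Proof.
move=> pz; have n0 := prim_order_gt0 pz; have := prim_expr_order pz.
move=> /(congr1 (@Normc.normc R)); rewrite normcX Normc.normc1 => /eqP.
rewrite pexpr_eq1// => [/eqP//|]; case: z {pz} => a b; exact: sqrtr_ge0.
Qed.

End Complex.

(** A root of [1 + X + ... + X^(p-1)] is a p-th root of unity whose order divides the prime [p];
    order 1 would make the sum equal to [p], which is nonzero in characteristic 0. *)
Lemma exists_prim_root (F : closedFieldType) p :
  [pchar F] =i pred0 -> prime p -> exists z : F, p.-primitive_root z.
Proof.
move=> F0 pp; have p1 := prime_gt1 pp; have p0 := prime_gt0 pp.
have : size (\poly_(i < p) (1 : F)) != 1%N.
  by rewrite size_poly_eq ?oner_eq0// gtn_eqF.
move/closed_rootP => [z /rootP]; rewrite horner_poly.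
under eq_bigr do rewrite mul1r.
move=> sz; have zp : z ^+ p = 1.
  by apply/eqP; rewrite -subr_eq0 subrX1 sz mulr0.
have [m pm mp] := prim_order_exists p0 zp.
exists z; move: (pp) => /primeP[_ /(_ _ mp) /pred2P[m1|<-//]].
move: pm sz; rewrite m1 => /prim_expr_order; rewrite expr1 => ->.
under eq_bigr do rewrite expr1n; rewrite sumr_const card_ord => /eqP.
by have /pcharf0P -> := F0; rewrite gtn_eqF.
Qed.

(** A geometric sum of ratio [z ^+ j], which differs from 1 exactly because [0 < j < n]. It is the
    discrete counterpart of a vanishing contour integral of a monomial. *)
Lemma prim_root_sum (F : idomainType) n (z : F) j : n.-primitive_root z ->
  (0 < j < n)%N -> \sum_(k < n) (z ^+ k) ^+ j = 0.
Proof.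
move=> pz /andP[j0 jn].
have : (z ^+ j - 1) * (\sum_(k < n) (z ^+ k) ^+ j) = 0.
  under eq_bigr do rewrite exprAC.
  by rewrite -subrX1 exprAC (prim_expr_order pz) expr1n subrr.
move/eqP; rewrite mulf_eq0 subr_eq0 -(prim_order_dvd pz) gtnNdvd//=.
by move/eqP.
Qed.

(** * Hilbert space geometry: Cauchy-Schwarz and orthogonal projection *)

Section HilbertSpace.
Context (R : realType) (H : lmodType R[i]).
Context (ip : H -> H -> R[i]).

(** Definiteness is not a field, so [hnorm] is a seminorm here and a vector of norm 0 cannot be
    replaced by 0; for L^2 this is [hnorm_eq0]. *)
Record hilbert_space : Prop := {
  ip_linr : forall x (a : R[i]) y z, ip x (a *: y + z) = a * ip x y + ip x z ;
  ip_sym : forall x y, ip y x = (ip x y)^*%C ;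
  ip_ge0 : forall x, 0 <= cRe (ip x x) ;
  ip_complete : forall u : nat -> H,
    (forall e : R, 0 < e -> exists N, forall m n, (N <= m)%N -> (N <= n)%N ->
       hnorm ip (u m - u n) < e) ->
    exists x, (fun n => hnorm ip (u n - x)) @ \oo --> (0 : R) }.

Context (hH : hilbert_space).

Local Notation nsq x := (cRe (ip x x)).
Local Notation hn := (hnorm ip).

Lemma ipDr x y z : ip x (y + z) = ip x y + ip x z.
Proof. by rewrite -[y]scale1r (ip_linr hH) mul1r scale1r. Qed.

Lemma ip0r x : ip x 0 = 0.
Proof. by apply: (@addrI _ (ip x 0)); rewrite -ipDr !addr0. Qed.

Lemma ipZr (a : R[i]) x y : ip x (a *: y) = a * ip x y.
Proof. by rewrite -[a *: y]addr0 (ip_linr hH) ip0r addr0. Qed.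

Lemma ipNr x y : ip x (- y) = - ip x y.
Proof. by rewrite -scaleN1r ipZr mulN1r. Qed.

Lemma ipBr x y z : ip x (y - z) = ip x y - ip x z.
Proof. by rewrite ipDr ipNr. Qed.

Lemma ipDl x y z : ip (y + z) x = ip y x + ip z x.
Proof. by rewrite !(ip_sym hH x) ipDr rmorphD. Qed.

Lemma ipZl (a : R[i]) x y : ip (a *: y) x = a^*%C * ip y x.
Proof. by rewrite !(ip_sym hH x) ipZr rmorphM. Qed.

Lemma ipNl x y : ip (- y) x = - ip y x.
Proof. by rewrite !(ip_sym hH x) ipNr rmorphN. Qed.

Lemma Im_ip x : cIm (ip x x) = 0.
Proof.
have := ip_sym hH x x; case: (ip x x) => a b [] /= /eqP.
by rewrite -subr_eq0 opprK -mulr2n mulrn_eq0/= => /eqP.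
Qed.

Lemma Re_ipC x y : cRe (ip y x) = cRe (ip x y).
Proof. by rewrite (ip_sym hH); case: (ip x y). Qed.

Lemma nsqD x y : nsq (x + y) = nsq x + nsq y + 2 * cRe (ip x y).
Proof.
rewrite !ipDr !ipDl !raddfD/= (Re_ipC x y); ring.
Qed.

Lemma nsqB x y : nsq (x - y) = nsq x + nsq y - 2 * cRe (ip x y).
Proof. by rewrite nsqD !ipNr !ipNl opprK !raddfN/= mulrN. Qed.

Lemma nsqZ (a : R[i]) x : nsq (a *: x) = (cRe a ^+ 2 + cIm a ^+ 2) * nsq x.
Proof.
rewrite ipZl ipZr; have := Im_ip x; case: (ip x x) => u v /= ->.
case: a => a b /=; ring.
Qed.

Lemma hnorm_ge0 x : 0 <= hn x.
Proof. exact: sqrtr_ge0. Qed.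

Lemma hnorm_sqr x : hn x ^+ 2 = nsq x.
Proof. by rewrite sqr_sqrtr// (ip_ge0 hH). Qed.

Lemma hnormZ (a : R[i]) x : hn (a *: x) = Normc.normc a * hn x.
Proof.
by rewrite /hnorm nsqZ sqrtrM ?addr_ge0 ?sqr_ge0//; case: a.
Qed.

Lemma hnorm_lt x (e : R) : 0 < e -> (hn x < e) = (nsq x < e ^+ 2).
Proof. by move=> e0; rewrite -hnorm_sqr ltr_pXn2r ?nnegrE ?hnorm_ge0 ?ltW. Qed.

Lemma hnorm_le x (e : R) : 0 <= e -> (hn x <= e) = (nsq x <= e ^+ 2).
Proof. by move=> e0; rewrite -hnorm_sqr ler_pXn2r ?nnegrE ?hnorm_ge0. Qed.

Lemma hnormN x : hn (- x) = hn x.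
Proof. by rewrite /hnorm ipNl ipNr opprK. Qed.

Lemma cauchy_schwarz_Re x y : cRe (ip x y) <= hn x * hn y.
Proof.
have [y0|y0] := eqVneq (nsq y) 0.
  rewrite {2}/hnorm y0 sqrtr0 mulr0 leNgt; apply/negP => c0.
  (* For [nsq y = 0] the square [nsq (x - t y)] is affine in [t]; this [t] gives it the value -1. *)
  pose t := (nsq x + 1) / (2 * cRe (ip x y)).
  have := ip_ge0 hH (x - t%:C *: y).
  rewrite nsqB nsqZ y0 mulr0 addr0 ipZr.
  have -> : cRe (t%:C * ip x y) = t * cRe (ip x y).
    by case: (ip x y) => a b /=; rewrite mul0r subr0.
  have -> : 2 * (t * cRe (ip x y)) = nsq x + 1.
    by rewrite /t; field; rewrite gt_eqF.
  lra.
have yp : 0 < nsq y by rewrite lt_neqAle eq_sym y0 (ip_ge0 hH).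
have h2 : cRe (ip x y) ^+ 2 <= nsq x * nsq y.
  pose t := cRe (ip x y) / nsq y.
  have := ip_ge0 hH (x - t%:C *: y).
  rewrite nsqB nsqZ ipZr /=.
  have -> : cRe (t%:C * ip x y) = t * cRe (ip x y).
    by case: (ip x y) => a b /=; rewrite mul0r subr0.
  rewrite expr0n /= addr0 => h.
  have -> : nsq x * nsq y = (nsq x + t ^+ 2 * nsq y - 2 * (t * cRe (ip x y))) * nsq y
     + cRe (ip x y) ^+ 2.
    by rewrite /t; field; rewrite gt_eqF.
  by rewrite lerDr mulr_ge0// (ip_ge0 hH).
have [c0|c0] := leP (cRe (ip x y)) 0.
  by rewrite (le_trans c0)// mulr_ge0 ?hnorm_ge0.
by rewrite -(@ler_pXn2r _ 2) ?nnegrE ?mulr_ge0 ?hnorm_ge0 ?(ltW c0)// exprMn !hnorm_sqr.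
Qed.

Lemma hnormD x y : hn (x + y) <= hn x + hn y.
Proof.
rewrite hnorm_le ?addr_ge0 ?hnorm_ge0// nsqD sqrrD !hnorm_sqr.
have := cauchy_schwarz_Re x y; rewrite -mulr_natl; lra.
Qed.

Lemma hnormB x y : hn (x - y) <= hn x + hn y.
Proof. by rewrite -(hnormN y) hnormD. Qed.

Lemma hnorm_sum (I : Type) (r : seq I) (P : pred I) (F : I -> H) :
  hn (\sum_(i <- r | P i) F i) <= \sum_(i <- r | P i) hn (F i).
Proof.
elim/big_rec2: _ => [|i y x _ h]; first by rewrite /hnorm ip0r sqrtr0.
by rewrite (le_trans (hnormD _ _))// lerD2l.
Qed.

Definition hcvg (u : nat -> H) x := (fun n => hn (u n - x)) @ \oo --> (0 : R).

Lemma hcvg_Re u x y : hcvg u x ->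
  (fun n => cRe (ip y (u n))) @ \oo --> cRe (ip y x).
Proof.
move=> ux; apply/cvgrPdist_le => e e0.
have e1 : 0 < e / (hn y + 1) by rewrite divr_gt0// ltr_wpDl ?hnorm_ge0.
move/cvgrPdist_lt : (ux) => /(_ _ e1); apply: filterS => n.
rewrite sub0r normrN ger0_norm ?hnorm_ge0// => h.
have K : hn y * hn (u n - x) <= e.
  rewrite (@le_trans _ _ ((hn y + 1) * (e / (hn y + 1))))//.
    by apply: ler_pM => //; rewrite ?hnorm_ge0 ?lerDl ?(ltW h).
  by rewrite mulrCA divff ?mulr1// gt_eqF// ltr_wpDl ?hnorm_ge0.
rewrite ler_norml; apply/andP; split.
  have := cauchy_schwarz_Re y (u n - x); rewrite ipBr raddfB/=; lra.
have := cauchy_schwarz_Re y (- (u n - x)).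
rewrite hnormN ipNr ipBr raddfN raddfB/=; lra.
Qed.

Lemma ip_i x y : cRe (ip x ('i *: y)) = - cIm (ip x y).
Proof. by rewrite ipZr; case: (ip x y) => a b /=; rewrite mul0r mul1r sub0r. Qed.

Lemma hcvg_Im u x y : hcvg u x ->
  (fun n => cIm (ip y (u n))) @ \oo --> cIm (ip y x).
Proof.
move=> /(@hcvg_Re _ _ (- ('i *: y))) h.
have e z : cRe (ip (- ('i *: y)) z) = - cIm (ip y z).
  by rewrite ipNl ipZl; case: (ip y z) => a b /=; ring.
move: h; rewrite e; under eq_fun do rewrite e.
by move=> h; rewrite -[cIm _]opprK; under eq_fun do rewrite -[cIm _]opprK; exact: cvgN.
Qed.

Lemma hcvg_ge0 u x : hcvg u x -> forall e : R, 0 < e ->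
  exists N, forall n, (N <= n)%N -> hn (u n - x) < e.
Proof.
move=> ux e e0; move/cvgrPdist_lt : ux => /(_ _ e0) [N _ h].
exists N => n Nn; have := h n Nn.
by rewrite /= sub0r normrN ger0_norm ?hnorm_ge0.
Qed.

(** [L] need not be closed, so the projection comes as the limit of a minimizing sequence in [L]:
    Cauchy by the parallelogram identity, orthogonal to [L] by the first variation of the
    distance. *)
Lemma orthogonal_projection (L : set H) f : Defs.subspace L ->
  exists u p, [/\ forall n, L (u n), hcvg u p & forall g, L g -> ip (f - p) g = 0].
Proof.
move=> [L0 LD].
pose E := [set nsq (f - g) | g in L].
have E0 : has_inf E.
  split; first by exists (nsq (f - 0)); exists 0.
  by exists 0 => _ [g _ <-]; exact: (ip_ge0 hH).
pose d := inf E.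
have dle g : L g -> d <= nsq (f - g).
  by move=> Lg; apply: ge_inf; [case: E0|exists g].
have /choice[u hu] : forall n : nat, exists g, L g /\ nsq (f - g) < d + n.+1%:R^-1.
  move=> n; have e0 : 0 < n.+1%:R^-1 :> R by rewrite invr_gt0.
  by have [_ [g Lg <-] h] := inf_adherent e0 E0; exists g.
(* Parallelogram identity: the midpoint of [u m] and [u n] lies in [L], so its squared distance to
   [f] is at least [d]. *)
have uc m n : nsq (u m - u n) <= 2 * m.+1%:R^-1 + 2 * n.+1%:R^-1.
  have [Lm hm] := hu m; have [Ln hn'] := hu n.
  have Lmn : L ((2^-1)%:C *: u m + ((2^-1)%:C *: u n + 0)).
    by apply: (LD) => //; apply: (LD).
  have := dle _ Lmn.
  set a := f - u m in hm *; set b := f - u n in hn' *.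
  have -> : f - ((2^-1)%:C *: u m + ((2^-1)%:C *: u n + 0)) = (2^-1)%:C *: (a + b).
    rewrite addr0 /a /b addrACA !scalerDr !scalerN -opprD; congr (_ - _).
    by rewrite -scalerDl -raddfD/= (_ : 2^-1 + 2^-1 = 1 :> R) ?scale1r//; field.
  have -> : u m - u n = b - a by rewrite /a /b opprB [RHS]addrC addrA subrK.
  rewrite nsqZ nsqB nsqD (Re_ipC a b) /= expr0n /= addr0.
  rewrite (_ : 2^-1 ^+ 2 = 4^-1 :> R); last by field.
  move: (nsq a) (nsq b) (cRe (ip a b)) (m.+1%:R^-1) (n.+1%:R^-1) hm hn' => A B C x y.
  lra.
have [p up] : exists p, hcvg u p.
  apply: (ip_complete hH) => e e0.
  have e2 : 0 < e ^+ 2 / 8 by rewrite divr_gt0 ?exprn_gt0.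
  have [N _ hN] := near_infty_natSinv_lt (PosNum e2).
  exists N => m n Nm Nn; rewrite hnorm_lt//.
  have := uc m n; have /= := hN m Nm; have /= := hN n Nn.
  move: (n.+1%:R^-1) (m.+1%:R^-1) => x y; nra.
exists u, p; split=> //; first by move=> n; case: (hu n).
(* Moving [u n] by [a *: g] lowers the squared distance by less than [1 / (n + 1)]; then [n] tends
   to infinity. *)
have key g : L g -> forall a : R[i], 2 * cRe (ip (f - p) (a *: g)) <= nsq (a *: g).
  move=> Lg a.
  have c1 : (fun n => 2 * cRe (ip (a *: g) (f - u n))) @ \oo -->
      2 * cRe (ip (a *: g) (f - p)).
    apply: cvgMr; rewrite ipBr raddfB/=.
    under eq_fun do rewrite ipBr raddfB/=.
    by apply: cvgB; [exact: cvg_cst|exact: hcvg_Re].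
  have c2 : (fun n : nat => nsq (a *: g) + n.+1%:R^-1 : R) @ \oo --> nsq (a *: g) + 0.
    by apply: cvgD; [exact: cvg_cst|exact: cvg_harmonic].
  rewrite Re_ipC -[leRHS]addr0.
  apply: (ler_cvg_to c1 c2); apply: nearW => n.
  have [Ln hn'] := hu n.
  have := dle _ (LD a _ _ Lg Ln).
  rewrite [_ *: _ + _]addrC opprD addrA nsqB (Re_ipC (a *: g)).
  move: hn'; move: (n.+1%:R^-1) => x; lra.
have key0 g : L g -> cRe (ip (f - p) g) = 0.
  move=> Lg; apply/eqP; rewrite eq_le; apply/andP.
  have Ht t : 2 * t * cRe (ip (f - p) g) <= t ^+ 2 * nsq g.
    have := key g Lg t%:C; rewrite nsqZ ipZr /= expr0n addr0.
    by case: (ip (f - p) g) => x y /=; rewrite mul0r subr0 mulrA.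
  set c := cRe _ in Ht *; set q := nsq g in Ht.
  have q0 : 0 <= q := ip_ge0 hH g.
  (* The optimal [c / q], shifted to remain meaningful when [q = 0]. *)
  have := Ht (c / (q + 1)); rewrite -subr_ge0.
  have -> : (c / (q + 1)) ^+ 2 * q - 2 * (c / (q + 1)) * c =
     - (c / (q + 1)) ^+ 2 * (q + 2) by field; rewrite gt_eqF// ltr_wpDl.
  rewrite mulNr oppr_ge0 => h.
  have /eqP : (c / (q + 1)) ^+ 2 = 0.
    apply/eqP; rewrite eq_le sqr_ge0 andbT -(@pmulr_lle0 _ (q + 2)) ?ltr_wpDl//.
  rewrite sqrf_eq0 mulf_eq0 invr_eq0 (gt_eqF (ltr_wpDl q0 ltr01)) orbF => /eqP ->.
  by rewrite lexx.
move=> g Lg; apply/eqP; rewrite eq_complex key0//= eqxx/=.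
have Lig : L ('i *: g) by rewrite -[_ *: _]addr0; exact: LD.
by have := key0 _ Lig; rewrite ip_i => /eqP; rewrite oppr_eq0.
Qed.

(** * Resolvents of a selfadjoint operator and chains of vectors *)

Section Selfadjoint.
Context (M : set H) (B : operator H).
Context (M_sub : Defs.subspace M) (M_closed : hclosed ip M).
Context (B_sa : selfadjoint_in ip M B).

Local Notation D := (dom B).

Lemma sa_graph u v : M u -> M v ->
  (forall w, D w -> ip u (act B w) = ip v w) -> D u /\ act B u = v.
Proof.
move=> Mu Mv h; case: B_sa => _ _ _ e.
by have : adjoint_graph_in ip M B (u, v) by []; rewrite e.
Qed.

Lemma sa_sym u w : D u -> D w -> ip u (act B w) = ip (act B u) w.
Proof.
move=> Du Dw; case: B_sa => _ _ _ e.
have : graph B (u, act B u) by [].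
by rewrite -e => -[_ _ /(_ w Dw)].
Qed.

Lemma sa_dom u : D u -> M u.
Proof. by case: B_sa => h _ _ _; exact: h. Qed.

Lemma sa_act u : D u -> M (act B u).
Proof. by case: B_sa => _ h _ _ Du; apply: h; exists u. Qed.

(** An [operator] is an arbitrary map on a set. Its linearity is inherited from the adjoint
    relation, which is linear and coincides with the graph. *)
Lemma sa_lin (a : R[i]) u v : D u -> D v ->
  D (a *: u + v) /\ act B (a *: u + v) = a *: act B u + act B v.
Proof.
move=> Du Dv; case: M_sub => _ MD.
apply: sa_graph; [by apply: MD; exact: sa_dom|by apply: MD; exact: sa_act|].
by move=> w Dw; rewrite !ipDl !ipZl !sa_sym.
Qed.

Lemma sa0 : D 0 /\ act B 0 = 0.
Proof.
case: M_sub => M0 _; apply: sa_graph => // w _.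
by rewrite !(ip_sym hH _ 0) !ip0r.
Qed.

Lemma sa_sum (I : Type) (r : seq I) (c : I -> R[i]) (F : I -> H) :
  (forall i, D (F i)) ->
  D (\sum_(i <- r) c i *: F i) /\
  act B (\sum_(i <- r) c i *: F i) = \sum_(i <- r) c i *: act B (F i).
Proof.
move=> DF; elim: r => [|i r [Dr Br]]; first by rewrite !big_nil; exact: sa0.
by rewrite !big_cons -Br; exact: sa_lin.
Qed.

Lemma sa_real u : D u -> cIm (ip u (act B u)) = 0.
Proof.
move=> Du; have := sa_sym Du Du; rewrite (ip_sym hH u (act B u)).
case: (ip u _) => a b [] /= /eqP.
by rewrite -subr_eq0 opprK -mulr2n mulrn_eq0/= => /eqP.
Qed.

(** Since [ip u (act B u)] is real, [Im <u, (B - z) u> = - Im z |u|^2]; Cauchy-Schwarz does the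
    rest. *)
Lemma sa_lower (z : R[i]) u : D u ->
  `|cIm z| * hn u <= hn (act B u - z *: u).
Proof.
move=> Du.
have [u0|u0] := eqVneq (hn u) 0; first by rewrite u0 mulr0 hnorm_ge0.
have up : 0 < hn u by rewrite lt_neqAle eq_sym u0 hnorm_ge0.
rewrite -(ler_pM2l up).
have e : cIm (ip u (act B u - z *: u)) = - cIm z * hn u ^+ 2.
  rewrite ipBr raddfB/= (sa_real Du) ipZr hnorm_sqr; have := Im_ip u.
  case: (ip u u) => a b /= ->; case: z => c d /=; ring.
(* Multiplication by ['i] and by [- 'i] turns the bound on real parts into both signs of the
   imaginary part. *)
have h1 := cauchy_schwarz_Re u ('i *: (act B u - z *: u)).
have h2 := cauchy_schwarz_Re u (- ('i *: (act B u - z *: u))).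
move: h1 h2; rewrite ipNr hnormN raddfN/= ip_i e hnormZ /=.
rewrite expr0n expr1n add0r sqrtr1 mul1r.
by case: (ger0P (cIm z)) => _; move: (hn _) (hn _) (cIm z) => x y c; lra.
Qed.

(** The component of [g] orthogonal to the range of [B - z] is an eigenvector for the conjugate of
    [z], hence of norm 0 by [sa_lower]. The same estimate makes preimages of a convergent sequence
    Cauchy. *)
Lemma sa_resolvent (z : R[i]) g : cIm z != 0 -> M g ->
  exists u, [/\ D u, act B u = z *: u + g & hn u <= hn g / `|cIm z|].
Proof.
move=> z0 Mg; have [M0 MD] := M_sub.
have z0' : 0 < `|cIm z| by rewrite normr_gt0.
pose L := [set act B u - z *: u | u in D].
have subL : Defs.subspace L.
  split; first by exists 0; have [D0 B0] := sa0 => //; rewrite B0 scaler0 subrr.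
  move=> a _ _ [u Du <-] [v Dv <-]; have [Duv Buv] := sa_lin a Du Dv.
  exists (a *: u + v) => //; rewrite Buv scalerDr scalerBr !scalerA [z * a]mulrC.
  by rewrite opprD addrACA.
have MB u v : M u -> M v -> M (u - v).
  by move=> Mu Mv; rewrite addrC -scaleN1r; exact: MD.
have MZ (a : R[i]) u : M u -> M (a *: u).
  by move=> Mu; rewrite -[a *: u]addr0; exact: MD.
have LM : L `<=` M.
  by move=> _ [u Du <-]; apply: MB; [exact: sa_act|apply: MZ; exact: sa_dom].
have [y [p [Ly yp ort]]] := orthogonal_projection g subL.
have Mp : M p by apply: M_closed yp => n; exact: LM.
set r := g - p in ort.
have Mr : M r by exact: MB.
have [Dr Br] : D r /\ act B r = z^*%C *: r.
  apply: sa_graph => //; first exact: MZ.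
  move=> w Dw; have := ort _ (ex_intro2 _ _ w Dw erefl).
  rewrite ipBr ipZl ipZr => /eqP; rewrite subr_eq0 => /eqP ->; congr (_ * _).
  by case: (z) => a b /=; rewrite opprK.
have r0 : hn r = 0.
  have := sa_lower z^*%C Dr; rewrite Br subrr /hnorm ip0r sqrtr0.
  have -> : cIm z^*%C = - cIm z by case: (z).
  rewrite normrN => h; apply/eqP; rewrite eq_le sqrtr_ge0 andbT.
  by rewrite -(ler_pM2l z0') mulr0.
have /choice[u hu] : forall n, exists w, D w /\ act B w - z *: w = y n.
  by move=> n; have [w Dw <-] := Ly n; exists w.
have Du n : D (u n) by case: (hu n).
(* Only [hn r = 0] is known, not [r = 0], but this suffices for [y] to converge to [g] itself. *)
have yg e : 0 < e -> exists N, forall n, (N <= n)%N -> hn (y n - g) < e.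
  move=> e0; have [N hN] := hcvg_ge0 yp e0; exists N => n /hN h.
  have -> : y n - g = (y n - p) - r by rewrite /r opprB addrA subrK.
  by rewrite (le_lt_trans (hnormB _ _))// r0 addr0.
have [x ux] : exists x, hcvg u x.
  apply: (ip_complete hH) => e e0.
  have e1 : 0 < e * `|cIm z| / 2 by rewrite divr_gt0 ?mulr_gt0.
  have [N hN] := yg _ e1; exists N => m n Nm Nn.
  have [Dmn Bmn] := sa_lin (-1) (Du n) (Du m).
  have := sa_lower z Dmn; rewrite Bmn !scaleN1r.
  have -> : - act B (u n) + act B (u m) - z *: (- u n + u m) = y m - y n.
    rewrite -(proj2 (hu m)) -(proj2 (hu n)) scalerDr scalerN opprD opprK opprB.
    by rewrite [- act B _ + _]addrC [LHS]addrACA [RHS]addrACA; congr (_ + _); exact: addrC.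
  rewrite addrC -(ltr_pM2l z0') => h; rewrite (le_lt_trans h)//.
  have -> : y m - y n = (y m - g) - (y n - g) by rewrite opprB addrA subrK.
  rewrite (le_lt_trans (hnormB _ _))//.
  have := hN _ Nm; have := hN _ Nn; lra.
have Mx : M x by apply: M_closed ux => n; exact: sa_dom.
(* Closedness of [B]: the adjoint identity holds for each [u n] and passes to the limit. *)
have [Dx Bx] : D x /\ act B x = z *: x + g.
  apply: sa_graph => //; first by exact: MD.
  move=> w Dw.
  have yg' : hcvg y g.
    apply/cvgrPdist_lt => e e0; have [N hN] := yg e e0; exists N => // n /hN.
    by rewrite /= sub0r normrN ger0_norm ?hnorm_ge0.
  have eqn n : ip (act B w) (u n) = z * ip w (u n) + ip w (y n).
    rewrite -(proj2 (hu n)) ipBr ipZr addrC subrK; apply/esym; exact: sa_sym.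
  suff : ip (act B w) x = z * ip w x + ip w g.
    by rewrite -ipZr -ipDr (ip_sym hH (act B w)) => ->; rewrite -(ip_sym hH).
  apply/eqP; rewrite eq_complex; apply/andP; split; apply/eqP.
    apply: (cvg_unique _ (hcvg_Re ux)); first exact: norm_hausdorff.
    rewrite /=; under eq_fun do rewrite eqn raddfD/=.
    rewrite raddfD/=; apply: cvgD; last exact: hcvg_Re.
    under eq_fun do rewrite cReM.
    by rewrite cReM; apply: cvgB; apply: cvgMr; [exact: hcvg_Re|exact: hcvg_Im].
  apply: (cvg_unique _ (hcvg_Im ux)); first exact: norm_hausdorff.
  rewrite /=; under eq_fun do rewrite eqn raddfD/=.
  rewrite raddfD/=; apply: cvgD; last exact: hcvg_Im.
  under eq_fun do rewrite cImM.
  by rewrite cImM; apply: cvgD; apply: cvgMr; [exact: hcvg_Im|exact: hcvg_Re].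
exists x; split=> //; rewrite ler_pdivlMr// mulrC.
by have := sa_lower z Dx; rewrite Bx [_ + g]addrC addrK.
Qed.

(* Discretizes the contour integrals of [(z^2 - r^2) z^j (B - z)^-1 (B f)] over
   the circle [|z| = r]: the weight [z^2 - r^2] vanishes on the real axis and
   compensates the factor [1 / |Im z|] of the resolvent bound. *)
Lemma sa_chain f (r : R) m : D f -> 0 < r -> exists (N : nat) (w : nat -> H),
  [/\ (0 < N)%N, forall j, D (w j),
      forall j, (j < m.+1)%N -> act B (w j) = w j.+1,
      hn (w m.+1) <= N%:R * 2 * r ^+ m.+2 * hn (act B f)
    & hn (w 0%N - (N%:R * r ^+ 2)%:C *: f) <= N%:R * 2 * r * hn (act B f)].
Proof.
move=> Df r0; set g := act B f.
(* A large [N] keeps the exponents [j] and [j + 2], for [j <= m], below [N]; primality serves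
   [exists_prim_root]. *)
have [N mN Np] := prime_above m.+3.
have N0 : (0 < N)%N by exact: leq_trans mN.
have [om omN] := exists_prim_root (@pchar_num R[i]) Np.
have no : Normc.normc om = 1 by exact: normc_prim_root omN.
pose z k := r%:C * om ^+ k.
have nz k : Normc.normc (z k) = r.
  rewrite Normc.normcM normcX no expr1n mulr1 /= expr0n addr0 sqrtr_sqr.
  by rewrite ger0_norm// ltW.
pose c k := z k ^+ 2 - (r ^+ 2)%:C.
have nc k : Normc.normc (c k) = 2 * r * `|cIm (z k)|.
  have := nz k; rewrite /c; case: (z k) => a b /= rE.
  have ab : a ^+ 2 + b ^+ 2 = r ^+ 2 by rewrite -rE sqr_sqrtr// addr_ge0 ?sqr_ge0.
  rewrite -ab expr2 /= subr0.
  have -> : (a * a - b * b - (a ^+ 2 + b ^+ 2)) ^+ 2 + (a * b + b * a) ^+ 2 =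
      (2 * r * b) ^+ 2 by rewrite !exprMn -ab; ring.
  by rewrite sqrtr_sqr !normrM (gtr0_norm r0) gtr0_norm.
have Mg : M g by exact: sa_act.
(* At a real node the resolvent may not exist, but there the weight vanishes: the equation carries
   the factor [c k], and [u = 0] serves. *)
have /choice[u hu] : forall k, exists u, [/\ D u,
    c k *: act B u = c k *: (z k *: u + g) & `|cIm (z k)| * hn u <= hn g].
  move=> k; have [z0|z0] := eqVneq (cIm (z k)) 0.
    have c0 : c k = 0 by apply: Normc.eq0_normc; rewrite nc z0 normr0 mulr0.
    exists 0; rewrite c0 !scale0r z0 normr0 mul0r; split => //.
      by case: sa0.
    exact: hnorm_ge0.
  have [u [Du Bu hu]] := sa_resolvent z0 Mg.
  exists u; rewrite Bu; split => //.
  by rewrite mulrC -ler_pdivlMr ?normr_gt0.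
have Du k : D (u k) by case: (hu k).
pose v j := \sum_(k < N) (c k * z k ^+ j) *: u k.
have DBv j := sa_sum (index_enum _) (fun k : 'I_N => c k * z k ^+ j) (fun k : 'I_N => Du k).
have Dv j : D (v j) by case: (DBv j).
pose s j : R[i] := \sum_(k < N) c k * z k ^+ j.
have Bv j : act B (v j) = v j.+1 + s j *: g.
  rewrite (proj2 (DBv j)) /v /s scaler_suml -big_split; apply: eq_bigr => k _ /=.
  have -> : (c k * z k ^+ j) *: act B (u k) = z k ^+ j *: (c k *: act B (u k)).
    by rewrite scalerA mulrC.
  have [_ -> _] := hu k.
  by rewrite !scalerDr !scalerA exprS; congr (_ *: _ + _ *: _); ring.
have sE j : s j = (r ^+ (j + 2))%:C * (\sum_(k < N) (om ^+ k) ^+ (j + 2) -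
    \sum_(k < N) (om ^+ k) ^+ j).
  rewrite /s -sumrB mulr_sumr; apply: eq_bigr => k _.
  by rewrite /c /z !exprD !rmorphM !rmorphXn /= !exprMn; ring.
(* The only surviving moment: [B (v 0) = v 1 - N r^2 B f], so adding [N r^2 f] to [v 0] starts an
   exact chain. *)
have s0 : s 0%N = - (N%:R * r ^+ 2)%:C.
  rewrite sE prim_root_sum ?(leq_trans _ mN)// sub0r.
  under eq_bigr do rewrite expr0.
  rewrite sumr_const card_ord add0n mulrN mulrC -(rmorph_nat (@real_complex R)).
  by rewrite -rmorphM.
have sj j : (0 < j)%N -> (j < m.+1)%N -> s j = 0.
  move=> j0 jm; rewrite sE !prim_root_sum ?subrr ?mulr0 ?j0 ?addn_gt0 ?orbT//=.
    by rewrite (leq_trans _ mN)// ltnS leqW// leqW// ltnW.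
  by rewrite (leq_trans _ mN)// addn2 !ltnS ltnW.
have nv j : hn (v j) <= N%:R * 2 * r ^+ j.+1 * hn g.
  rewrite (le_trans (hnorm_sum _ _ _))//.
  rewrite (@le_trans _ _ (\sum_(k < N) 2 * r ^+ j.+1 * hn g))//; last first.
    by rewrite sumr_const card_ord -[leLHS]mulr_natl !mulrA.
  apply: ler_sum => k _; rewrite hnormZ Normc.normcM normcX nz nc.
  have [_ _ h] := hu k.
  have -> : 2 * r * `|cIm (z k)| * r ^+ j * hn (u k) =
      2 * r ^+ j.+1 * (`|cIm (z k)| * hn (u k)) by rewrite exprS; ring.
  by rewrite ler_wpM2l// mulr_ge0// exprn_ge0// ltW.
exists N, (fun j => if j is j'.+1 then v j else v 0%N + (N%:R * r ^+ 2)%:C *: f).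
split => //=.
- case=> [|j] //.
  by have [] := sa_lin (N%:R * r ^+ 2)%:C Df (Dv 0%N); rewrite addrC.
- case=> [|j] jm; last by rewrite Bv sj// scale0r addr0.
  have [_] := sa_lin (N%:R * r ^+ 2)%:C Df (Dv 0%N); rewrite addrC => ->.
  by rewrite Bv s0 scaleNr addrC subrK.
by rewrite addrK; have := nv 0%N; rewrite expr1.
Qed.

End Selfadjoint.

End HilbertSpace.

(** * Real L^2: integrability and completeness *)

Section RealL2.
Context d (T : measurableType d) (R : realType).
Context (mu : {measure set T -> \bar R}).
Implicit Types f g : T -> R.

Local Notation integ f := (mu.-integrable setT (EFin \o f)).
Local Notation I f := (\int[mu]_x f x).

Lemma ae_and (P Q : T -> Prop) : {ae mu, forall x, P x} ->
  {ae mu, forall x, Q x} -> {ae mu, forall x, P x /\ Q x}.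
Proof. by apply: (@filterS2 _ _ (ae_filter_ringOfSetsType _)). Qed.

Lemma ae_imp (P Q : T -> Prop) : {ae mu, forall x, P x} ->
  (forall x, P x -> Q x) -> {ae mu, forall x, Q x}.
Proof. by move=> h PQ; move: h; apply: filterS. Qed.

Lemma Lfun2P f : f \in Lfun mu 2%:E <->
  measurable_fun setT f /\ integ (fun x => f x ^+ 2).
Proof.
split=> [fL|[mf /integrableP[_ fi]]].
  split; last exact: Lfun2_integrable_sqr.
  by have /set_mem := sub_Lfun_mfun fL.
rewrite inE; apply/andP; split; rewrite inE//= /finite_norm unlock.
rewrite poweR_lty// (le_lt_trans _ fi)// le_eqVlt; apply/orP; left; apply/eqP.
by apply: eq_integral => x _ /=; rewrite normrX powR_mulrn.
Qed.

Lemma Lfun2_measurable f : f \in Lfun mu 2%:E -> measurable_fun setT f.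
Proof. by move=> /Lfun2P[]. Qed.

Lemma Lfun2_mul f g : f \in Lfun mu 2%:E -> g \in Lfun mu 2%:E ->
  integ (fun x => f x * g x).
Proof. by move=> fL gL; apply/Lfun1_integrable; exact: Lfun2_mul_Lfun1. Qed.

Lemma Lfun2_lin (a : R) f g : f \in Lfun mu 2%:E -> g \in Lfun mu 2%:E ->
  (fun x => a * f x + g x) \in Lfun mu 2%:E.
Proof.
have p1 : ((1 : \bar R) <= 2%:E)%E by rewrite lee_fin ler1n.
by have [_ P] := @Lfun_submod_closed _ _ _ mu 2%:E p1; exact: (P a).
Qed.

Lemma Lfun2D f g : f \in Lfun mu 2%:E -> g \in Lfun mu 2%:E ->
  (fun x => f x + g x) \in Lfun mu 2%:E.
Proof.
move=> fL gL; rewrite (_ : (fun _ => _) = (fun x => 1 * f x + g x)).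
  exact: Lfun2_lin.
by apply/funext => x; rewrite mul1r.
Qed.

Lemma Lfun2B f g : f \in Lfun mu 2%:E -> g \in Lfun mu 2%:E ->
  (fun x => f x - g x) \in Lfun mu 2%:E.
Proof.
move=> fL gL; rewrite (_ : (fun _ => _) = (fun x => -1 * g x + f x)).
  exact: Lfun2_lin.
by apply/funext => x; rewrite mulN1r addrC.
Qed.

Lemma integrable_scale (A : set T) f (c : R) : measurable A ->
  mu.-integrable A (EFin \o f) -> mu.-integrable A (EFin \o (fun x => c * f x)).
Proof. by move=> mA fi; exact: (integrableZl mA c fi). Qed.

Lemma integrable_add (A : set T) f g : measurable A -> mu.-integrable A (EFin \o f) ->
  mu.-integrable A (EFin \o g) -> mu.-integrable A (EFin \o (fun x => f x + g x)).
Proof. by move=> mA fi gi; exact: (integrableD mA fi gi). Qed.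

Lemma integrable_sub (A : set T) f g : measurable A -> mu.-integrable A (EFin \o f) ->
  mu.-integrable A (EFin \o g) -> mu.-integrable A (EFin \o (fun x => f x - g x)).
Proof. by move=> mA fi gi; exact: (integrableB mA fi gi). Qed.

Lemma integrable_mul_bounded (A : set T) f g (C : R) : measurable A ->
  mu.-integrable A (EFin \o f) -> measurable_fun A g ->
  (forall x, A x -> `|g x| <= C) -> mu.-integrable A (EFin \o (fun x => f x * g x)).
Proof.
move=> mA fi mg gC.
rewrite (_ : _ \o _ = (EFin \o f) \* (EFin \o g))%E; last by [].
apply: integrableMl => //; exists C; split; first exact: num_real.
by move=> M CM x Ax; exact: le_trans (gC _ Ax) (ltW CM).
Qed.

Lemma ae_eq_Rintegral f g : measurable_fun setT f -> measurable_fun setT g ->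
  {ae mu, forall x, f x = g x} -> I f = I g.
Proof.
move=> mf mg fg; congr fine; apply: ae_eq_integral => //; do ?exact/measurable_EFinP.
by apply: filterS fg => x -> _.
Qed.

Lemma Rdominated_cvg (D : set T) (f_ : nat -> T -> R) f g : measurable D ->
  (forall n, measurable_fun D (f_ n)) -> measurable_fun D f ->
  {ae mu, forall x, D x -> f_ ^~ x @ \oo --> f x} ->
  mu.-integrable D (EFin \o g) -> (forall n x, D x -> `|f_ n x| <= g x) ->
  (fun n => \int[mu]_(x in D) f_ n x) @ \oo --> \int[mu]_(x in D) f x.
Proof.
move=> mD mf_ mf ff ig fg.
have [|||||fi _ c] := @dominated_convergence _ _ _ mu D mD (fun n => EFin \o f_ n)
    (EFin \o f) (EFin \o g).
- by move=> n; exact/measurable_EFinP.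
- exact/measurable_EFinP.
- by apply: filterS ff => x h Dx; apply: cvg_EFin; [exact: nearW|exact: h].
- by [].
- by apply: aeW => x n Dx; rewrite lee_fin fg.
by apply: fine_cvg; rewrite fineK//; exact: integrable_fin_num.
Qed.

(** Riesz-Fischer: a fast subsequence converges almost everywhere, and Fatou's lemma turns the
    pointwise limit into an L^2 limit of the whole sequence. *)
Lemma Lfun2_complete (u : nat -> T -> R) :
  (forall n, u n \in Lfun mu 2%:E) ->
  (forall e : R, 0 < e -> exists N, forall m n, (N <= m)%N -> (N <= n)%N ->
     I (fun x => (u m x - u n x) ^+ 2) < e) ->
  exists2 v, v \in Lfun mu 2%:E &
    forall e : R, 0 < e -> exists N, forall n, (N <= n)%N ->
     I (fun x => (u n x - v x) ^+ 2) <= e.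
Proof.
move=> uL uC.
have mu_ n : measurable_fun setT (u n) by exact: Lfun2_measurable.
have iB m n : integ (fun x => (u m x - u n x) ^+ 2).
  by apply: Lfun2_integrable_sqr; exact: Lfun2B.
(* The rate [8^-k] leaves a summable [4^-k] after the weight [2^k] that is put on the squared
   increments. *)
have /choice[N hN] : forall k : nat, exists N, forall m n, (N <= m)%N -> (N <= n)%N ->
    I (fun x => (u m x - u n x) ^+ 2) < (8^-1) ^+ k.
  by move=> k; apply: uC; rewrite exprn_gt0.
(* Partial sums of [(N i).+1] give a monotone choice of indices that dominates both [N k] and
   [k]. *)
pose s k := (\sum_(i < k.+1) (N i).+1)%N.
have sN k : (N k <= s k)%N.
  by rewrite /s big_ord_recr/= (leq_trans (leqnSn _))// leq_addl.
have ss k : (s k <= s k.+1)%N by rewrite /s [leqRHS]big_ord_recr/= leq_addr.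
have sk k : (k <= s k)%N.
  elim: k => // k IHk; by rewrite /s big_ord_recr/= addnS ltnS (leq_trans IHk)// leq_addr.
pose w k := u (s k).
pose dk k x := w k.+1 x - w k x.
have Idk k : I (fun x => dk k x ^+ 2) < (8^-1) ^+ k.
  by apply: hN => //; exact: leq_trans (ss k).
pose g k x : \bar R := (2 ^+ k * dk k x ^+ 2)%:E.
have g0 k x : setT x -> (0 <= g k x)%E.
  by move=> _; rewrite lee_fin mulr_ge0 ?sqr_ge0 ?exprn_ge0.
have mg k : measurable_fun setT (g k).
  apply/measurable_EFinP; apply: measurable_funM => //; apply: measurable_funX.
  by apply: measurable_funB; exact: mu_.
pose S x := (\sum_(0 <= k <oo) g k x)%E.
have S0 x : (0 <= S x)%E by apply: nneseries_ge0 => n _ _; exact: g0.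
have mS : measurable_fun setT S.
  by apply: ge0_emeasurable_sum => // k x _ _; exact: g0.
have iS : (\int[mu]_x S x < +oo)%E.
  rewrite integral_nneseries//.
  apply: (@le_lt_trans _ _ (\sum_(0 <= k <oo) ((4^-1) ^+ k)%:E)%E).
    apply: lee_nneseries => [k *|k *].
      by apply: integral_ge0 => x _; exact: g0.
    have := ltW (Idk k); rewrite -lee_fin fineK; last first.
      by apply: integrable_fin_num => //; exact: iB.
    move=> h; rewrite /g; under eq_integral do rewrite EFinM.
    rewrite integralZl//; last exact: iB.
    apply: (@le_trans _ _ ((2 ^+ k)%:E * ((8^-1) ^+ k)%:E)%E).
      by rewrite lee_pmul2l// lte_fin exprn_gt0.
    by rewrite -EFinM lee_fin -exprMn (_ : 2 * 8^-1 = 4^-1 :> R)//; field.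
  have q1 : `|4^-1| < 1 :> R by rewrite ger0_norm// invf_lt1// ltr1n.
  have cg := @is_cvg_geometric_series R 1 _ q1.
  have -> : (\sum_(0 <= k <oo) ((4^-1 : R) ^+ k)%:E)%E =
      (limn (series (geometric (1 : R) (4^-1 : R)) : R^nat))%:E.
    rewrite -EFin_lim//; apply: congr_lim; apply/funext => n /=.
    rewrite /series/= -sumEFin; apply: eq_bigr => k _.
    by rewrite /geometric/= mul1r.
  exact: ltry.
have iS' : mu.-integrable setT S.
  by apply/integrableP; split=> //; under eq_integral do rewrite gee0_abs//.
pose A := [set x | (S x < +oo)%E].
have mA : measurable A.
  by rewrite -[A]setTI; exact: emeasurable_fun_infty_o.
have aeA : {ae mu, forall x, A x}.
  apply: filterS (integrable_ae measurableT iS') => x /(_ Logic.I).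
  by rewrite ge0_fin_numE.
have wcvg x : A x -> cvgn (w ^~ x).
  move=> Ax.
  have cd : cvgn (series (dk ^~ x)).
    apply: normed_cvg.
    (* [|d| <= 2^k d^2 + 2^-k], so finiteness of [S x] gives absolute convergence of the
       increments. *)
    apply: (@series_le_cvg _ _ (fun k => 2 ^+ k * dk k x ^+ 2 + (2^-1) ^+ k)) => //.
    - by move=> k /=.
    - move=> k; apply: addr_ge0; last by rewrite exprn_ge0// invr_ge0.
      by rewrite mulr_ge0 ?sqr_ge0 ?exprn_ge0.
    - move=> k /=; have p2 : 0 < 2 ^+ k :> R by rewrite exprn_gt0.
      rewrite exprVn -(ler_pM2l p2) mulrDr divff ?gt_eqF//.
      rewrite mulrA -expr2 -exprMn -real_normK ?num_real// normrM (gtr0_norm p2).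
      have := sqr_ge0 (2 ^+ k * `|dk k x| - 2^-1); rewrite sqrrB.
      move: (_ * _) => y; lra.
    rewrite [X in cvgn X](_ : _ = series (fun k => 2 ^+ k * dk k x ^+ 2) +
        series (geometric 1 2^-1)); last first.
      apply/funext => n; rewrite /series/= [RHS]/GRing.add/= -big_split/=.
      by apply: eq_bigr => k _; rewrite mul1r.
    apply: is_cvgD.
      by apply: nnseries_is_cvg => // k; rewrite mulr_ge0 ?sqr_ge0 ?exprn_ge0.
    by apply: is_cvg_geometric_series; rewrite ger0_norm// invf_lt1// ltr1n.
  rewrite (_ : w ^~ x = fun n => w 0%N x + series (dk ^~ x) n); last first.
    by apply/funext => n; rewrite (eq_sum_telescope (w ^~ x) n).
  by apply: is_cvgD; [exact: is_cvg_cst|].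
(* Cutting off outside [A] makes the sequence converge everywhere, so that its limit is
   measurable. *)
pose v_ k := w k \_ A.
pose v x := limn (v_ ^~ x).
have vcvg x : v_ ^~ x @ \oo --> v x.
  have [Ax|nAx] := pselect (A x).
    rewrite /v (_ : v_ ^~ x = w ^~ x); first exact: wcvg.
    by apply/funext => k; rewrite /v_ patchE mem_set.
  rewrite /v (_ : v_ ^~ x = fun=> 0); first exact: is_cvg_cst.
  by apply/funext => k; rewrite /v_ patchE memNset.
have mv_ k : measurable_fun setT (v_ k).
  by apply/(measurable_restrictT (w k) mA); apply: measurable_funTS; exact: mu_.
have mv : measurable_fun setT v.
  by apply: (@measurable_fun_cvg _ _ _ setT v_).
(* Stated in the extended reals, because integrability of [(u n - v)^2] is still to be deduced from
   it. *)
have key (e : R) M n : (forall m, (M <= m)%N -> I (fun x => (u n x - u m x) ^+ 2) < e) ->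
    (\int[mu]_x ((u n x - v x) ^+ 2)%:E <= e%:E)%E.
  move=> h.
  pose F k x : \bar R := ((u n x - v_ k x) ^+ 2)%:E.
  have mF k : measurable_fun setT (F k).
    by apply/measurable_EFinP; apply: measurable_funX; exact: measurable_funB.
  have F0 k x : setT x -> (0 <= F k x)%E by move=> _; rewrite lee_fin sqr_ge0.
  have := fatou mu measurableT mF F0.
  have -> : (\int[mu]_x limn_einf (F ^~ x) = \int[mu]_x ((u n x - v x) ^+ 2)%:E)%E.
    apply: eq_integral => x _.
    have c : F ^~ x @ \oo --> ((u n x - v x) ^+ 2)%:E.
      apply: cvg_EFin; first by apply: nearW.
      have c1 : (fun k => u n x - v_ k x) @ \oo --> u n x - v x.
        by apply: cvgB => //; exact: cvg_cst.
      exact: (cvgM c1 c1).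
    by rewrite (cvg_limn_einf_sup c).
  move/le_trans; apply.
  rewrite limn_einf_lim; apply: lime_le; first exact: is_cvg_einfs.
  apply: nearW => k; apply: (@le_trans _ _ (\int[mu]_x F (maxn k M) x)%E).
    by apply: ereal_inf_lbound; exists (maxn k M) => //=; rewrite leq_maxl.
  have -> : (\int[mu]_x F (maxn k M) x =
      \int[mu]_x ((u n x - w (maxn k M) x) ^+ 2)%:E)%E.
    apply: ae_eq_integral => //.
      by have := iB n (s (maxn k M)) => /measurable_int.
    by apply: filterS aeA => x Ax _; rewrite /F /v_ patchE mem_set.
  have := h (s (maxn k M)) (leq_trans (leq_maxr _ _) (sk _)).
  move=> /ltW; rewrite -lee_fin fineK//.
  by apply: integrable_fin_num => //; exact: iB.
have vB n M : (forall m, (M <= m)%N -> I (fun x => (u n x - u m x) ^+ 2) < 1) ->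
    (fun x => u n x - v x) \in Lfun mu 2%:E.
  move=> h; apply/Lfun2P; split; first exact: measurable_funB.
  apply/integrableP; split.
    by apply/measurable_EFinP; apply: measurable_funX; exact: measurable_funB.
  rewrite (le_lt_trans _ (ltry 1))// (le_trans _ (key _ _ _ h))//.
  rewrite le_eqVlt; apply/orP; left; apply/eqP; apply: eq_integral => x _ /=.
  by rewrite ger0_norm// sqr_ge0.
exists v.
  have [M hM] := uC 1 ltr01.
  rewrite (_ : v = fun x => u M x - (u M x - v x)).
    by apply: Lfun2B => //; apply: (vB M M) => m; exact: hM.
  by apply/funext => x; rewrite opprB addrC subrK.
move=> e e0; have [M hM] := uC e e0; exists M => n Mn.
have h := key e M n (fun m Mm => hM n m Mn Mm).
rewrite -lee_fin fineK//; apply/fin_numPlt; rewrite (le_lt_trans h (ltry e)) andbT.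
by rewrite (lt_le_trans (ltNyr 0))//; apply: integral_ge0 => x _; rewrite lee_fin sqr_ge0.
Qed.

End RealL2.

(** * Weak derivatives on the half-line and the fundamental theorem of calculus *)

Section WeakDerivative.
Context (R : realType).
Implicit Types (f g : R -> R) (a b r x : R).

Local Notation mu := (@lebesgue_measure R).
Local Notation integ f := (mu.-integrable setT (EFin \o f)).

(** Meant for the squared positive part, whose first-order remainder is at most [h ^+ 2] everywhere,
    the kink of the positive part included. *)
Lemma is_derive_of_quadratic f x l (C : R) :
  (forall h, `|f (x + h) - f x - h * l| <= C * h ^+ 2) -> is_derive x (1 : R) f l.
Proof.
move=> H.
have c : (fun h : R => h^-1 *: ((f \o shift x) (h *: (1 : R)) - f x)) @ 0^' --> l.
  apply/cvgrPdist_le => e e0.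
  have C0 : 0 <= C by have := H 1; rewrite expr1n mulr1; apply: le_trans.
  have d0 : 0 < e / (C + 1) by rewrite divr_gt0// ltr_wpDl.
  near=> h.
  have h0 : h != 0 by near: h; exact: nbhs_dnbhs_neq.
  rewrite /= [h%:A]mulr1 [h + x]addrC distrC.
  have -> : h^-1 *: (f (x + h) - f x) - l = h^-1 * (f (x + h) - f x - h * l).
    by rewrite /GRing.scale/=; field.
  rewrite normrM normfV ler_pdivrMl ?normr_gt0//.
  rewrite (le_trans (H h))// -real_normK ?num_real// expr2 mulrA mulrC ler_wpM2l//.
  have hd : `|h| <= e / (C + 1).
    near: h; apply: cvg_within; apply/nbhs_ballP; exists (e / (C + 1)) => // y.
    by rewrite /ball/= sub0r normrN => /ltW.
  rewrite (@le_trans _ _ (C * (e / (C + 1))))// ?ler_wpM2l//.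
  rewrite mulrA ler_pdivrMr ?ltr_wpDl//; nra.
by apply: DeriveDef; [exact/cvgP/c|exact/cvg_lim/c].
Unshelve. all: by end_near. Qed.

(* [step a r] is a C^1 function growing from 0 to 1 on [a - r, a + r]; its
   derivative [tent a r] is a tent of mass 1. *)
Definition step a r x : R := (Num.max (x - a + r) 0 ^+ 2 -
  2 * Num.max (x - a) 0 ^+ 2 + Num.max (x - a - r) 0 ^+ 2) / (2 * r ^+ 2).

Definition tent a r x : R := (Num.max (x - a + r) 0 -
  2 * Num.max (x - a) 0 + Num.max (x - a - r) 0) / r ^+ 2.

Let pos_sqr_quadratic (y h : R) :
  `|Num.max (y + h) 0 ^+ 2 - Num.max y 0 ^+ 2 - 2 * h * Num.max y 0| <= h ^+ 2.
Proof.
rewrite ler_norml; apply/andP; rewrite /Num.max.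
by case: ltP => ?; case: ltP => ?; split; nra.
Qed.

Lemma is_derive_step a r x : 0 < r -> is_derive x (1 : R) (step a r) (tent a r x).
Proof.
move=> r0; apply: (@is_derive_of_quadratic _ _ _ (2 / r ^+ 2)) => h.
have r2 : 0 < r ^+ 2 by rewrite exprn_gt0.
have -> : step a r (x + h) - step a r x - h * tent a r x =
  ((Num.max (x - a + r + h) 0 ^+ 2 - Num.max (x - a + r) 0 ^+ 2 -
       2 * h * Num.max (x - a + r) 0)
   - 2 * (Num.max (x - a + h) 0 ^+ 2 - Num.max (x - a) 0 ^+ 2 -
       2 * h * Num.max (x - a) 0)
   + (Num.max (x - a - r + h) 0 ^+ 2 - Num.max (x - a - r) 0 ^+ 2 -
       2 * h * Num.max (x - a - r) 0)) / (2 * r ^+ 2).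
  rewrite /step /tent.
  have -> : x + h - a + r = x - a + r + h by ring.
  have -> : x + h - a = x - a + h by ring.
  have -> : x - a + h - r = x - a - r + h by ring.
  by field; rewrite gt_eqF.
have := pos_sqr_quadratic (x - a + r) h; have := pos_sqr_quadratic (x - a) h.
have := pos_sqr_quadratic (x - a - r) h.
move: (_ - _ - _) (_ - _ - _) (_ - _ - _) => A B C hA hB hC.
rewrite normrM (gtr0_norm (_ : 0 < (2 * r ^+ 2)^-1)) ?invr_gt0 ?mulr_gt0//.
rewrite ler_pdivrMr ?mulr_gt0//.
have -> : 2 / r ^+ 2 * h ^+ 2 * (2 * r ^+ 2) = 4 * h ^+ 2 by field; rewrite gt_eqF.
move: hA hB hC; rewrite !ler_norml => /andP[? ?] /andP[? ?] /andP[? ?].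
by apply/andP; split; lra.
Qed.

Lemma step0 a r x : 0 < r -> x <= a - r -> step a r x = 0.
Proof.
move=> r0 h; rewrite /step !max_r ?expr0n/= ?mulr0 ?subr0 ?addr0 ?mul0r//; lra.
Qed.

Lemma step1 a r x : 0 < r -> a + r <= x -> step a r x = 1.
Proof.
move=> r0 h; rewrite /step !max_l; try lra.
by field; rewrite gt_eqF.
Qed.

Lemma step_ge0 a r x : 0 < r -> 0 <= step a r x.
Proof.
move=> r0; apply: divr_ge0; last by rewrite mulr_ge0// sqr_ge0.
by rewrite /Num.max; case: ltP => ?; case: ltP => ?; case: ltP => ?; nra.
Qed.

Lemma step_le1 a r x : 0 < r -> step a r x <= 1.
Proof.
move=> r0; rewrite /step ler_pdivrMr ?mulr_gt0 ?exprn_gt0// mul1r.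
by rewrite /Num.max; case: ltP => ?; case: ltP => ?; case: ltP => ?; nra.
Qed.

Lemma tent0 a r x : 0 < r -> r <= `|x - a| -> tent a r x = 0.
Proof.
move=> r0; rewrite /tent ler_normr => /orP[h|h].
  by rewrite !max_l; try lra; rewrite (_ : _ + _ = 0) ?mul0r//; lra.
by rewrite !max_r; try lra; rewrite (_ : _ + _ = 0) ?mul0r//; lra.
Qed.

Lemma tent_ge0 a r x : 0 < r -> 0 <= tent a r x.
Proof.
move=> r0; rewrite /tent divr_ge0 ?sqr_ge0//.
by rewrite /Num.max; case: ltP => ?; case: ltP => ?; case: ltP => ?; lra.
Qed.

Lemma tent_le a r x : 0 < r -> tent a r x <= r^-1.
Proof.
move=> r0; rewrite /tent ler_pdivrMr ?exprn_gt0// expr2 mulKf ?gt_eqF//.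
by rewrite /Num.max; case: ltP => ?; case: ltP => ?; case: ltP => ?; lra.
Qed.

Lemma continuous_tent a r : continuous (tent a r).
Proof.
move=> x; rewrite /tent.
have cM0 (h : R -> R) : h y @[y --> x] --> h x ->
    Num.max (h y) 0 @[y --> x] --> Num.max (h x) 0.
  by move=> ch; apply: (@continuous_max _ _ h (cst 0)) => //; exact: cvg_cst.
have cS : (y - a) @[y --> x] --> x - a by apply: cvgB; [exact: cvg_id|exact: cvg_cst].
have cM c : Num.max (y - a + c) 0 @[y --> x] --> Num.max (x - a + c) 0.
  by apply: (cM0 (fun y => y - a + c)); apply: cvgD => //; exact: cvg_cst.
apply: cvgM; last exact: cvg_cst.
apply: cvgD; last exact: cM.
apply: cvgB; first exact: cM.
by apply: cvgM; [exact: cvg_cst|exact: (cM0 (fun y => y - a))].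
Qed.

Lemma measurable_tent a r : measurable_fun setT (tent a r).
Proof. by apply: continuous_measurable_fun; exact: continuous_tent. Qed.

Lemma continuous_step a r : 0 < r -> continuous (step a r).
Proof.
move=> r0 x; apply: differentiable_continuous; apply/derivable1_diffP.
by have [] := is_derive_step a x r0.
Qed.

Lemma locally_integrable_itv f a b : locally_integrable setT f ->
  mu.-integrable `[a, b] (EFin \o f).
Proof.
move=> [mf _ fi]; apply/integrableP; split.
  by apply/measurable_EFinP; exact: measurable_funTS.
by apply: fi => //; exact: segment_compact.
Qed.

Lemma locally_integrable_cst (c : R) : locally_integrable setT (cst c : R -> R).
Proof.
split => //; first exact: openT.
move=> K _ cK; rewrite (_ : (fun x => _) = cst `|c|%:E)// integral_cst//; last exact: compact_measurable.
by rewrite lte_mul_pinfty//; exact: compact_finite_measure.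
Qed.

Lemma Rintegral_support f (A : set R) : (forall x, ~ A x -> f x = 0) ->
  \int[mu]_x f x = \int[mu]_(x in A) f x.
Proof.
move=> f0; rewrite [RHS]Rintegral_mkcond; congr fine; apply: eq_integral => x _.
by rewrite patchE; case: ifPn => //; rewrite notin_setE => /f0 ->.
Qed.

Lemma integrable_support f (A : set R) : measurable A ->
  (forall x, ~ A x -> f x = 0) ->
  integ f <-> mu.-integrable A (EFin \o f).
Proof.
move=> mA f0; apply: (iff_trans _ (iff_sym (@integrable_mkcond _ _ _ mu A _ mA))).
suff -> : (EFin \o f) \_ A = EFin \o f by [].
apply/funext => x; rewrite patchE; case: ifPn => //.
by rewrite notin_setE => /f0 /= ->.
Qed.

Lemma tent_support a r x : 0 < r -> ~ `[a - r, a + r]%classic x -> tent a r x = 0.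
Proof.
move=> r0 h; apply: tent0 => //; rewrite leNgt; apply/negP => h'; apply: h.
by move: h'; rewrite /= in_itv/= ltr_norml => /andP[? ?]; apply/andP; split; lra.
Qed.

Lemma Rintegral_tent a r : 0 < r -> \int[mu]_x tent a r x = 1.
Proof.
move=> r0; rewrite (Rintegral_support (fun x => @tent_support a r x r0)).
have ab : a - r < a + r by lra.
have cs := @continuous_step a r r0.
rewrite /Rintegral (@continuous_FTC2 _ _ (step a r))//.
- by rewrite step1// step0//= subr0.
- exact/continuous_subspaceT/continuous_tent.
- split.
  + by move=> x _; have [] := is_derive_step a x r0.
  + exact/cvg_at_right_filter/cs.
  + exact/cvg_at_left_filter/cs.
- by move=> x _; rewrite derive1E; have [] := is_derive_step a x r0.
Qed.

Lemma integrable_mul_tent f a r : 0 < r -> locally_integrable setT f ->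
  integ (fun x => f x * tent a r x).
Proof.
move=> r0 fi; apply/(@integrable_support _ `[a - r, a + r]%classic) => //.
  by move=> x /(tent_support r0) ->; rewrite mulr0.
have fi' := locally_integrable_itv (a - r) (a + r) fi.
apply: (@integrable_mul_bounded _ _ _ _ _ _ _ r^-1) => //.
  by apply: measurable_funTS; exact: measurable_tent.
by move=> x _; rewrite ger0_norm ?tent_ge0// tent_le.
Qed.

Lemma integrable_tent a r : 0 < r -> integ (tent a r).
Proof.
move=> r0; have l1 := locally_integrable_cst 1.
have := @integrable_mul_tent (cst 1) a r r0 l1.
by rewrite (_ : (fun x => _) = tent a r)//; apply/funext => x /=; rewrite mul1r.
Qed.

(** The tent is at most [1 / r], twice the uniform density on the ball of radius [r], so the error
    is at most twice the mean deviation that vanishes at a Lebesgue point. *)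
Lemma tent_cvg f a : locally_integrable setT f -> lebesgue_pt f a ->
  forall e : R, 0 < e -> exists2 d : R, 0 < d & forall r, 0 < r -> r < d ->
    `|\int[mu]_x (f x * tent a r x) - f a| <= e.
Proof.
move=> fi fa e e0.
have e2 : 0 < e / 2 by rewrite divr_gt0.
have mf : measurable_fun setT f by case: fi.
have : \forall r \near 0^'+, (davg f a r < (e / 2)%:E)%E.
  move: fa => /fine_cvgP[fin]; move/cvgrPdist_lt => /(_ _ e2) h.
  near=> r; rewrite -(fineK (_ : davg f a r \is a fin_num)) ?lte_fin; last by near: r.
  have : `|0 - fine (davg f a r)| < e / 2 by near: r; exact: h.
  by rewrite sub0r normrN; apply: le_lt_trans; exact: ler_norm.
move=> [d /= d0 hd]; exists d => // r r0 rd.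
have {}hd : (davg f a r < (e / 2)%:E)%E.
  by apply: hd => //=; rewrite sub0r normrN gtr0_norm.
pose B : set R := `]a - r, a + r[%classic.
have mB : measurable B by exact: measurable_itv.
have fai : mu.-integrable B (EFin \o (fun x => f x - f a)).
  apply: (@integrableS _ _ _ mu `[a - r, a + r]) => //.
    by move=> x; exact: subset_itv_oo_cc.
  apply: locally_integrable_itv; apply: locally_integrableB => //.
  exact: locally_integrable_cst.
have i1 := integrable_mul_tent a r0 fi; have i2 := integrable_tent a r0.
rewrite -[X in _ - X]mulr1 -(Rintegral_tent a r0) -RintegralZl// -RintegralB//; last first.
  exact: integrable_scale.
have bs x : ~ B x -> f x * tent a r x - f a * tent a r x = 0.
  move=> h; rewrite tent0 ?mulr0 ?subrr// leNgt; apply/negP => h'; apply: h.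
  by move: h'; rewrite /B /= in_itv/= ltr_norml => /andP[? ?]; apply/andP; split; lra.
rewrite (Rintegral_support bs).
have i3 : mu.-integrable B
    (EFin \o (fun x => f x * tent a r x - f a * tent a r x)).
  rewrite (_ : (fun x => _) = (fun x => (f x - f a) * tent a r x)); last first.
    by apply/funext => x; rewrite mulrBl.
  apply: (@integrable_mul_bounded _ _ _ _ _ _ _ r^-1) => //.
  - by apply: measurable_funTS; exact: measurable_tent.
  - by move=> x _; rewrite ger0_norm ?tent_ge0// tent_le.
rewrite (le_trans (le_normr_Rintegral _ i3))//.
apply: (@le_trans _ _ (\int[mu]_(x in B) (r^-1 * `|f x - f a|))).
  apply: le_Rintegral => //.
  - exact: integrable_norm.
  - by apply: integrable_scale => //; exact: integrable_norm.
  - move=> x _; rewrite -mulrBl normrM mulrC ler_wpM2r// ger0_norm ?tent_ge0//.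
    exact: tent_le.
rewrite RintegralZl//; last exact: integrable_norm.
move: hd; rewrite /davg /iavg lebesgue_measure_ball ?(ltW r0)// ball_itv -/B.
have rr : 0 < r *+ 2 by rewrite mulrn_wgt0.
rewrite inver gt_eqF//.
have fin : (\int[mu]_(y in B) `|f y - f a|%:E)%E \is a fin_num.
  by apply: integrable_fin_num => //; exact: integrable_norm.
rewrite -[X in (_ * X < _)%E]fineK//.
rewrite -EFinM lte_fin => /ltW; rewrite /Rintegral/=.
move: (fine _) => y.
have -> : (r *+ 2)^-1 * y = r^-1 * y / 2 by rewrite -mulr_natr; field; rewrite gt_eqF.
lra.
Unshelve. all: by end_near. Qed.

Lemma ae_neq a : {ae mu, forall x, x != a}.
Proof.
exists [set a]; split; [exact: measurable_set1|exact: lebesgue_measure_set1|].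
by move=> x /= /negP; rewrite negbK => /eqP.
Qed.

Lemma derive1_step_diff a b r : 0 < r ->
  derive1 (fun x => step a r x - step b r x) = (fun x => tent a r x - tent b r x).
Proof.
move=> r0; apply/funext => x; rewrite derive1E.
have da := is_derive_step a x r0; have db := is_derive_step b x r0.
by have [_ ->] := is_deriveB da db.
Qed.

Lemma test_function_step_diff a b r : 0 < r -> r < a -> a <= b ->
  test_function (fun x => step a r x - step b r x).
Proof.
move=> r0 ra ab; split.
- move=> x; have da := is_derive_step a x r0; have db := is_derive_step b x r0.
  by have [] := is_deriveB da db.
- rewrite derive1_step_diff// => x.
  by apply: cvgB; exact: continuous_tent.
- exists (a - r), (b + r); split => [|x]; first by rewrite subr_gt0.
  apply: contraNT; rewrite negb_and -!ltNge => /orP[h|h].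
    by rewrite !step0 ?subrr//; lra.
  by rewrite !step1 ?subrr//; lra.
Qed.

(** The integrals run over the whole line: test functions are supported in (0, oo), so values of [f]
    and [g] elsewhere do not matter. *)
Definition is_weak_deriv f g := forall phi : R -> R, test_function phi ->
  \int[mu]_x (f x * derive1 phi x) = - \int[mu]_x (g x * phi x).

(** Testing with [step a r - step b r]: as [r] tends to 0 the derivative samples [f] at [a] minus
    [f] at [b], while the test function tends to the indicator of []a, b]]. *)
Let weak_FTC_pts f g a b : locally_integrable setT f -> locally_integrable setT g ->
  is_weak_deriv f g -> 0 < a -> a < b -> lebesgue_pt f a -> lebesgue_pt f b ->
  f b - f a = \int[mu]_(x in `]a, b]) g x.
Proof.
move=> fi gi fg a0 ab fa fb.
have mg : measurable_fun setT g by case: gi.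
(* The factor [a / 2] keeps the supports in (0, oo) and inside [[0, a + b]]. *)
pose r n := a / 2 * n.+1%:R^-1.
have r0 n : 0 < r n by rewrite mulr_gt0 ?divr_gt0 ?invr_gt0.
have ra n : r n <= a / 2 by rewrite ler_piMr//; [rewrite divr_ge0// ltW|rewrite invf_le1// ler1n].
have rlt (e : R) : 0 < e -> \forall n \near \oo, r n < e.
  move=> e0; have e1 : 0 < e / (a / 2) by rewrite !divr_gt0.
  have := near_infty_natSinv_lt (PosNum e1); apply: filterS => n /=.
  by rewrite ltr_pdivlMr ?divr_gt0// mulrC.
pose phi n x := step a (r n) x - step b (r n) x.
have lim1 : (fun n => \int[mu]_x (f x * derive1 (phi n) x)) @ \oo --> f a - f b.
  rewrite (_ : (fun n => _) = (fun n => \int[mu]_x (f x * tent a (r n) x) -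
      \int[mu]_x (f x * tent b (r n) x))); last first.
    apply/funext => n; rewrite -RintegralB//; try exact: integrable_mul_tent.
    by rewrite derive1_step_diff//; apply: eq_Rintegral => x _; rewrite mulrBr.
  by apply: cvgB; apply/cvgrPdist_le => e e0;
    [have [d d0 h] := tent_cvg fi fa e0|have [d d0 h] := tent_cvg fi fb e0];
    apply: filterS (rlt _ d0) => n rd; rewrite distrC; exact: h.
pose D : set R := `[0, b + a]%classic.
have mD : measurable D by exact: measurable_itv.
have giD : mu.-integrable D (EFin \o g) by exact: locally_integrable_itv.
have phi_D n x : ~ D x -> phi n x = 0.
  rewrite /D/= in_itv/= => /negP; rewrite negb_and -!ltNge /phi => /orP[h|h].
    by rewrite !step0 ?subrr//; have := ra n; have := r0 n; lra.
  by rewrite !step1 ?subrr//; have := ra n; have := r0 n; lra.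
have mphi n : measurable_fun setT (phi n).
  by apply: measurable_funB; apply: continuous_measurable_fun; exact: continuous_step.
have phi1 n x : `|phi n x| <= 1.
  rewrite ler_norml /phi; have := step_ge0 a x (r0 n); have := step_ge0 b x (r0 n).
  have := step_le1 a x (r0 n); have := step_le1 b x (r0 n).
  by move=> *; apply/andP; split; lra.
pose chi : R -> R := \1_(`]a, b]%classic : set R).
have mchi : measurable_fun setT chi by exact: measurable_indic.
have phi_cvg x : x != a -> x != b -> phi ^~ x @ \oo --> chi x.
  move=> xa xb; rewrite /chi indicE.
  have [xla|] := ltP x a.
    rewrite memNset; last by rewrite /= in_itv/= => /andP[? _]; lra.
    apply: cvg_near_cst; have d0 : 0 < a - x by lra.
    apply: filterS (rlt _ d0) => n h; rewrite /phi !step0 ?subrr//; lra.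
  rewrite le_eqVlt eq_sym (negbTE xa)/= => ax.
  have [xlb|] := ltP x b.
    rewrite mem_set; last by rewrite /= in_itv/=; apply/andP; split; lra.
    apply: cvg_near_cst; have d0 : 0 < Num.min (x - a) (b - x).
      by rewrite lt_min; apply/andP; split; lra.
    apply: filterS (rlt _ d0) => n; rewrite lt_min => /andP[h1 h2].
    by rewrite /phi step1// ?step0 ?subr0//; lra.
  rewrite le_eqVlt eq_sym (negbTE xb)/= => bx.
  rewrite memNset; last by rewrite /= in_itv/= => /andP[_ ?]; lra.
  apply: cvg_near_cst; have d0 : 0 < x - b by lra.
  by apply: filterS (rlt _ d0) => n h; rewrite /phi !step1 ?subrr//; lra.
have lim2 : (fun n => \int[mu]_(x in D) (g x * phi n x)) @ \oo -->
    \int[mu]_(x in D) (g x * chi x).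
  apply: (@Rdominated_cvg _ _ _ mu D (fun n x => g x * phi n x)
    (fun x => g x * chi x) (fun x => `|g x|)) => //.
  - by move=> n; apply: measurable_funTS; exact: (measurable_funM mg (mphi n)).
  - by apply: measurable_funTS; exact: (measurable_funM mg mchi).
  - apply: filterS (ae_and (ae_neq a) (ae_neq b)) => x [xa xb] _.
    by apply: cvgM; [exact: cvg_cst|exact: phi_cvg].
  - exact: integrable_norm.
  - by move=> n x _; rewrite normrM ler_piMr.
have : f a - f b = - \int[mu]_(x in D) (g x * chi x).
  apply: (cvg_unique _ lim1); first exact: norm_hausdorff.
  rewrite (_ : (fun n => _) = (fun n => - \int[mu]_(x in D) (g x * phi n x))).
    exact: cvgN.
  apply/funext => n; rewrite fg; last first.
    by apply: test_function_step_diff => //; [have := ra n; lra|exact: ltW].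
  congr (- _); apply: Rintegral_support => x /(phi_D n) ->; exact: mulr0.
move=> /(congr1 -%R); rewrite opprB opprK => ->.
rewrite [LHS]Rintegral_mkcond [RHS]Rintegral_mkcond.
apply: eq_Rintegral => x _; rewrite !patchE /chi indicE.
case: (boolP (x \in `]a, b]%classic)) => [|_]; last by rewrite mulr0 if_same.
rewrite inE /= in_itv/= mulr1 => /andP[xa xb]; rewrite mem_set//.
by rewrite /D /= in_itv/=; apply/andP; split; lra.
Qed.

Lemma ae_exists_itv a b (P : R -> Prop) : a < b -> {ae mu, forall x, P x} ->
  exists2 x, x \in `]a, b[ & P x.
Proof.
move=> ab [N [mN N0 sub]]; apply: contrapT => nP.
have sub1 : `]a, b[%classic `<=` N.
  by move=> x xab; apply: sub => Px; apply: nP; exists x.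
have : (mu `]a, b[%classic <= mu N)%E by apply: le_measure => //; rewrite inE.
by rewrite N0 lebesgue_measure_itv/= lte_fin ab -EFinB lee_fin leNgt subr_gt0 ab.
Qed.

(** Almost every point is a Lebesgue point; one of them in (0, 1) fixes the constant for all the
    others. *)
Lemma weak_FTC f g : locally_integrable setT f -> locally_integrable setT g ->
  is_weak_deriv f g ->
  exists c : R, {ae mu, forall x, 0 < x -> f x = c + \int[mu]_(t in `[0, x]) g t}.
Proof.
move=> fi gi fg; have fL := lebesgue_differentiation fi.
have [a a01 La] := ae_exists_itv ltr01 fL.
have a0 : 0 < a by move: a01; rewrite in_itv/= => /andP[].
exists (f a - \int[mu]_(t in `[0, a]) g t).
have gB x y : 0 < x -> x <= y ->
    \int[mu]_(t in `]x, y]) g t = \int[mu]_(t in `[0, y]) g t - \int[mu]_(t in `[0, x]) g t.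
  move=> x0 xy; rewrite Rintegral_itvB//.
  - exact: locally_integrable_itv.
  - by rewrite bnd_simp ltW.
apply: (ae_imp fL) => x Lx x0; have [xa|ax|->] := ltgtP x a.
- have := weak_FTC_pts fi gi fg x0 xa Lx La; rewrite gB ?ltW//; lra.
- have := weak_FTC_pts fi gi fg a0 ax La Lx; rewrite gB ?ltW//; lra.
- by rewrite subrK.
Qed.

End WeakDerivative.

(** * Primitives from 0 and their exponential bounds *)

Section Primitive.
Context (R : realType).
Implicit Types (f g h : R -> R) (a b x : R).

Local Notation mu := (@lebesgue_measure R).
Local Notation integ f := (mu.-integrable setT (EFin \o f)).

Lemma Lfun2_locally_integrable f : f \in Lfun mu 2%:E -> locally_integrable setT f.
Proof.
move=> fL; have /Lfun2P[mf f2] := fL; split => //; first exact: openT.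
move=> K _ cK; have mK : @measurable _ (measurableTypeR R) K by exact: compact_measurable.
have i1 : mu.-integrable K (EFin \o (fun x => f x ^+ 2)).
  by apply: (@integrableS _ _ _ mu setT).
have [_ _ /(_ K (@subsetT _ K) cK) c1] := locally_integrable_cst (1 : R).
have i2 : mu.-integrable K (EFin \o (cst 1 : R -> R)).
  by apply/integrableP; split => //; exact/measurable_EFinP.
have := integrable_add mK i1 i2.
have mfK : measurable_fun K (EFin \o f).
  by apply/measurable_EFinP; exact: measurable_funTS.
have h x : K x -> (`|(f x)%:E| <= `|(f x ^+ 2 + 1)%:E|)%E.
  move=> _; rewrite /= lee_fin [leRHS]ger0_norm ?addr_ge0 ?sqr_ge0//.
  rewrite -real_normK ?num_real//; have := sqr_ge0 (`|f x| - 1).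
  by rewrite sqrrB; have := normr_ge0 (f x); move: (`|f x|) => y; nra.
by move/(le_integrable mK mfK h)/integrableP => [_].
Qed.

Lemma locally_integrable_mul_continuous h f : continuous h ->
  locally_integrable setT f -> locally_integrable setT (fun x => h x * f x).
Proof.
move=> ch [mf oT fi]; split => //.
  by apply: measurable_funM => //; exact: continuous_measurable_fun.
move=> K KT cK; have mK : @measurable _ (measurableTypeR R) K by exact: compact_measurable.
have fK : mu.-integrable K (EFin \o f).
  apply/integrableP; split; last exact: fi.
  by apply/measurable_EFinP; exact: measurable_funTS.
have [C hC] : exists C, forall x, K x -> `|h x| <= C.
  have : compact (h @` K).
    by apply: continuous_compact => //; exact: continuous_subspaceT.
  move=> /compact_bounded[M [Mr hM]]; exists (M + 1) => x Kx.
  by apply: (hM (M + 1)); [rewrite ltrDl|exists x].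
have /integrableP[_] : mu.-integrable K (EFin \o (fun x => f x * h x)).
  apply: (integrable_mul_bounded mK fK _ hC).
  by apply: measurable_funTS; exact: continuous_measurable_fun.
by under eq_integral do rewrite /= mulrC.
Qed.

Lemma continuous_locally_integrable h : continuous h -> locally_integrable setT h.
Proof.
move=> ch; have := locally_integrable_mul_continuous ch (locally_integrable_cst 1).
by under eq_fun do rewrite mulr1.
Qed.

(** For [x < 0] the interval is empty and the value is 0, so representatives built from [prim] live
    on the whole line. *)
Definition prim f x : R := \int[mu]_(t in `[0, x]) f t.

Lemma prim0 f : prim f 0 = 0.
Proof. by rewrite /prim set_itv1 Rintegral_set1. Qed.

Lemma continuous_prim f : locally_integrable setT f -> continuous (prim f).
Proof.
move=> fi x0; pose a := - `|x0| - 1; pose b := `|x0| + 1.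
have a0 : a <= 0 by rewrite /a; have := normr_ge0 x0; lra.
have ab : a < b by rewrite /a /b; have := normr_ge0 x0; lra.
(* Cutting [f] off below 0 makes the primitive from [a <= 0] agree with [prim f] on both sides of
   0. *)
pose h := f \_ [set x | 0 <= x].
have m0 : measurable [set x : R | 0 <= x].
  by rewrite -set_itvcy; exact: measurable_itv.
have hi : mu.-integrable `[a, b] (EFin \o h).
  rewrite /h -restrict_EFin; apply/integrable_restrict => //.
  apply: (@integrableS _ _ _ mu `[a, b]) => //; first exact: measurableI.
  exact: locally_integrable_itv.
have := parameterized_integral_continuous (ltW ab) hi.
move=> /(continuous_within_itvP _ ab)[c _ _].
have -> : prim f = (fun x => parameterized_integral mu a x h).
  apply/funext => x; rewrite /prim /parameterized_integral.
  rewrite [LHS]Rintegral_mkcond [RHS]Rintegral_mkcond.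
  apply: eq_Rintegral => t _; rewrite !patchE.
  have [ta|ta] := boolP (t \in `[a, x]%classic); last first.
    rewrite memNset//; move: ta; rewrite notin_setE /= !in_itv/=.
    by move=> n /andP[t0 tx]; apply: n; rewrite tx andbT (le_trans a0).
  rewrite /h patchE; move: ta; rewrite inE /= in_itv/= => /andP[_ tx].
  have [t0|t0] := boolP (0 <= t); first by rewrite !mem_set//= in_itv/= t0 tx.
  rewrite !memNset//=; first by apply/negP.
  by rewrite in_itv/= (negbTE t0).
apply: c; rewrite in_itv/= /a /b.
by have := ler_norm x0; have := ler_norm (- x0); rewrite normrN => ? ?; apply/andP; split; lra.
Qed.

Lemma primD f g x : locally_integrable setT f -> locally_integrable setT g ->
  prim (fun t => f t + g t) x = prim f x + prim g x.
Proof. by move=> fi gi; rewrite /prim RintegralD//; exact: locally_integrable_itv. Qed.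

Lemma primB f g x : locally_integrable setT f -> locally_integrable setT g ->
  prim (fun t => f t - g t) x = prim f x - prim g x.
Proof. by move=> fi gi; rewrite /prim RintegralB//; exact: locally_integrable_itv. Qed.

Lemma primZ (c : R) f x : locally_integrable setT f ->
  prim (fun t => c * f t) x = c * prim f x.
Proof. by move=> fi; rewrite /prim RintegralZl//; exact: locally_integrable_itv. Qed.

Lemma eq_prim f g x : measurable_fun setT f -> measurable_fun setT g ->
  {ae mu, forall t, 0 < t -> f t = g t} -> prim f x = prim g x.
Proof.
move=> mf mg fg; congr fine; apply: ae_eq_integral => //.
- by apply/measurable_EFinP; exact: measurable_funTS.
- by apply/measurable_EFinP; exact: measurable_funTS.
apply: (ae_imp (ae_and fg (ae_neq 0))) => t [h t0].
rewrite /= in_itv/= => /andP[t0' _]; rewrite /= h// lt_neqAle eq_sym t0.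
by rewrite t0'.
Qed.

Lemma le_prim f g x : locally_integrable setT f -> locally_integrable setT g ->
  {ae mu, forall t, 0 < t -> `|f t| <= g t} -> `|prim f x| <= prim g x.
Proof.
move=> fi gi fg.
have mf : measurable_fun setT f by case: fi.
have mg : measurable_fun setT g by case: gi.
have fi' := @locally_integrable_itv _ f 0 x fi.
have gi' := @locally_integrable_itv _ g 0 x gi.
rewrite /prim (le_trans (le_normr_Rintegral _ fi'))//.
(* The hypothesis holds almost everywhere only; [m] is a version of [g] that dominates [f] at every
   point. *)
pose m t := Num.max (g t) `|f t|.
have mm : measurable_fun setT m.
  by apply: measurable_maxr => //; exact: measurableT_comp.
have -> : \int[mu]_(t in `[0, x]) g t = \int[mu]_(t in `[0, x]) m t.
  apply: eq_prim => //; apply: (ae_imp fg) => t h t0.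
  by rewrite /m max_l// h.
apply: le_Rintegral => //.
- exact: integrable_norm.
- have mgE : {ae mu, forall t, 0 < t -> g t = m t}.
    by apply: (ae_imp fg) => t h t0; rewrite /m max_l// h.
  apply/integrableP; split; first by apply/measurable_EFinP; exact: measurable_funTS.
  move/integrableP : gi' => [_].
  suff -> : (\int[mu]_(t in `[0%R, x]) `|(EFin \o g) t| =
     \int[mu]_(t in `[0%R, x]) `|(EFin \o m) t|)%E by [].
  apply: ae_eq_integral => //.
  + by apply: measurableT_comp => //; apply/measurable_EFinP; exact: measurable_funTS.
  + by apply: measurableT_comp => //; apply/measurable_EFinP; exact: measurable_funTS.
  apply: (ae_imp (ae_and mgE (ae_neq 0))) => t [h t0].
  rewrite /= in_itv/= => /andP[t0' _]; rewrite h// lt_neqAle eq_sym t0.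
  by rewrite t0'.
- by move=> t _; rewrite /m le_max lexx orbT.
Qed.

Lemma prim_cst (c : R) x : 0 <= x -> prim (cst c) x = c * x.
Proof.
move=> x0; rewrite /prim Rintegral_cst//; congr (_ * _).
rewrite /= lebesgue_measure_itv/= lte_fin -EFinB subr0.
by case: ltP => // x1; apply/eqP; rewrite eq_le x0 x1.
Qed.

(* The L^2 bound is linearized by the arithmetic-geometric mean inequality
   [2 |f| <= f^2 / s + s]. *)
Lemma prim_le_L2 f (s : R) x : f \in Lfun mu 2%:E -> 0 < s ->
  \int[mu]_t (f t ^+ 2) <= s ^+ 2 -> 0 <= x -> `|prim f x| <= s * (1 + x).
Proof.
move=> fL s0 fs x0; have [mf f2] := (Lfun2P _ _).1 fL.
have fi := Lfun2_locally_integrable fL.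
have f2i : locally_integrable setT (fun t => f t ^+ 2).
  exact: (open_integrable_locally openT).
pose g t := s^-1 * f t ^+ 2 + cst s t.
have li c h : locally_integrable setT h -> locally_integrable setT (fun t => c * h t).
  by apply: locally_integrable_mul_continuous => y; exact: cvg_cst.
have gi : locally_integrable setT g.
  by apply: locally_integrableD; [exact: li|exact: locally_integrable_cst].
apply: (le_trans (le_prim (g := g) x fi gi _)).
  apply: aeW => t _; rewrite /g /= -(ler_pM2l s0) mulrDr mulrA divff ?gt_eqF// mul1r.
  rewrite -real_normK ?num_real//.
  have := sqr_ge0 (`|f t| - s); rewrite sqrrB; have := normr_ge0 (f t).
  move: (`|f t|) => y; nra.
rewrite /g primD; [|exact: li|exact: locally_integrable_cst].
rewrite prim_cst// primZ// mulrDr mulr1 lerD//.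
rewrite mulrC ler_pdivrMr// -expr2 (le_trans _ fs)//.
rewrite /prim Rintegral_mkcond; apply: le_Rintegral => //.
  rewrite -restrict_EFin; apply/integrable_restrict => //.
  by rewrite setTI; apply: (@integrableS _ _ _ mu setT).
by move=> t _; rewrite patchE; case: ifP => _ //; rewrite sqr_ge0.
Qed.

Lemma prim_expR (l x : R) : l != 0 -> 0 <= x ->
  prim (fun t => expR (l * t)) x = (expR (l * x) - 1) / l.
Proof.
move=> l0; rewrite le_eqVlt => /predU1P[<-|x0].
  by rewrite prim0 mulr0 expR0 subrr mul0r.
have d t : is_derive t (1 : R) (fun t => expR (l * t) / l) (expR (l * t)).
  apply: is_derive_eq; rewrite /GRing.scale/=; field; exact: l0.
have cF : continuous (fun t : R => expR (l * t)).
  by move=> t; apply: continuous_comp; [exact: mulrl_continuous|exact: continuous_expR].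
have cF2 : continuous (fun t : R => expR (l * t) / l).
  by move=> t; apply: cvgM; [exact: cF|exact: cvg_cst].
rewrite /prim /Rintegral (@continuous_FTC2 _ _ (fun t => expR (l * t) / l))//.
- by rewrite /= mulr0 expR0 mulrBl.
- exact: continuous_subspaceT.
- split.
  + by move=> t _; case: (d t).
  + exact/cvg_at_right_filter/cF2.
  + exact/cvg_at_left_filter/cF2.
- by move=> t _; rewrite derive1E; case: (d t).
Qed.

(** Each integration gains a factor [1 / l] in the weight [exp(l x)]; this gain drives the Volterra
    estimate. *)
Lemma prim_le_expR f (q l x : R) : locally_integrable setT f -> 0 < l -> 0 <= q ->
  {ae mu, forall t, 0 < t -> `|f t| <= q * expR (l * t)} -> 0 <= x ->
  `|prim f x| <= q / l * expR (l * x).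
Proof.
move=> fi l0 q0 h x0.
have cF : continuous (fun t : R => expR (l * t)).
  by move=> t; apply: continuous_comp; [exact: mulrl_continuous|exact: continuous_expR].
have ei := continuous_locally_integrable cF.
have qi : locally_integrable setT (fun t => q * expR (l * t)).
  by apply: locally_integrable_mul_continuous => // y; exact: cvg_cst.
rewrite (le_trans (le_prim x fi qi h))// primZ// prim_expR ?gt_eqF//.
rewrite [leLHS]mulrA [leRHS]mulrAC ler_wpM2r ?invr_ge0 ?(ltW l0)// ler_wpM2l//.
by rewrite gerBl.
Qed.

Lemma is_derive_prim f x : continuous f -> 0 < x ->
  is_derive x (1 : R) (prim f) (f x).
Proof.
move=> cf x0; have fi := continuous_locally_integrable cf.
have x1 : x < x + 1 by rewrite ltrDl.
have [dF eF] := continuous_FTC1_closed x1 (locally_integrable_itv 0 (x + 1) fi) x0 (cf x).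
by apply: DeriveDef; [exact: dF|rewrite -derive1E; exact: eF].
Qed.

Lemma weak_deriv_rep f f1 : f \in Lfun mu 2%:E -> f1 \in Lfun mu 2%:E ->
  is_weak_deriv f f1 -> exists F : R -> R,
  [/\ continuous F, {ae mu, forall x, 0 < x -> f x = F x}
    & forall x, F x = F 0 + prim f1 x].
Proof.
move=> fL f1L ff1; have fi := Lfun2_locally_integrable fL.
have f1i := Lfun2_locally_integrable f1L.
have [c hc] := weak_FTC fi f1i ff1.
exists (fun x => c + prim f1 x); split => //.
  by move=> x; apply: cvgD; [exact: cvg_cst|exact: continuous_prim].
by move=> x; rewrite prim0 addr0.
Qed.

Lemma weak_deriv_rep2 f f1 f2 : f \in Lfun mu 2%:E -> f1 \in Lfun mu 2%:E ->
  f2 \in Lfun mu 2%:E -> is_weak_deriv f f1 -> is_weak_deriv f1 f2 ->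
  exists F F1 : R -> R,
  [/\ continuous F /\ continuous F1, {ae mu, forall x, 0 < x -> f x = F x},
      {ae mu, forall x, 0 < x -> f1 x = F1 x},
      forall x, F x = F 0 + prim F1 x & forall x, F1 x = F1 0 + prim f2 x].
Proof.
move=> fL f1L f2L ff1 ff2.
have [F [cF eF hF]] := weak_deriv_rep fL f1L ff1.
have [F1 [cF1 eF1 hF1]] := weak_deriv_rep f1L f2L ff2.
exists F, F1; split => // x; rewrite [LHS]hF; congr (_ + _); apply: eq_prim => //.
- exact: Lfun2_measurable f1L.
- exact: continuous_measurable_fun.
Qed.

End Primitive.

(** * Lagrange's identity for the Wronskian on the half-line *)

Section Wronskian.
Context (R : realType).
Implicit Types (f g h F G phi : R -> R) (a b x : R).

Local Notation mu := (@lebesgue_measure R).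
Local Notation integ f := (mu.-integrable setT (EFin \o f)).

(** Makes [phi F] admissible in a weak derivative identity. [F] is differentiable on (0, oo) only,
    but near any [x <= 0] the product vanishes with [phi]. *)
Lemma test_function_mul phi F F1 : test_function phi -> continuous F -> continuous F1 ->
  (forall x, 0 < x -> is_derive x (1 : R) F (F1 x)) ->
  test_function (fun x => phi x * F x) /\
  derive1 (fun x => phi x * F x) = (fun x => derive1 phi x * F x + phi x * F1 x).
Proof.
move=> [dphi cphi [a [b [a0 ab]]]] cF cF1 dF.
have phi0 x : x < a -> phi x = 0.
  by move=> xa; apply: contraTeq xa => /ab /andP[ax _]; rewrite -leNgt.
have D x : is_derive x (1 : R) (fun x => phi x * F x) (derive1 phi x * F x + phi x * F1 x).
  have [x0|x0] := ltP 0 x.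
    have dp : is_derive x (1 : R) phi (derive1 phi x).
      by apply: DeriveDef; [exact: dphi|rewrite derive1E].
    have := is_deriveM dp (dF x x0).
    rewrite /GRing.scale/= => H; apply: (is_derive_eq H).
    by rewrite addrC [F x * _]mulrC.
  have near0 : \forall y \near x, 0 = phi y * F y.
    apply: (@filterS _ _ _ [set y | y < a]) => [y /= ya|]; first by rewrite phi0// mul0r.
    by apply: lt_nbhsl; exact: le_lt_trans a0.
  have nearp : \forall y \near x, cst 0 y = phi y.
    apply: (@filterS _ _ _ [set y | y < a]) => [y /= ya|]; first by rewrite phi0.
    by apply: lt_nbhsl; exact: le_lt_trans a0.
  apply: (near_eq_is_derive near0).
  rewrite derive1E -(near_eq_derive _ nearp) derive_cst mul0r phi0 ?mul0r ?addr0.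
    exact: is_derive_cst.
  exact: le_lt_trans a0.
have dE : derive1 (fun x => phi x * F x) = (fun x => derive1 phi x * F x + phi x * F1 x).
  by apply/funext => x; rewrite derive1E; case: (D x).
have cph : continuous phi.
  by move=> x; apply: differentiable_continuous; apply/derivable1_diffP.
split; last exact: dE.
split; first by move=> x; case: (D x).
  rewrite dE => x; apply: cvgD; first by apply: cvgM; [exact: cphi|exact: cF].
  by apply: cvgM; [exact: cph|exact: cF1].
exists a, b; split => // x h; apply: ab; apply: contra_neq h => ->; exact: mul0r.
Qed.

Lemma integrable_compact_mul f h a b : locally_integrable setT f -> continuous h ->
  (forall x, h x != 0 -> a <= x <= b) -> integ (fun x => f x * h x).
Proof.
move=> fi ch hab.
have sup x : ~ `[a, b]%classic x -> f x * h x = 0.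
  move=> nx; have [->|h0] := eqVneq (h x) 0; first exact: mulr0.
  by exfalso; apply: nx; rewrite /= in_itv/= hab.
apply/(@integrable_support _ _ `[a, b]%classic) => //.
rewrite (_ : (fun x => _) = (fun x => h x * f x)).
  by apply: locally_integrable_itv; exact: locally_integrable_mul_continuous.
by apply/funext => x; rewrite mulrC.
Qed.

Lemma continuous_test phi : test_function phi -> continuous phi.
Proof.
move=> [dphi _ _] x; apply: differentiable_continuous; exact/derivable1_diffP.
Qed.

Lemma derive1_test_support phi a b : (forall x, phi x != 0 -> a <= x <= b) ->
  forall x, derive1 phi x != 0 -> a <= x <= b.
Proof.
move=> ab x; apply: contraR => nx.
suff n0 : \forall y \near x, cst 0 y = phi y.
  by rewrite derive1E -(near_eq_derive _ n0) derive_cst.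
have phi0 y : ~~ (a <= y <= b) -> phi y = 0.
  by move=> ny; apply/eqP; apply: contraNT ny => /ab.
move: nx; rewrite negb_and -!ltNge => /orP[xa|xb].
  apply: (@filterS _ _ _ [set y | y < a]); last exact: lt_nbhsl.
  by move=> y /= ya; rewrite phi0// negb_and -ltNge ya.
apply: (@filterS _ _ _ [set y | b < y]); last exact: lt_nbhsr.
by move=> y /= ya; rewrite phi0// negb_and -!ltNge ya orbT.
Qed.

(** The identity for [f1] is tested with [phi G], that for [g1] with [phi F]; the term [phi F1 G1]
    cancels in the difference. *)
Lemma weak_deriv_wronskian f1 f2 g1 g2 F F1 G G1 :
  f1 \in Lfun mu 2%:E -> f2 \in Lfun mu 2%:E ->
  g1 \in Lfun mu 2%:E -> g2 \in Lfun mu 2%:E ->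
  continuous F -> continuous F1 -> continuous G -> continuous G1 ->
  (forall x, 0 < x -> is_derive x (1 : R) F (F1 x)) ->
  (forall x, 0 < x -> is_derive x (1 : R) G (G1 x)) ->
  {ae mu, forall x, 0 < x -> f1 x = F1 x} ->
  {ae mu, forall x, 0 < x -> g1 x = G1 x} ->
  is_weak_deriv f1 f2 -> is_weak_deriv g1 g2 ->
  is_weak_deriv (fun x => F x * G1 x - G x * F1 x) (fun x => F x * g2 x - G x * f2 x).
Proof.
move=> f1L f2L g1L g2L cF cF1 cG cG1 dF dG eF1 eG1 wf wg phi tphi.
have [tF eF] := test_function_mul tphi cF cF1 dF.
have [tG eG] := test_function_mul tphi cG cG1 dG.
have := wg _ tF; have := wf _ tG; rewrite eF eG.
have [_ cphi' [a [b [a0 ab]]]] := tphi.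
have cphi := continuous_test tphi; have ab' := derive1_test_support ab.
have f1i := Lfun2_locally_integrable f1L; have g1i := Lfun2_locally_integrable g1L.
have f2i := Lfun2_locally_integrable f2L; have g2i := Lfun2_locally_integrable g2L.
have F1i := continuous_locally_integrable cF1.
have G1i := continuous_locally_integrable cG1.
have ic h H : locally_integrable setT h -> continuous H -> integ (fun x => h x * (phi x * H x)).
  move=> hi cH; apply: (@integrable_compact_mul _ _ a b) => //.
    by move=> x; apply: cvgM; [exact: cphi|exact: cH].
  by move=> x h0; apply: ab; apply: contra_neq h0 => ->; exact: mul0r.
have ic' h H : locally_integrable setT h -> continuous H ->
    integ (fun x => h x * (derive1 phi x * H x)).
  move=> hi cH; apply: (@integrable_compact_mul _ _ a b) => //.
    by move=> x; apply: cvgM; [exact: cphi'|exact: cH].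
  by move=> x h0; apply: ab'; apply: contra_neq h0 => ->; exact: mul0r.
have mphi : measurable_fun setT phi by exact: continuous_measurable_fun.
have mphi' : measurable_fun setT (derive1 phi) by exact: continuous_measurable_fun.
have phin x : x <= 0 -> phi x = 0.
  by move=> x0; apply/eqP; apply: contraTT x0 => /ab/andP[ax _]; rewrite -ltNge (lt_le_trans a0).
have phin' x : x <= 0 -> derive1 phi x = 0.
  by move=> x0; apply/eqP; apply: contraTT x0 => /ab'/andP[ax _]; rewrite -ltNge (lt_le_trans a0).
have sw h H1 H : h \in Lfun mu 2%:E -> continuous H1 -> continuous H ->
    {ae mu, forall x, 0 < x -> h x = H1 x} ->
    \int[mu]_x (h x * (phi x * H x)) = \int[mu]_x (H1 x * (phi x * H x)) /\
    \int[mu]_x (h x * (derive1 phi x * H x)) = \int[mu]_x (H1 x * (derive1 phi x * H x)).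
  move=> hL cH1 cH hE.
  have mh := Lfun2_measurable hL.
  have mH : measurable_fun setT H by exact: continuous_measurable_fun.
  have mH1 : measurable_fun setT H1 by exact: continuous_measurable_fun.
  split; apply: ae_eq_Rintegral.
  - by apply: measurable_funM => //; exact: measurable_funM.
  - by apply: measurable_funM => //; exact: measurable_funM.
  - apply: (ae_imp hE) => x hx; have [x0|x0] := ltP 0 x; first by rewrite hx.
    by rewrite phin// mul0r !mulr0.
  - by apply: measurable_funM => //; exact: measurable_funM.
  - by apply: measurable_funM => //; exact: measurable_funM.
  - apply: (ae_imp hE) => x hx; have [x0|x0] := ltP 0 x; first by rewrite hx.
    by rewrite phin'// mul0r !mulr0.
have split1 h H H1 : locally_integrable setT h -> continuous H -> continuous H1 ->
    \int[mu]_x (h x * (derive1 phi x * H x + phi x * H1 x)) =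
    \int[mu]_x (h x * (derive1 phi x * H x)) + \int[mu]_x (h x * (phi x * H1 x)).
  move=> hi cH cH1; rewrite -RintegralD//; [|exact: ic'|exact: ic].
  by apply: eq_Rintegral => x _; rewrite mulrDr.
rewrite !split1//.
have [-> _] := sw _ _ _ f1L cF1 cG1 eF1; have [_ ->] := sw _ _ _ f1L cF1 cG eF1.
have [-> _] := sw _ _ _ g1L cG1 cF1 eG1; have [_ ->] := sw _ _ _ g1L cG1 cF eG1.
have -> : \int[mu]_x (G1 x * (phi x * F1 x)) = \int[mu]_x (F1 x * (phi x * G1 x)).
  by apply: eq_Rintegral => x _; ring.
have -> : \int[mu]_x ((F x * G1 x - G x * F1 x) * derive1 phi x) =
    \int[mu]_x (G1 x * (derive1 phi x * F x)) - \int[mu]_x (F1 x * (derive1 phi x * G x)).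
  rewrite -RintegralB//; [|exact: ic'|exact: ic'].
  by apply: eq_Rintegral => x _; ring.
have -> : \int[mu]_x ((F x * g2 x - G x * f2 x) * phi x) =
    \int[mu]_x (g2 x * (phi x * F x)) - \int[mu]_x (f2 x * (phi x * G x)).
  rewrite -RintegralB//; [|exact: ic|exact: ic].
  by apply: eq_Rintegral => x _; ring.
lra.
Qed.

(** Otherwise [|f| >= e] on a half-line, against integrability. It replaces a proof that the
    Wronskian decays at infinity. *)
Lemma integrable_small_value f (e : R) n : continuous f -> mu.-integrable (@Rpos R) (EFin \o f) ->
  0 < e -> exists2 x, n <= x & `|f x| < e.
Proof.
move=> cf fi e0; apply: contrapT => H.
have big x : n <= x -> e <= `|f x|.
  by move=> nx; rewrite leNgt; apply/negP => fx; apply: H; exists x.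
pose a := Num.max n 1.
pose K := \int[mu]_(x in @Rpos R) `|f x|.
have mP : measurable (@Rpos R) by rewrite /Rpos -set_itvoy; exact: measurable_itv.
have le_K (m : R) : 0 < m -> e * m <= K.
  move=> m0; pose D : set R := `[a, a + m]%classic.
  have DP : D `<=` @Rpos R.
    move=> x; rewrite /D /= in_itv/= => /andP[ax _]; rewrite /Rpos/=.
    by rewrite (lt_le_trans _ ax)// /a lt_max ltr01 orbT.
  have fD : mu.-integrable D (EFin \o (fun x => `|f x|)).
    apply: (@integrableS _ _ _ mu (@Rpos R)) => //; first exact: measurable_itv.
    exact: integrable_norm.
  have -> : e * m = \int[mu]_(x in D) e.
    rewrite Rintegral_cst; last exact: measurable_itv.
    rewrite /D /= lebesgue_measure_itv/= lte_fin ltrDl m0 -EFinB/=; ring.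
  apply: (@le_trans _ _ (\int[mu]_(x in D) `|f x|)).
    apply: le_Rintegral => //; first exact: measurable_itv.
      exact: (locally_integrable_itv a (a + m) (locally_integrable_cst e)).
    by move=> x; rewrite /D/= in_itv/= => /andP[ax _]; apply: big; rewrite (le_trans _ ax)// /a le_max lexx.
  rewrite /K [leLHS]Rintegral_mkcond [leRHS]Rintegral_mkcond; apply: le_Rintegral => //.
  - by rewrite -restrict_EFin; apply/integrable_restrict; rewrite ?setTI//; exact: measurable_itv.
  - rewrite -restrict_EFin; apply/integrable_restrict; rewrite ?setTI//.
    exact: integrable_norm.
  - move=> x _; rewrite !patchE; case: ifPn => [/set_mem/DP xP|_].
      by rewrite mem_set.
    by case: ifP => // _; exact: normr_ge0.
have K0 : 0 <= K by apply: Rintegral_ge0.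
have := le_K ((K + 1) / e); rewrite divr_gt0 ?ltr_wpDl// mulrCA divff ?gt_eqF// mulr1.
by move=> /(_ erefl); rewrite gerDl ler10.
Qed.

Lemma prim_cvg_infty f (x_ : nat -> R) : mu.-integrable (@Rpos R) (EFin \o f) ->
  (forall n, n%:R <= x_ n) -> (fun n => prim f (x_ n)) @ \oo --> \int[mu]_(x in @Rpos R) f x.
Proof.
move=> fi xn.
have mP : measurable (@Rpos R) by rewrite /Rpos -set_itvoy; exact: measurable_itv.
have mf : measurable_fun (@Rpos R) f by apply/measurable_EFinP; exact: (measurable_int mu).
pose g n x := f x * \1_(`]0, (x_ n)]%classic : set R) x.
have -> : (fun n => prim f (x_ n)) = (fun n => \int[mu]_(x in @Rpos R) g n x).
  apply/funext => n; rewrite /prim /g -(@Rintegral_itv_obnd_cbnd _ 0 (BRight (x_ n))); last first.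
    apply: (@integrableS _ _ _ mu (@Rpos R)) => //.
    by move=> x; rewrite /= in_itv/= => /andP[].
  rewrite [LHS]Rintegral_mkcond [RHS]Rintegral_mkcond.
  apply: eq_Rintegral => x _; rewrite !patchE indicE.
  have [h|h] := boolP (x \in `]0, x_ n]%classic); last by rewrite mulr0 if_same.
  by move: h; rewrite inE /= in_itv/= => /andP[x0 _]; rewrite mulr1 mem_set.
have m1 n : measurable_fun (@Rpos R) (\1_(`]0, (x_ n)]%classic : set R) : R -> R).
  by apply: measurable_funTS; exact: measurable_indic.
apply: (@Rdominated_cvg _ _ _ mu (@Rpos R) g f (fun x => `|f x|)) => //.
- by move=> n; exact: (measurable_funM mf (m1 n)).
- apply: aeW => x x0; apply: cvg_near_cst.
  have [N _ hN] := nbhs_infty_ger x; exists N => // n /hN /= xn'.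
  by rewrite /g indicE mem_set ?mulr1//= in_itv/= (le_trans xn' (xn n)) andbT.
- exact: integrable_norm.
- move=> n x _; rewrite /g indicE normrM.
  by case: (_ \in _); rewrite ?normr0 ?mulr0 ?normr1 ?mulr1.
Qed.

(** Every interval to the right of [x] contains points where [f] and [g] agree. Values at 0 are read
    off almost everywhere equalities in this way. *)
Lemma at_right_lim_ae_eq f g x (lf lg : R) : 0 <= x ->
  {ae mu, forall y, 0 < y -> f y = g y} ->
  f y @[y --> x^'+] --> lf -> g y @[y --> x^'+] --> lg -> lf = lg.
Proof.
move=> x0 fg cf cg; apply/eqP; rewrite -subr_eq0; apply: contrapT => /negP d0.
have : (f y - g y) @[y --> x^'+] --> lf - lg by exact: cvgB.
move/cvgrPdist_lt => /(_ `|lf - lg|); rewrite normr_gt0 => /(_ d0)[d /= d1 hd].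
have xd : x < x + d by rewrite ltrDl.
have [y xyd fgy] := ae_exists_itv xd fg.
have [xy yd] : x < y /\ y < x + d by move: xyd; rewrite in_itv/= => /andP.
have := hd y; rewrite /= ltr_distlC => /(_ _ xy).
rewrite fgy ?(le_lt_trans x0)// subrr subr0 ltxx => H; apply: notF; apply: H.
by apply/andP; split; lra.
Qed.

(** The Wronskian is a constant plus a primitive of an integrable function, so it converges along
    any sequence tending to infinity; along a suitable one it tends to 0, which determines the
    integral by its value at 0. *)
Lemma wronskian_integral f f1 f2 g g1 g2 F F1 G G1 :
  f \in Lfun mu 2%:E -> f1 \in Lfun mu 2%:E -> f2 \in Lfun mu 2%:E ->
  g \in Lfun mu 2%:E -> g1 \in Lfun mu 2%:E -> g2 \in Lfun mu 2%:E ->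
  continuous F -> continuous F1 -> continuous G -> continuous G1 ->
  (forall x, F x = F 0 + prim F1 x) -> (forall x, G x = G 0 + prim G1 x) ->
  {ae mu, forall x, 0 < x -> f x = F x} -> {ae mu, forall x, 0 < x -> f1 x = F1 x} ->
  {ae mu, forall x, 0 < x -> g x = G x} -> {ae mu, forall x, 0 < x -> g1 x = G1 x} ->
  is_weak_deriv f1 f2 -> is_weak_deriv g1 g2 ->
  \int[mu]_(x in @Rpos R) (f x * g2 x - g x * f2 x) = - (F 0 * G1 0 - G 0 * F1 0).
Proof.
move=> fL f1L f2L gL g1L g2L cF cF1 cG cG1 hF hG eF eF1 eG eG1 wf wg.
have dprim H H1 : (forall x, H x = H 0 + prim H1 x) -> continuous H1 ->
    forall x, 0 < x -> is_derive x (1 : R) H (H1 x).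
  move=> hH cH1 x x0; have d1 := is_derive_cst (H 0) x (1 : R).
  have := is_deriveD d1 (is_derive_prim cH1 x0); rewrite add0r.
  by rewrite (_ : cst _ + _ = H)//; apply/funext => y; rewrite [RHS]hH.
have wW := weak_deriv_wronskian f1L f2L g1L g2L cF cF1 cG cG1 (dprim _ _ hF cF1)
  (dprim _ _ hG cG1) eF1 eG1 wf wg.
set W := (fun x => F x * G1 x - _) in wW; set w := (fun x => F x * g2 x - _) in wW.
have cW : continuous W.
  by move=> x; apply: cvgB; apply: cvgM; [exact: cF|exact: cG1|exact: cG|exact: cF1].
have f2i := Lfun2_locally_integrable f2L; have g2i := Lfun2_locally_integrable g2L.
have wi : locally_integrable setT w.
  by apply: locally_integrableB; exact: locally_integrable_mul_continuous.
have Wi := continuous_locally_integrable cW.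
have [c hc] := weak_FTC Wi wi wW.
have mP : measurable (@Rpos R) by rewrite /Rpos -set_itvoy; exact: measurable_itv.
have mW : measurable_fun setT W by exact: continuous_measurable_fun.
have mw : measurable_fun setT w by case: wi.
have cp := continuous_prim wi.
(* Continuity upgrades the almost everywhere identity to all of [[0, oo)]; at 0 it reads
   [c = W 0]. *)
have Wc x : 0 <= x -> W x = c + prim w x.
  move=> x0; apply: (@at_right_lim_ae_eq W (fun y => c + prim w y)) x0 _ _ _.
  - by apply: (ae_imp hc) => y h y0; exact: h.
  - by apply: cvg_at_right_filter; exact: cW.
  - by apply: cvg_at_right_filter; apply: cvgD; [exact: cvg_cst|exact: cp].
have aeI (h h' : R -> R) : {ae mu, forall x, 0 < x -> h x = h' x} ->
    measurable_fun setT h' -> integ h -> mu.-integrable (@Rpos R) (EFin \o h').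
  move=> hh' mh' hi; have hi' : mu.-integrable (@Rpos R) (EFin \o h).
    exact: (@integrableS _ _ _ mu setT).
  have mh'P : measurable_fun (@Rpos R) (EFin \o h').
    by apply/measurable_EFinP; exact: measurable_funTS.
  apply/integrableP; split => //.
  move/integrableP : hi' => [mh].
  suff -> : (\int[mu]_(x in @Rpos R) `|(EFin \o h) x| =
      \int[mu]_(x in @Rpos R) `|(EFin \o h') x|)%E by [].
  apply: ae_eq_integral => //.
  - exact: measurableT_comp.
  - exact: measurableT_comp.
  - by apply: (ae_imp hh') => x h0 x0; rewrite /= h0.
have i1 : mu.-integrable (@Rpos R) (EFin \o W).
  apply: (aeI (fun x => f x * g1 x - g x * f1 x)) => //.
    apply: (ae_imp (ae_and (ae_and eF eF1) (ae_and eG eG1))) => x [[h1 h2] [h3 h4]] x0.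
    by rewrite /W h1// h2// h3// h4.
  by apply: integrable_sub => //; exact: Lfun2_mul.
have ew : {ae mu, forall x, 0 < x -> f x * g2 x - g x * f2 x = w x}.
  apply: (ae_imp (ae_and eF eG)) => x [h1 h2] x0.
  by rewrite /w h1// h2.
have i2 : mu.-integrable (@Rpos R) (EFin \o w).
  apply: (aeI _ _ ew) => //; by apply: integrable_sub => //; exact: Lfun2_mul.
have -> : \int[mu]_(x in @Rpos R) (f x * g2 x - g x * f2 x) =
    \int[mu]_(x in @Rpos R) w x.
  congr fine; apply: ae_eq_integral => //.
  - apply/measurable_EFinP; apply: measurable_funTS; apply: measurable_funB.
      exact: (measurable_funM (Lfun2_measurable fL) (Lfun2_measurable g2L)).
    exact: (measurable_funM (Lfun2_measurable gL) (Lfun2_measurable f2L)).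
  - by apply/measurable_EFinP; exact: measurable_funTS.
  - by apply: (ae_imp ew) => x h x0; rewrite /= h.
have /choice[x_ hx] : forall n : nat, exists x, n%:R <= x /\ `|W x| < n.+1%:R^-1.
  move=> n; have e0 : 0 < n.+1%:R^-1 :> R by rewrite invr_gt0.
  by have [x nx Wx] := integrable_small_value n%:R cW i1 e0; exists x.
have c1 := prim_cvg_infty i2 (fun n => proj1 (hx n)).
have c2 : (fun n => W (x_ n) - c) @ \oo --> 0 - c.
  apply: cvgB; last exact: cvg_cst.
  apply/cvgrPdist_lt => e e0; have := near_infty_natSinv_lt (PosNum e0).
  by apply: filterS => n /=; rewrite sub0r normrN; apply: lt_trans; case: (hx n).
have -> : \int[mu]_(x in @Rpos R) w x = 0 - c.
  apply: (cvg_unique _ c1); first exact: norm_hausdorff.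
  rewrite (_ : (fun n => prim w (x_ n)) = (fun n => W (x_ n) - c))//.
  apply/funext => n; rewrite Wc ?(le_trans _ (proj1 (hx n)))//; ring.
by rewrite sub0r; have := Wc 0 (lexx _); rewrite prim0 addr0 => <-.
Qed.

End Wronskian.

(** * Weighted estimates for the Volterra equation *)

Section Volterra.
Context (R : realType).
Implicit Types (f g v F : R -> R).

Local Notation mu := (@lebesgue_measure R).

(* On (0, oo), [f] is the solution of [- f'' + v f = g], [f(0) = f'(0) = 0]. *)
Definition volterra v f g : Prop := exists F F1 f2 : R -> R,
  [/\ continuous F /\ continuous F1, f2 \in Lfun mu 2%:E,
      {ae mu, forall x, 0 < x -> f x = F x},
      (forall x, F x = prim F1 x) /\ (forall x, F1 x = prim f2 x) &
      {ae mu, forall x, 0 < x -> f2 x = v x * f x - g x}].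

Lemma ler_geometric_limit (a b q : R) :
  (forall n, a <= q * 2^-1 ^+ n + b) -> a <= b.
Proof.
move=> h; rewrite -[leRHS]add0r -(mulr0 q).
have c : (fun n => q * (2^-1 : R) ^+ n + b) @ \oo --> q * 0 + b.
  apply: cvgD; last exact: cvg_cst.
  by apply: cvgM; [exact: cvg_cst|apply: cvg_expr; rewrite ger0_norm ?invf_lt1 ?ltr1n].
apply: (cvgr_to_ge c); exact: nearW.
Qed.

(** Two integrations of [v F - g] send a weighted bound [q] on [F] to at most [q / 2 + a / l], and a
    third one bounds the primitive. Hypothesis and conclusion concern primitives alike, so the
    estimate iterates. *)
Lemma volterra_le v f g (C l a x : R) :
  measurable_fun setT v -> (forall y, `|v y| <= C) ->
  locally_integrable setT f -> locally_integrable setT g ->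
  volterra v f g -> 1 <= l -> 2 * C <= l ^+ 2 -> 0 <= a ->
  (forall y, 0 <= y -> `|prim g y| <= a * expR (l * y)) ->
  0 <= x -> `|prim f x| <= 2 / l ^+ 2 * a * expR (l * x).
Proof.
move=> mv vC fi gi [F [F1 [f2 [[cF cF1] f2L eF [hF hF1] ef2]]]] l1 lC a0 ga x0.
have l0 : 0 < l by rewrite (lt_le_trans ltr01).
have Fi := continuous_locally_integrable cF.
have F1i := continuous_locally_integrable cF1.
have f2i := Lfun2_locally_integrable f2L.
have mf2 := Lfun2_measurable f2L.
have C0 : 0 <= C by exact: le_trans (vC 0).
have mF : measurable_fun setT F by exact: continuous_measurable_fun.
have mg : measurable_fun setT g by case: gi.
have mf : measurable_fun setT f by case: fi.
have vFi : locally_integrable setT (fun y => v y * F y).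
  split; [exact: measurable_funM|exact: openT|].
  move=> K _ cK; have mK : @measurable _ (measurableTypeR R) K by exact: compact_measurable.
  have FK : mu.-integrable K (EFin \o F).
    by apply: continuous_compact_integrable => //; exact: continuous_subspaceT.
  have := integrable_mul_bounded mK FK (measurable_funTS mv) (fun y _ => vC y).
  by move=> /integrableP[_]; under eq_integral do rewrite /= mulrC.
have F1E y : F1 y = prim (fun y => v y * F y) y - prim g y.
  rewrite hF1 -primB//; apply: eq_prim => //.
    by apply: measurable_funB => //; exact: measurable_funM.
  by apply: (ae_imp (ae_and ef2 eF)) => t [h1 h2] t0; rewrite h1// h2.
have step q : 0 <= q -> (forall y, 0 <= y -> `|F y| <= q * expR (l * y)) ->
    forall y, 0 <= y -> `|F y| <= (C * q / l ^+ 2 + a / l) * expR (l * y).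
  move=> q0 hq.
  have h1 y : 0 <= y -> `|F1 y| <= (C * q / l + a) * expR (l * y).
    move=> y0; rewrite F1E (le_trans (ler_normB _ _))// mulrDl lerD ?ga//.
    apply: prim_le_expR => //; first by rewrite mulr_ge0.
    apply: aeW => t t0; rewrite normrM -mulrA.
    by apply: ler_pM => //; apply: hq; exact: ltW.
  move=> y y0; rewrite hF.
  have -> : C * q / l ^+ 2 + a / l = (C * q / l + a) / l by field; rewrite gt_eqF.
  apply: prim_le_expR => //; first by rewrite addr_ge0// divr_ge0 ?mulr_ge0// ltW.
  by apply: aeW => t t0; apply: h1; exact: ltW.
(* Supplies a finite starting bound; the summand 1 ensures that the integral of [f2 ^+ 2] is at most
   [s ^+ 2]. *)
pose s := 1 + \int[mu]_t (f2 t ^+ 2).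
have I0 : 0 <= \int[mu]_t (f2 t ^+ 2) by apply: Rintegral_ge0 => t _; exact: sqr_ge0.
have s0 : 0 < s by rewrite ltr_wpDr.
have le_exp y : 0 <= y -> 1 + y <= expR (l * y).
  by move=> y0; rewrite (le_trans _ (expR_ge1Dx _))// lerD2l ler_peMl.
have q0 y : 0 <= y -> `|F y| <= s / l * expR (l * y).
  move=> y0; rewrite hF; apply: prim_le_expR => //; first exact: ltW.
  apply: aeW => t t0; rewrite hF1.
  apply: (le_trans (prim_le_L2 f2L s0 _ (ltW t0))).
    by rewrite /s; move: I0; move: (Rintegral _ _ _) => J; nra.
  by rewrite ler_wpM2l ?le_exp// ltW.
(* [2 * a / l] is the fixed point of [q -> q / 2 + a / l]; the excess over it is halved at each
   step. *)
have qn n y : 0 <= y -> `|F y| <= (s / l * 2^-1 ^+ n + 2 * a / l) * expR (l * y).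
  elim: n y => [|n IHn] y y0.
    rewrite expr0 mulr1 (le_trans (q0 y y0))// ler_wpM2r ?expR_ge0//.
    by rewrite lerDl divr_ge0 ?mulr_ge0// ltW.
  have qn0 : 0 <= s / l * 2^-1 ^+ n + 2 * a / l.
    by rewrite addr_ge0// ?mulr_ge0 ?exprn_ge0 ?invr_ge0// ltW.
  apply: (le_trans (step _ qn0 IHn y y0)); rewrite ler_wpM2r ?expR_ge0//.
  have : C * (s / l * 2^-1 ^+ n + 2 * a / l) / l ^+ 2 <=
      2^-1 * (s / l * 2^-1 ^+ n + 2 * a / l).
    by rewrite mulrAC ler_wpM2r// ler_pdivrMr ?exprn_gt0// mulrC; lra.
  rewrite [2^-1 ^+ n.+1]exprS.
  have -> : 2 * a / l = 2 * (a / l) by rewrite mulrA.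
  have -> : s / l * (2^-1 * 2^-1 ^+ n) = 2^-1 * (s / l * 2^-1 ^+ n) by ring.
  by move: (s / l * _) (a / l) => A B; lra.
have Fb y : 0 <= y -> `|F y| <= 2 * a / l * expR (l * y).
  move=> y0; rewrite -ler_pdivrMr ?expR_gt0//.
  by apply: (@ler_geometric_limit _ _ (s / l)) => n; rewrite ler_pdivrMr ?expR_gt0// qn.
have -> : prim f x = prim F x by exact: eq_prim.
have -> : 2 / l ^+ 2 * a = 2 * a / l / l by field; rewrite gt_eqF.
apply: prim_le_expR => //; first by rewrite divr_ge0 ?mulr_ge0// ltW.
by apply: aeW => t t0; apply: Fb; exact: ltW.
Qed.

(** Backward induction from the last function, whose L^2 bound gives [s (1 + x) <= s exp(l x)] for
    its primitive. *)
Lemma volterra_chain v (w : nat -> R -> R) (C l s x : R) m :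
  measurable_fun setT v -> (forall y, `|v y| <= C) ->
  (forall j, w j \in Lfun mu 2%:E) ->
  (forall j, (j < m)%N -> volterra v (w j) (w j.+1)) ->
  1 <= l -> 2 * C <= l ^+ 2 -> 0 < s -> \int[mu]_t (w m t ^+ 2) <= s ^+ 2 ->
  0 <= x -> `|prim (w 0%N) x| <= (2 / l ^+ 2) ^+ m * s * expR (l * x).
Proof.
move=> mv vC wL wv l1 lC s0 ws x0.
have l0 : 0 < l by rewrite (lt_le_trans ltr01).
have l2 : 0 <= 2 / l ^+ 2 by rewrite divr_ge0// exprn_ge0// ltW.
have wi j := Lfun2_locally_integrable (wL j).
suff H k : (k <= m)%N -> forall y, 0 <= y ->
    `|prim (w (m - k)%N) y| <= (2 / l ^+ 2) ^+ k * s * expR (l * y).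
  by have := H m (leqnn _) x x0; rewrite subnn.
elim: k => [_ y y0|k IHk km y y0].
  rewrite subn0 expr0 mul1r (le_trans (prim_le_L2 (wL m) s0 ws y0))//.
  rewrite ler_wpM2l ?(ltW s0)// (le_trans _ (expR_ge1Dx _))// lerD2l ler_peMl//.
have mk : (m - k)%N = (m - k.+1).+1 by rewrite subnSK.
rewrite exprS -[X in X * expR _]mulrA.
apply: (@volterra_le v _ (w (m - k)%N) C) => //.
- by rewrite mk; apply: wv; rewrite ltn_subrL /= (leq_ltn_trans _ km).
- by rewrite mulr_ge0 ?exprn_ge0// ltW.
- by move=> z z0; apply: IHk => //; exact: ltnW.
Qed.

End Volterra.

(** * Complex L^2 through real and imaginary parts *)

Section ConcreteL2.
Context (R : realType).
Implicit Types (f g : L2 R) (phi : R -> R).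

Local Notation mu := (@lebesgue_measure R).
Local Notation integ f := (mu.-integrable setT (EFin \o f)).

(** Extension by 0 turns integrals over (0, oo) into integrals over the line, where the real L^2
    lemmas are stated. *)
Definition re_part (u : R -> R[i]) : R -> R := (cRe \o u) \_ (@Rpos R).
Definition im_part (u : R -> R[i]) : R -> R := (cIm \o u) \_ (@Rpos R).

Lemma re_partE (u : R -> R[i]) x : 0 < x -> re_part u x = cRe (u x).
Proof. by move=> x0; rewrite /re_part patchE mem_set. Qed.

Lemma im_partE (u : R -> R[i]) x : 0 < x -> im_part u x = cIm (u x).
Proof. by move=> x0; rewrite /im_part patchE mem_set. Qed.

Lemma re_part0 (u : R -> R[i]) x : ~ 0 < x -> re_part u x = 0.
Proof. by move=> x0; rewrite /re_part patchE memNset. Qed.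

Lemma im_part0 (u : R -> R[i]) x : ~ 0 < x -> im_part u x = 0.
Proof. by move=> x0; rewrite /im_part patchE memNset. Qed.

Lemma re_part_Lfun2 f : re_part f \in Lfun mu 2%:E.
Proof. by have /andP[] := L2_fun_valP (repr f). Qed.

Lemma im_part_Lfun2 f : im_part f \in Lfun mu 2%:E.
Proof. by have /andP[] := L2_fun_valP (repr f). Qed.

Lemma Re_cintegral u : cRe (cintegral u) = \int[mu]_x re_part u x.
Proof. by rewrite /cintegral/= Rintegral_mkcond. Qed.

Lemma Im_cintegral u : cIm (cintegral u) = \int[mu]_x im_part u x.
Proof. by rewrite /cintegral/= Rintegral_mkcond. Qed.

Lemma Re_L2ip f g : cRe (L2ip f g) =
  \int[mu]_x (re_part f x * re_part g x + im_part f x * im_part g x).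
Proof.
rewrite /L2ip Re_cintegral; apply: eq_Rintegral => x _.
have [x0|x0] := pselect (0 < x); last by rewrite !re_part0// !im_part0// !mul0r addr0.
rewrite !re_partE// !im_partE//; case: (fun_of_L2 f x) (fun_of_L2 g x) => a b [c d] /=.
by rewrite mulNr opprK.
Qed.

Lemma Im_L2ip f g : cIm (L2ip f g) =
  \int[mu]_x (re_part f x * im_part g x - im_part f x * re_part g x).
Proof.
rewrite /L2ip Im_cintegral; apply: eq_Rintegral => x _.
have [x0|x0] := pselect (0 < x); last by rewrite !re_part0// !im_part0// !mul0r subr0.
rewrite !re_partE// !im_partE//; case: (fun_of_L2 f x) (fun_of_L2 g x) => a b [c d] /=.
by rewrite mulNr.
Qed.

Lemma pi_L2P (u v : L2_fun_type R) : \pi_(L2 R)%qT u = \pi_(L2 R)%qT v <->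
  {ae mu, forall x, 0 < x -> u x = v x}.
Proof.
split.
  move=> /eqP; rewrite -Quotient.idealrBE => /asboolP h.
  by apply: (ae_imp h) => x hx /hx /eqP; rewrite subr_eq0 => /eqP.
move=> h; apply/eqP; rewrite -Quotient.idealrBE; apply/asboolP.
by apply: (ae_imp h) => x hx x0; rewrite /= [LHS]/GRing.add/= hx ?subrr.
Qed.

Lemma L2_ext f g : {ae mu, forall x, 0 < x -> f x = g x} -> f = g.
Proof. by move=> h; rewrite -[f]reprK -[g]reprK; apply/pi_L2P. Qed.

Lemma repr_pi_L2 (u : L2_fun_type R) :
  {ae mu, forall x, 0 < x -> fun_of_L2 (\pi_(L2 R)%qT u) x = u x}.
Proof. by apply/pi_L2P; rewrite reprK. Qed.

(** A class is evaluated through an arbitrary representative, so linearity of evaluation holds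
    almost everywhere only. *)
Lemma L2_lin_ae (a : R[i]) f g :
  {ae mu, forall x, 0 < x -> fun_of_L2 (a *: f + g) x = a * f x + g x}.
Proof.
have -> : a *: f + g = \pi_(L2 R)%qT (a *: repr f + repr g).
  by rewrite -{1}[g]reprK [a *: f]/(L2_scale a f) /L2_scale -raddfD.
exact: repr_pi_L2.
Qed.

Lemma toL2_ae (u : R -> R[i]) : u \in @L2_fun R ->
  {ae mu, forall x, 0 < x -> fun_of_L2 (toL2 u) x = u x}.
Proof.
by move=> uL; apply: (ae_imp (repr_pi_L2 (insubd 0 u))) => x h x0; rewrite h// insubdK.
Qed.

Lemma re_part_lin_ae (a : R[i]) f g : {ae mu, forall x,
  re_part (a *: f + g : L2 R) x = cRe a * re_part f x - cIm a * im_part f x + re_part g x}.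
Proof.
apply: (ae_imp (L2_lin_ae a f g)) => x h.
have [x0|x0] := pselect (0 < x); last by rewrite !re_part0// !im_part0// !mulr0 subr0 addr0.
by rewrite !re_partE// !im_partE// h// cReD cReM.
Qed.

Lemma im_part_lin_ae (a : R[i]) f g : {ae mu, forall x,
  im_part (a *: f + g : L2 R) x = cRe a * im_part f x + cIm a * re_part f x + im_part g x}.
Proof.
apply: (ae_imp (L2_lin_ae a f g)) => x h.
have [x0|x0] := pselect (0 < x); last by rewrite !re_part0// !im_part0// !mulr0 !addr0.
by rewrite !re_partE// !im_partE// h// cImD cImM.
Qed.

Lemma L2_ext_parts f g : {ae mu, forall x, 0 < x -> re_part f x = re_part g x} ->
  {ae mu, forall x, 0 < x -> im_part f x = im_part g x} -> f = g.
Proof.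
move=> hr hi; apply: L2_ext; apply: (ae_imp (ae_and hr hi)) => x [h1 h2] x0.
move: (h1 x0) (h2 x0); rewrite !re_partE// !im_partE//.
by case: (fun_of_L2 f x) (fun_of_L2 g x) => a b [c d] /= -> ->.
Qed.

Lemma re_part_measurable f : measurable_fun setT (re_part f).
Proof. exact: Lfun2_measurable (re_part_Lfun2 f). Qed.

Lemma im_part_measurable f : measurable_fun setT (im_part f).
Proof. exact: Lfun2_measurable (im_part_Lfun2 f). Qed.

Lemma L2_nsqE f : cRe (L2ip f f) =
  \int[mu]_x (re_part f x ^+ 2) + \int[mu]_x (im_part f x ^+ 2).
Proof.
rewrite Re_L2ip RintegralD//; apply: Lfun2_mul;
  by [exact: re_part_Lfun2|exact: im_part_Lfun2].
Qed.

End ConcreteL2.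

(** * L^2 as a Hilbert space *)

Section L2Hilbert.
Context (R : realType).
Implicit Types (f g : L2 R).

Local Notation mu := (@lebesgue_measure R).
Local Notation integ f := (mu.-integrable setT (EFin \o f)).

Lemma Lfun2_ae (u v : R -> R) : u \in Lfun mu 2%:E -> measurable_fun setT v ->
  {ae mu, forall x, u x = v x} -> v \in Lfun mu 2%:E.
Proof.
move=> /Lfun2P[mu_ /integrableP[_ u2]] mv uv; apply/Lfun2P; split => //.
apply/integrableP; split; first by apply/measurable_EFinP; exact: measurable_funX.
suff <- : (\int[mu]_x `|(u x ^+ 2)%R%:E| =
    \int[mu]_x `|(v x ^+ 2)%R%:E|)%E by [].
apply: ae_eq_integral => //.
- by apply: measurableT_comp => //; apply/measurable_EFinP; exact: measurable_funX.
- by apply: measurableT_comp => //; apply/measurable_EFinP; exact: measurable_funX.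
- by apply: (ae_imp uv) => x h _; rewrite /= h.
Qed.

Lemma measurable_Rpos : @measurable _ (measurableTypeR R) (@Rpos R).
Proof. by rewrite /Rpos -set_itvoy; exact: measurable_itv. Qed.

Lemma measurable_restrict_Rpos (u : R -> R) : measurable_fun setT u ->
  measurable_fun setT (u \_ (@Rpos R)).
Proof.
move=> mu_; apply/(@measurable_restrictT _ _ (measurableTypeR R) _ _ u measurable_Rpos).
exact: measurable_funTS.
Qed.

Lemma Lfun2_restrict (u : R -> R) : u \in Lfun mu 2%:E -> u \_ (@Rpos R) \in Lfun mu 2%:E.
Proof.
move=> /Lfun2P[mu_ u2]; apply/Lfun2P; have m' := measurable_restrict_Rpos mu_.
split => //; apply: (le_integrable _ _ _ u2) => //.
  by apply/measurable_EFinP; exact: measurable_funX.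
move=> x _; rewrite /= lee_fin patchE; case: ifP => _ //.
by rewrite expr0n normr0 normr_ge0.
Qed.

Lemma re_part_mk (v w : R -> R) : re_part (fun t => v t +i* w t) = v \_ (@Rpos R).
Proof. by apply/funext => x; rewrite /re_part !patchE. Qed.

Lemma im_part_mk (v w : R -> R) : im_part (fun t => v t +i* w t) = w \_ (@Rpos R).
Proof. by apply/funext => x; rewrite /im_part !patchE. Qed.

Lemma L2_fun_parts (u : R -> R[i]) : re_part u \in Lfun mu 2%:E ->
  im_part u \in Lfun mu 2%:E -> u \in @L2_fun R.
Proof. by move=> hr hi; apply/andP. Qed.

Lemma re_part_toL2 (u : R -> R[i]) : u \in @L2_fun R ->
  {ae mu, forall x, re_part (toL2 u) x = re_part u x}.
Proof.
move=> /toL2_ae h; apply: (ae_imp h) => x hx.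
by have [x0|x0] := pselect (0 < x); [rewrite !re_partE// hx|rewrite !re_part0].
Qed.

Lemma im_part_toL2 (u : R -> R[i]) : u \in @L2_fun R ->
  {ae mu, forall x, im_part (toL2 u) x = im_part u x}.
Proof.
move=> /toL2_ae h; apply: (ae_imp h) => x hx.
by have [x0|x0] := pselect (0 < x); [rewrite !im_partE// hx|rewrite !im_part0].
Qed.

Lemma re_partB_ae f g : {ae mu, forall x,
  re_part (f - g : L2 R) x = re_part f x - re_part g x}.
Proof.
apply: (ae_imp (re_part_lin_ae (-1) g f)) => x.
rewrite scaleN1r addrC => -> /=; rewrite oppr0; ring.
Qed.

Lemma im_partB_ae f g : {ae mu, forall x,
  im_part (f - g : L2 R) x = im_part f x - im_part g x}.
Proof.
apply: (ae_imp (im_part_lin_ae (-1) g f)) => x.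
rewrite scaleN1r addrC => -> /=; rewrite oppr0; ring.
Qed.

Lemma L2_hilbert : hilbert_space (@L2ip R).
Proof.
have rL f := re_part_Lfun2 f; have iL f := im_part_Lfun2 f.
have i2 (u v : R -> R) : u \in Lfun mu 2%:E -> v \in Lfun mu 2%:E -> integ (fun x => u x * v x).
  exact: Lfun2_mul.
have i3 (u v w z : R -> R) : u \in Lfun mu 2%:E -> v \in Lfun mu 2%:E ->
    w \in Lfun mu 2%:E -> z \in Lfun mu 2%:E -> integ (fun x => u x * v x + w x * z x).
  by move=> *; apply: integrable_add => //; exact: i2.
have i4 (u v w z : R -> R) : u \in Lfun mu 2%:E -> v \in Lfun mu 2%:E ->
    w \in Lfun mu 2%:E -> z \in Lfun mu 2%:E -> integ (fun x => u x * v x - w x * z x).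
  by move=> *; apply: integrable_sub => //; exact: i2.
have mm (u v : R -> R) : u \in Lfun mu 2%:E -> v \in Lfun mu 2%:E ->
    measurable_fun setT (fun x => u x * v x).
  by move=> h1 h2; exact: (measurable_funM (Lfun2_measurable h1) (Lfun2_measurable h2)).
have mi (w : R -> R) : integ w -> measurable_fun setT w.
  by move=> wi; apply/measurable_EFinP; exact: (measurable_int mu).
split.
- move=> x a y z; apply/eqP; rewrite eq_complex cReD cImD cReM cImM !Re_L2ip !Im_L2ip.
  have cr := re_part_lin_ae a y z; have ci := im_part_lin_ae a y z.
  rewrite -!RintegralZl//; try by [exact: i3|exact: i4].
  have is_ (c : R) (u v w t : R -> R) : u \in Lfun mu 2%:E -> v \in Lfun mu 2%:E ->
      w \in Lfun mu 2%:E -> t \in Lfun mu 2%:E -> integ (fun x => c * (u x * v x + w x * t x)).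
    by move=> *; apply: integrable_scale => //; exact: i3.
  have is' (c : R) (u v w t : R -> R) : u \in Lfun mu 2%:E -> v \in Lfun mu 2%:E ->
      w \in Lfun mu 2%:E -> t \in Lfun mu 2%:E -> integ (fun x => c * (u x * v x - w x * t x)).
    by move=> *; apply: integrable_scale => //; exact: i4.
  rewrite -RintegralB//; try by [exact: is_|exact: is'].
  rewrite -RintegralD//; try by [exact: is_|exact: is'|exact: i3|
    apply: integrable_sub => //; by [exact: is_|exact: is']].
  rewrite -RintegralD//; try by [exact: is_|exact: is'].
  rewrite -RintegralD//; try by [exact: i4|
    apply: integrable_add => //; by [exact: is_|exact: is']].
  apply/andP; split; apply/eqP; apply: ae_eq_Rintegral.
  + by apply: measurable_funD; exact: mm.
  + apply: mi; apply: integrable_add => //; last exact: i3.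
    by apply: integrable_sub => //; [exact: is_|exact: is'].
  + apply: (ae_imp (ae_and cr ci)) => t [-> ->]; ring.
  + by apply: measurable_funB; exact: mm.
  + apply: mi; apply: integrable_add => //; last exact: i4.
    by apply: integrable_add => //; [exact: is'|exact: is_].
  + apply: (ae_imp (ae_and cr ci)) => t [-> ->]; ring.
- move=> x y; apply/eqP; rewrite eq_complex.
  have -> (z : R[i]) : cRe z^*%C = cRe z by case: z.
  have -> (z : R[i]) : cIm z^*%C = - cIm z by case: z.
  rewrite !Re_L2ip !Im_L2ip; apply/andP; split; apply/eqP.
    by apply: eq_Rintegral => t _; ring.
  rewrite -mulN1r -RintegralZl//; last exact: i4.
  by apply: eq_Rintegral => t _; ring.
- by move=> x; rewrite Re_L2ip; apply: Rintegral_ge0 => t _; rewrite addr_ge0// -expr2 sqr_ge0.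
move=> u; move: (u : nat -> L2 R) => {}u uC.
have nB f g : cRe (L2ip (f - g) (f - g)) =
    \int[mu]_x ((re_part f x - re_part g x) ^+ 2) +
    \int[mu]_x ((im_part f x - im_part g x) ^+ 2).
  rewrite L2_nsqE; congr (_ + _); apply: ae_eq_Rintegral.
  + by apply: measurable_funX; exact: re_part_measurable.
  + by apply: measurable_funX; apply: measurable_funB; exact: re_part_measurable.
  + by apply: (ae_imp (re_partB_ae f g)) => x ->.
  + by apply: measurable_funX; exact: im_part_measurable.
  + by apply: measurable_funX; apply: measurable_funB; exact: im_part_measurable.
  + by apply: (ae_imp (im_partB_ae f g)) => x ->.
have sq0 (w : R -> R) : 0 <= \int[mu]_x (w x ^+ 2).
  by apply: Rintegral_ge0 => x _; exact: sqr_ge0.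
have cauchy (e : R) : 0 < e -> exists N, forall m n, (N <= m)%N -> (N <= n)%N ->
    cRe (L2ip (u m - u n) (u m - u n)) < e.
  move=> e0; have e1 : 0 < Num.sqrt e by rewrite sqrtr_gt0.
  have [N hN] := uC _ e1; exists N => m n Nm Nn; have := hN m n Nm Nn.
  by rewrite /hnorm ltr_sqrt.
have [|v vL hv] := @Lfun2_complete _ _ R mu (fun n => re_part (u n)) (fun n => rL (u n)).
  move=> e e0; have [N hN] := cauchy e e0; exists N => m n Nm Nn.
  have := hN m n Nm Nn; rewrite nB; apply: le_lt_trans.
  by rewrite lerDl; exact: (sq0 (fun x => im_part (u m) x - im_part (u n) x)).
have [|w wL hw] := @Lfun2_complete _ _ R mu (fun n => im_part (u n)) (fun n => iL (u n)).
  move=> e e0; have [N hN] := cauchy e e0; exists N => m n Nm Nn.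
  have := hN m n Nm Nn; rewrite nB; apply: le_lt_trans.
  by rewrite lerDr; exact: (sq0 (fun x => re_part (u m) x - re_part (u n) x)).
pose z t := v t +i* w t.
have zL : z \in @L2_fun R.
  by apply: L2_fun_parts; rewrite ?re_part_mk ?im_part_mk; exact: Lfun2_restrict.
exists (toL2 z); apply/cvgrPdist_le => e e0.
have e2 : 0 < e ^+ 2 / 2 by rewrite divr_gt0 ?exprn_gt0.
have [N1 hN1] := hv _ e2; have [N2 hN2] := hw _ e2.
exists (maxn N1 N2) => // n /=; rewrite geq_max => /andP[n1 n2].
rewrite sub0r normrN ger0_norm ?sqrtr_ge0//.
rewrite /hnorm -(ger0_norm (ltW e0)) -sqrtr_sqr ler_wsqrtr// nB.
(* The limits found on the line may be nonzero on the negative half-line; restricting them can only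
   reduce the distance to functions that vanish there. *)
have le1 (p q q' : R -> R) : p \in Lfun mu 2%:E -> q \in Lfun mu 2%:E ->
    q' \in Lfun mu 2%:E -> (forall x, ~ 0 < x -> p x = 0) ->
    {ae mu, forall x, q' x = (q \_ (@Rpos R)) x} ->
    \int[mu]_x ((p x - q' x) ^+ 2) <= \int[mu]_x ((p x - q x) ^+ 2).
  move=> pL qL q'L p0 qq'.
  have rL' := Lfun2_restrict qL.
  rewrite (@ae_eq_Rintegral _ _ _ mu _ (fun x => (p x - (q \_ (@Rpos R)) x) ^+ 2)); last 3 first.
  + by apply: measurable_funX; exact: Lfun2_measurable (Lfun2B pL q'L).
  + by apply: measurable_funX; exact: Lfun2_measurable (Lfun2B pL rL').
  + by apply: (ae_imp qq') => x ->.
  apply: le_Rintegral => //.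
  + by apply: Lfun2_integrable_sqr; exact: Lfun2B.
  + by apply: Lfun2_integrable_sqr; exact: Lfun2B.
  move=> x _; rewrite patchE; case: ifPn => // /negP x0.
  by rewrite p0 ?sub0r ?oppr0 ?expr0n ?sqr_ge0// => x0'; apply: x0; rewrite inE.
rewrite (splitr (e ^+ 2)) lerD//.
  apply: le_trans (hN1 n n1); apply: le1 => //; first by move=> x; exact: re_part0.
  by apply: (ae_imp (re_part_toL2 zL)) => x ->; rewrite re_part_mk.
apply: le_trans (hN2 n n2); apply: le1 => //; first by move=> x; exact: im_part0.
by apply: (ae_imp (im_part_toL2 zL)) => x ->; rewrite im_part_mk.
Qed.

End L2Hilbert.

(** * Uniqueness of weak derivatives and of values at 0; bounded multipliers *)

Section OperatorDomain.
Context (R : realType).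
Implicit Types (f g : L2 R).

Local Notation mu := (@lebesgue_measure R).
Local Notation integ f := (mu.-integrable setT (EFin \o f)).

Lemma re_part_mulr (u : R -> R[i]) (p : R -> R) :
  re_part (fun x => u x * (p x)%:C) = (fun x => re_part u x * p x).
Proof.
apply/funext => x; have [x0|x0] := pselect (0 < x); last by rewrite !re_part0// mul0r.
by rewrite !re_partE// -[LHS]/(cRe (u x * (p x)%:C)) cReM /= mulr0 subr0.
Qed.

Lemma im_part_mulr (u : R -> R[i]) (p : R -> R) :
  im_part (fun x => u x * (p x)%:C) = (fun x => im_part u x * p x).
Proof.
apply/funext => x; have [x0|x0] := pselect (0 < x); last by rewrite !im_part0// mul0r.
by rewrite !im_partE// -[LHS]/(cIm (u x * (p x)%:C)) cImM /= mulr0 add0r.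
Qed.

Lemma weak_derivative_parts f g : is_weak_derivative f g ->
  is_weak_deriv (re_part f) (re_part g) /\ is_weak_deriv (im_part f) (im_part g).
Proof.
have reN (z : R[i]) : cRe (- z) = - cRe z by case: z.
have imN (z : R[i]) : cIm (- z) = - cIm z by case: z.
move=> fg; split => phi tphi; have e := fg phi tphi.
  have := congr1 (@complex.Re R) e.
  by rewrite reN !Re_cintegral !re_part_mulr.
have := congr1 (@complex.Im R) e.
by rewrite imN !Im_cintegral !im_part_mulr.
Qed.

Lemma prim_ae_eq0 (u : R -> R) : locally_integrable setT u ->
  (forall x, 0 <= x -> prim u x = 0) -> {ae mu, forall x, 0 < x -> u x = 0}.
Proof.
move=> ui u0; have iu y : mu.-integrable [set` Interval (BLeft 0) (BRight y)] (EFin \o u).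
  exact: locally_integrable_itv.
apply: (ae_imp (FTC1 iu ui)) => x h x0.
have {h}[|_ <-] := h; first by rewrite /= lte_fin.
rewrite derive1E (near_eq_derive (g := cst 0)) ?derive_cst ?oner_eq0//.
apply: (@filterS _ _ _ [set y | 0 < y]); last exact: lt_nbhsr.
by move=> y /= /ltW; exact: u0.
Qed.

(** The continuous representatives of [u] built from [v] and from [w] agree on [[0, oo)], hence so
    do the primitives of [v] and [w]. *)
Lemma weak_deriv_unique (u v w : R -> R) : u \in Lfun mu 2%:E -> v \in Lfun mu 2%:E ->
  w \in Lfun mu 2%:E -> is_weak_deriv u v -> is_weak_deriv u w ->
  {ae mu, forall x, 0 < x -> v x = w x}.
Proof.
move=> uL vL wL uv uw.
have vi := Lfun2_locally_integrable vL; have wi := Lfun2_locally_integrable wL.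
have [F [cF eF hF]] := weak_deriv_rep uL vL uv.
have [G [cG eG hG]] := weak_deriv_rep uL wL uw.
have FG x : 0 <= x -> F x = G x.
  move=> x0; apply: (@at_right_lim_ae_eq _ F G x) => //.
  - by apply: (ae_imp (ae_and eF eG)) => y [h1 h2] y0; rewrite -h1// h2.
  - exact/cvg_at_right_filter/cF.
  - exact/cvg_at_right_filter/cG.
have vwi : locally_integrable setT (fun x => v x - w x) by exact: locally_integrableB.
have : {ae mu, forall x, 0 < x -> v x - w x = 0}.
  apply: prim_ae_eq0 => // x x0; rewrite primB//.
  by have := FG x x0; rewrite hF hG (FG 0)//; lra.
by move=> h; apply: (ae_imp h) => x hx /hx; lra.
Qed.

Lemma is_weak_derivative_unique f g g' :
  is_weak_derivative f g -> is_weak_derivative f g' -> g = g'.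
Proof.
move=> /weak_derivative_parts[r1 i1] /weak_derivative_parts[r2 i2].
apply: L2_ext_parts.
  exact: weak_deriv_unique (re_part_Lfun2 f) (re_part_Lfun2 g) (re_part_Lfun2 g') r1 r2.
exact: weak_deriv_unique (im_part_Lfun2 f) (im_part_Lfun2 g) (im_part_Lfun2 g') i1 i2.
Qed.

Lemma weak_derivativeE f g : is_weak_derivative f g -> weak_derivative f = g.
Proof.
move=> fg; apply: (is_weak_derivative_unique _ fg).
by rewrite /weak_derivative; case: xgetP => [_ ->//|/(_ g)].
Qed.

(** [value_at0] is a choice among admissible values; [F] and [G] provide one, and right limits at 0
    show that it is the only one. *)
Lemma value_at0E f (F G : R -> R) : continuous F -> continuous G ->
  {ae mu, forall x, 0 < x -> re_part f x = F x} ->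
  {ae mu, forall x, 0 < x -> im_part f x = G x} -> value_at0 f = F 0 +i* G 0.
Proof.
move=> cF cG eF eG.
have : is_value_at0 f (value_at0 f).
  apply: xgetPex; exists (F 0 +i* G 0); exists (fun x => F x +i* G x); split => //.
  - exact: continuous_subspaceT.
  - exact: continuous_subspaceT.
  - apply: (ae_imp (ae_and eF eG)) => x [h1 h2] x0; move: (h1 x0) (h2 x0).
    by rewrite re_partE// im_partE//; case: (fun_of_L2 f x) => a b /= -> ->.
move=> [g [cr ci eg <-]].
have [_ cr0] := (continuous_within_itvcyP _ _).1 cr.
have [_ ci0] := (continuous_within_itvcyP _ _).1 ci.
have hr : cRe (g 0) = F 0.
  apply: (@at_right_lim_ae_eq _ (cRe \o g) F 0) => //; last exact/cvg_at_right_filter/cF.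
  by apply: (ae_imp (ae_and eF eg)) => y [h1 h2] y0; rewrite -h1// re_partE// h2.
have hi : cIm (g 0) = G 0.
  apply: (@at_right_lim_ae_eq _ (cIm \o g) G 0) => //; last exact/cvg_at_right_filter/cG.
  by apply: (ae_imp (ae_and eG eg)) => y [h1 h2] y0; rewrite -h1// im_partE// h2.
by rewrite -hr -hi; case: (g 0).
Qed.

(** Truncation at the essential supremum; [volterra_le] asks for a bound at every point. *)
Lemma Lfunoo_bounded (v : R -> R) : v \in Lfun mu +oo%E -> exists (v' : R -> R) (C : R),
  [/\ measurable_fun setT v', forall x, `|v' x| <= C & {ae mu, forall x, v x = v' x}].
Proof.
rewrite inE => /andP[]; rewrite inE/= => mv; rewrite inE/= /finite_norm unlock.
(* The L^oo norm is the essential supremum only on a space of positive measure. *)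
have mT : (0 < mu setT)%E.
  apply: (@lt_le_trans _ _ (mu `]0%R, 1%R[%classic)).
    by rewrite lebesgue_measure_itv/= lte_fin ltr01 oppr0 adde0 lte_fin.
  by apply: le_measure => //; rewrite inE.
rewrite mT => voo.
pose C := Num.max 0 (fine (ess_sup mu (abse \o (EFin \o v)))).
exists (fun x => Num.max (- C) (Num.min C (v x))), C; split.
- apply: measurable_maxr => //; exact: measurable_minr.
- move=> x; have C0 : 0 <= C by rewrite /C le_max lexx.
  rewrite ler_norml le_max lexx/= ge_max ge_min lexx andbT.
  lra.
apply: (ae_imp (ess_sup_ge mu (abse \o (EFin \o v)))) => x hx.
have vC : `|v x| <= C.
  move: hx voo; rewrite /= /C; case: (ess_sup _ _) => [r|//|//].
  - by rewrite /= lee_fin le_max => -> _; rewrite orbT.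
rewrite min_r ?max_r//; first by move: vC; rewrite ler_norml => /andP[].
by rewrite (le_trans _ vC)// ler_norm.
Qed.

Lemma Lfun2_mul_bounded (v u : R -> R) (C : R) : measurable_fun setT v ->
  (forall x, `|v x| <= C) -> u \in Lfun mu 2%:E -> (fun x => v x * u x) \in Lfun mu 2%:E.
Proof.
move=> mv vC /Lfun2P[mu_ u2]; apply/Lfun2P; split; first exact: measurable_funM.
rewrite (_ : (fun x => _) = (fun x => u x ^+ 2 * v x ^+ 2)); last first.
  by apply/funext => x; rewrite exprMn mulrC.
apply: (@integrable_mul_bounded _ _ _ _ _ _ _ (C ^+ 2)) => //.
  exact: measurable_funX.
move=> x _; rewrite normrX ler_pXn2r ?nnegrE//; exact: le_trans (vC x).
Qed.

Lemma measurable_inv (u : R -> R) : measurable_fun setT u -> measurable_fun setT (fun x => (u x)^-1).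
Proof.
move=> mu_.
suff m : measurable_fun setT (fun x : R => x^-1) by exact: (measurableT_comp m mu_).
(* Continuous approximations converging everywhere, also at 0, where the inverse is 0 by
   convention. *)
pose h (n : nat) (x : R) := x / (x ^+ 2 + n.+1%:R^-1).
have e0 (n : nat) : 0 < n.+1%:R^-1 :> R by rewrite invr_gt0.
apply: (@measurable_fun_cvg _ _ _ setT h).
  move=> n; apply: continuous_measurable_fun => x.
  have c : (y ^+ 2 + n.+1%:R^-1 : R) @[y --> x] --> (x ^+ 2 + n.+1%:R^-1 : R).
    by apply: cvgD; [exact: exprn_continuous|exact: cvg_cst].
  apply: cvgM; first exact: cvg_id.
  by apply: cvgV => //; rewrite gt_eqF// ltr_wpDl// sqr_ge0.
move=> x _; have [->|x0] := eqVneq x 0.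
  rewrite invr0 (_ : (fun n => h n 0) = fun=> 0); first exact: cvg_cst.
  by apply/funext => n; rewrite /h mul0r.
have -> : x^-1 = x / (x ^+ 2 + 0) by rewrite addr0; field.
apply: cvgM; first exact: cvg_cst.
apply: cvgV; first by rewrite addr0 sqrf_eq0.
by apply: cvgD; [exact: cvg_cst|exact: cvg_harmonic].
Qed.

End OperatorDomain.

(** * The imaginary part of the quadratic form of the operator *)

Section SchrodingerOperator.
Context (R : realType).
Implicit Types (V : R -> R[i]) (f g k : L2 R) (h : R[i]).

Local Notation mu := (@lebesgue_measure R).
Local Notation integ f := (mu.-integrable setT (EFin \o f)).

Lemma Rintegral_eq0_ae (u : R -> R) : integ u -> {ae mu, forall x, 0 <= u x} ->
  \int[mu]_x u x = 0 -> {ae mu, forall x, u x = 0}.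
Proof.
move=> ui u0 I0; have mu_ : measurable_fun setT (EFin \o u) by exact: (measurable_int mu).
have e : (\int[mu]_x `|(u x)%:E| = 0)%E.
  transitivity (\int[mu]_x (u x)%:E)%E.
    apply: ae_eq_integral => //; first exact: measurableT_comp.
    by apply: (ae_imp u0) => x h _; rewrite /= ger0_norm.
  by rewrite -[LHS]fineK ?[fine _]I0//; exact: integrable_fin_num.
have := (ae_eq_integral_abs mu measurableT mu_).1 e.
by move=> h; apply: (ae_imp h) => x /(_ Logic.I) [].
Qed.

Lemma im_part_ge0 V : {ae mu, forall x, 0 < x -> 0 <= cIm (V x)} ->
  {ae mu, forall x, 0 <= im_part V x}.
Proof.
move=> V0; apply: (ae_imp V0) => x hx.
by have [x0|x0] := pselect (0 < x); [rewrite im_partE// hx|rewrite im_part0].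
Qed.

Lemma Linfty_mul (v u : R -> R) : v \in Lfun mu +oo%E -> u \in Lfun mu 2%:E ->
  (fun x => v x * u x) \in Lfun mu 2%:E.
Proof.
move=> vL uL; have [v' [C [mv' vC vv']]] := Lfunoo_bounded vL.
have mv : measurable_fun setT v by have /set_mem := sub_Lfun_mfun vL.
apply: (Lfun2_ae (Lfun2_mul_bounded mv' vC uL)).
  exact: (measurable_funM mv (Lfun2_measurable uL)).
by apply: (ae_imp vv') => x ->.
Qed.

Lemma mulop_parts V f : V \in Lp_fun +oo%E ->
  {ae mu, forall x, re_part (mulop V f) x =
     re_part V x * re_part f x - im_part V x * im_part f x} /\
  {ae mu, forall x, im_part (mulop V f) x =
     re_part V x * im_part f x + im_part V x * re_part f x}.
Proof.
move=> /andP[VrL ViL]; pose u x := V x * f x.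
have ru : re_part u = (fun x => re_part V x * re_part f x - im_part V x * im_part f x).
  apply/funext => x; have [x0|x0] := pselect (0 < x).
    by rewrite !re_partE// !im_partE// cReM.
  by rewrite !re_part0// !im_part0// !mul0r subr0.
have iu : im_part u = (fun x => re_part V x * im_part f x + im_part V x * re_part f x).
  apply/funext => x; have [x0|x0] := pselect (0 < x).
    by rewrite !re_partE// !im_partE// cImM.
  by rewrite !re_part0// !im_part0// !mul0r addr0.
have uL : u \in @L2_fun R.
  apply: L2_fun_parts; rewrite ?ru ?iu.
    by apply: Lfun2B; apply: Linfty_mul => //; [exact: re_part_Lfun2|exact: im_part_Lfun2].
  by apply: Lfun2D; apply: Linfty_mul => //; [exact: im_part_Lfun2|exact: re_part_Lfun2].
split; first by apply: (ae_imp (re_part_toL2 uL)) => x; rewrite ru.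
by apply: (ae_imp (im_part_toL2 uL)) => x; rewrite iu.
Qed.

Lemma range_mulop_sqrt V k :
  range (mulop (fun x => (Num.sqrt (cIm (V x)))%:C)) k ->
  {ae mu, forall x, im_part V x = 0 -> re_part k x = 0 /\ im_part k x = 0}.
Proof.
move=> [g _ <-]; pose u x := (Num.sqrt (cIm (V x)))%:C * fun_of_L2 g x.
rewrite -[mulop _ g]/(toL2 u).
(* If the product is not square-integrable, [toL2] returns 0, and the conclusion holds as well. *)
have kae : {ae mu, forall x, 0 < x -> fun_of_L2 (toL2 u) x = u x \/ fun_of_L2 (toL2 u) x = 0}.
  have [uL|uL] := boolP (u \in @L2_fun R).
    by apply: (ae_imp (toL2_ae uL)) => x hx x0; left; exact: hx.
  rewrite /toL2 /insubd insubN//=.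
  by apply: (ae_imp (repr_pi_L2 0)) => x hx x0; right; rewrite hx.
apply: (ae_imp kae) => x hx; have [x0|x0] := pselect (0 < x); last first.
  by move=> _; rewrite re_part0// im_part0.
rewrite im_partE// => V0; rewrite re_partE// im_partE//.
by have [->|->] := hx x0; rewrite // /u V0 sqrtr0 mul0r.
Qed.

Lemma dom_A_op V h k f : dom (A_op V h k) f -> exists f1 f2 : L2 R,
  [/\ is_weak_derivative f f1, is_weak_derivative f1 f2,
      value_at0 f1 = h * value_at0 f &
      act (A_op V h k) f = value_at0 f *: k + (mulop V f - f2)].
Proof.
move=> [[f1 [f2 [ff1 ff2]]]]; rewrite /= (weak_derivativeE ff1) => hv.
exists f1, f2; split => //.
by rewrite (weak_derivativeE ff2) addrC [- _ + _]addrC.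
Qed.

(** A strict bound by a real number forces the extended integral to be finite. Outside the set of
    integration the quotient is 0 because [0^-1 = 0]. *)
Lemma weighted_k_integrable V h k : V \in Lp_fun +oo%E ->
  {ae mu, forall x, 0 < x -> 0 <= cIm (V x)} ->
  ((4^-1 : R)%:E *
     \int[mu]_(x in [set x : R | (0 < x)%R /\ cIm (V x) != 0%R])
       (cRe (`|k x| ^+ 2) / cIm (V x))%R%:E < (cIm h)%:E)%E ->
  let kk x := (re_part k x ^+ 2 + im_part k x ^+ 2) / im_part V x in
  integ kk /\ 4^-1 * \int[mu]_x kk x < cIm h.
Proof.
move=> /andP[_ ViL] V0 + kk.
have -> : (\int[mu]_(x in [set x : R | (0 < x)%R /\ cIm (V x) != 0%R])
    (cRe (`|k x| ^+ 2) / cIm (V x))%R%:E = \int[mu]_x (kk x)%:E)%E.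
  rewrite integral_mkcond; apply: eq_integral => x _; rewrite patchE /kk.
  have [x0|x0] := pselect (0 < x); last first.
    by rewrite memNset/= ?re_part0 ?im_part0 ?expr0n ?addr0 ?mul0r//; case.
  rewrite re_partE// !im_partE//; case: ifPn => [|].
    by rewrite inE -add_Re2_Im2.
  rewrite notin_setE /= => H; have -> : cIm (V x) = 0.
    by apply/eqP; apply: contra_notT H => H.
  by rewrite invr0 mulr0.
have kk0 : {ae mu, forall x, 0 <= kk x}.
  apply: (ae_imp (im_part_ge0 V0)) => x hx.
  by rewrite /kk divr_ge0// addr_ge0// sqr_ge0.
have mV : measurable_fun setT (im_part V) by have /set_mem := sub_Lfun_mfun ViL.
have mkk : measurable_fun setT kk.
  apply: (measurable_funM _ (measurable_inv mV)); apply: measurable_funD.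
    by apply: measurable_funX; exact: re_part_measurable.
  by apply: measurable_funX; exact: im_part_measurable.
have e : (\int[mu]_x `|(kk x)%:E| = \int[mu]_x (kk x)%:E)%E.
  apply: ae_eq_integral => //.
  - by apply: measurableT_comp => //; exact/measurable_EFinP.
  - exact/measurable_EFinP.
  - by apply: (ae_imp kk0) => x h0 _; rewrite /= ger0_norm.
move=> hlt; have fin : (\int[mu]_x (kk x)%:E < +oo)%E.
  rewrite ltey; apply: contraTneq hlt => ->.
  by rewrite gt0_muley ?lte_fin// -leNgt leey.
have ikk : integ kk.
  apply/integrableP; split; first exact/measurable_EFinP.
  by rewrite e.
split => //; rewrite -lte_fin EFinM fineK//.
by apply: integrable_fin_num.
Qed.

(** With [f = p + i q] and [c = f(0)], the minimum over [f] of [v |f|^2 + Im (f^* c k)] is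
    [- |c k|^2 / (4 v)]: this is the origin of the factor 1/4 in the theorem. Where [v = 0], [k]
    vanishes too. *)
Lemma form_pointwise_ge0 (v p q cr ci kr ki : R) : 0 <= v ->
  (v = 0 -> kr = 0 /\ ki = 0) ->
  0 <= (v * p * p + v * q * q) + (p * (cr * ki + ci * kr) - q * (cr * kr - ci * ki))
     + (cr ^+ 2 + ci ^+ 2) / 4 * ((kr ^+ 2 + ki ^+ 2) / v).
Proof.
rewrite le_eqVlt => /predU1P[<- /(_ erefl)[-> ->]|v0 _].
  by rewrite invr0 !mul0r !mulr0 !addr0 subr0 !mulr0 subr0.
set A := cr * ki + ci * kr; set B := cr * kr - ci * ki.
have -> : (v * p * p + v * q * q) + (p * A - q * B)
     + (cr ^+ 2 + ci ^+ 2) / 4 * ((kr ^+ 2 + ki ^+ 2) / v) =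
  v * (p + A / (2 * v)) ^+ 2 + v * (q - B / (2 * v)) ^+ 2.
  by rewrite /A /B; field; rewrite gt_eqF.
by rewrite addr_ge0// mulr_ge0 ?sqr_ge0// ltW.
Qed.

(** For [n = |f(0)|^2], [a] and [b] the potential and coupling terms, [H = Im h] and [K] a quarter
    of the weighted integral of [k]: the two relations give [H n <= K n]. *)
Lemma form_coercive (n a b K H : R) : 0 <= n -> K < H ->
  H * n + a + b = 0 -> 0 <= a + b + n * K -> n = 0.
Proof.
move=> n0 KH tot pos; apply/eqP; rewrite eq_le n0 andbT leNgt; apply/negP => np.
have : n * K < n * H by rewrite ltr_pM2l.
lra.
Qed.

Lemma A_op_real_form V h k f : V \in Lp_fun +oo%E ->
  {ae mu, forall x, 0 < x -> 0 <= cIm (V x)} -> 0 < cIm h ->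
  range (mulop (fun x => (Num.sqrt (cIm (V x)))%:C)) k ->
  ((4^-1 : R)%:E *
     \int[mu]_(x in [set x : R | (0 < x)%R /\ cIm (V x) != 0%R])
       (cRe (`|k x| ^+ 2) / cIm (V x))%R%:E < (cIm h)%:E)%E ->
  dom (A_op V h k) f -> cIm (L2ip f (act (A_op V h k) f)) = 0 ->
  value_at0 f = 0 /\ {ae mu, forall x, im_part V x * im_part f x = 0}.
Proof.
move=> VL V0 h0 kran klt /dom_A_op[f1 [f2 [ff1 ff2 hbc ->]]].
have [ikk Kh] := weighted_k_integrable VL V0 klt.
have kV := range_mulop_sqrt kran; have Vi0 := im_part_ge0 V0.
have [mr mi] := mulop_parts f VL; have /andP[VrL ViL] := VL.
have [wr wi] := weak_derivative_parts ff1; have [wr1 wi1] := weak_derivative_parts ff2.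
have rL (g : L2 R) := re_part_Lfun2 g; have iL (g : L2 R) := im_part_Lfun2 g.
have [F [F1 [[cF cF1] eF eF1 hF _]]] := weak_deriv_rep2 (rL f) (rL f1) (rL f2) wr wr1.
have [G [G1 [[cG cG1] eG eG1 hG _]]] := weak_deriv_rep2 (iL f) (iL f1) (iL f2) wi wi1.
have vf : value_at0 f = F 0 +i* G 0 by exact: value_at0E.
move: hbc; rewrite (value_at0E cF1 cG1 eF1 eG1) vf => hbc.
have [hF1 hG1] : F1 0 = cRe h * F 0 - cIm h * G 0 /\ G1 0 = cRe h * G 0 + cIm h * F 0.
  by have := congr1 (@complex.Re R) hbc; have := congr1 (@complex.Im R) hbc;
    rewrite cReM cImM.
pose p := re_part f; pose q := im_part f; pose v := im_part V.
pose cr := F 0; pose ci := G 0; pose kr := re_part k; pose ki := im_part k.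
(* [th], [J] and [W] are the densities of [Im (f^* f(0) k)], [V_I |f|^2] and [Im (f^* f'')]. *)
pose th x := p x * (cr * ki x + ci * kr x) - q x * (cr * kr x - ci * ki x).
pose J x := v x * p x * p x + v x * q x * q x.
pose W x := p x * im_part f2 x - q x * re_part f2 x.
pose kk x := (kr x ^+ 2 + ki x ^+ 2) / v x.
have iM := @Lfun2_mul _ _ _ mu.
have vp : (fun x => v x * p x) \in Lfun mu 2%:E by exact: Linfty_mul ViL (rL f).
have vq : (fun x => v x * q x) \in Lfun mu 2%:E by exact: Linfty_mul ViL (iL f).
have iJ : integ J.
  by apply: (integrable_add measurableT (iM _ _ vp (rL f)) (iM _ _ vq (iL f))).
have iW : integ W.
  by apply: (integrable_sub measurableT (iM _ _ (rL f) (iL f2)) (iM _ _ (iL f) (rL f2))).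
have clin (a b : R) (u w : R -> R) : u \in Lfun mu 2%:E -> w \in Lfun mu 2%:E ->
    (fun x => a * u x + b * w x) \in Lfun mu 2%:E.
  move=> uL wL; apply: Lfun2_lin => //.
  rewrite (_ : (fun x => _) = (fun x => b * w x + (w x - w x))); last first.
    by apply/funext => x; rewrite subrr addr0.
  by apply: Lfun2_lin => //; exact: Lfun2B.
have ith : integ th.
  have L1 := clin cr ci _ _ (iL k) (rL k); have L2 := clin cr (- ci) _ _ (rL k) (iL k).
  have L3 : (fun x => cr * kr x - ci * ki x) \in Lfun mu 2%:E.
    by under eq_fun do rewrite -mulNr.
  exact: (integrable_sub measurableT (iM _ _ (rL f) L1) (iM _ _ (iL f) L3)).
(* Lagrange's identity for re f and im f; the boundary condition evaluates their Wronskian at 0 as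
   [Im h |f(0)|^2]. *)
have IW : \int[mu]_x W x = - (cIm h * (cr ^+ 2 + ci ^+ 2)).
  rewrite (@Rintegral_support _ _ (@Rpos R)); last first.
    by move=> x x0; rewrite /W /p /q !re_part0// !im_part0// !mul0r subr0.
  rewrite (wronskian_integral (rL f) (rL f1) (rL f2) (iL f) (iL f1) (iL f2)
    cF cF1 cG cG1 hF hG eF eF1 eG eG1 wr1 wi1) hF1 hG1 /cr /ci; ring.
rewrite Im_L2ip => I0.
have : \int[mu]_x (- W x + J x + th x) = 0.
  rewrite -[RHS]I0; apply: ae_eq_Rintegral.
  - apply: measurable_funD; last by apply/measurable_EFinP; exact: (measurable_int mu ith).
    apply: measurable_funD; last by apply/measurable_EFinP; exact: (measurable_int mu iJ).
    by apply: measurableT_comp => //; apply/measurable_EFinP; exact: (measurable_int mu iW).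
  - by apply: measurable_funB; apply: measurable_funM;
      [exact: re_part_measurable|exact: im_part_measurable
      |exact: im_part_measurable|exact: re_part_measurable].
  have lr := re_part_lin_ae (F 0 +i* G 0) k (mulop V f - f2).
  have li := im_part_lin_ae (F 0 +i* G 0) k (mulop V f - f2).
  have br := re_partB_ae (mulop V f) f2; have bi := im_partB_ae (mulop V f) f2.
  apply: (ae_imp (ae_and (ae_and lr li) (ae_and (ae_and br bi) (ae_and mr mi)))) => x.
  move=> [[-> ->] [[-> ->] [-> ->]]] /=.
  by rewrite /W /J /th /p /q /v /kr /ki /cr /ci; ring.
have iNW : integ (fun x => - W x).
  have := integrable_scale (-1) measurableT iW.
  by under eq_fun do rewrite mulN1r.
have IN : \int[mu]_x (- W x) = cIm h * (cr ^+ 2 + ci ^+ 2).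
  rewrite -[RHS]opprK -IW -mulN1r -RintegralZl//.
  by apply: eq_Rintegral => x _; rewrite mulN1r.
rewrite RintegralD//; last exact: integrable_add.
rewrite RintegralD// IN => tot.
set n := cr ^+ 2 + ci ^+ 2 in tot.
have n0 : 0 <= n by rewrite addr_ge0// sqr_ge0.
have pos : 0 <= \int[mu]_x (J x + th x + n / 4 * kk x).
  have ai : integ (fun x => J x + th x + n / 4 * kk x).
    by apply: integrable_add => //; [exact: integrable_add|exact: integrable_scale].
  have am : measurable_fun setT (fun x => J x + th x + n / 4 * kk x).
    by apply/measurable_EFinP; exact: (measurable_int mu ai).
  (* Nonnegativity holds almost everywhere only; the absolute value is a version nonnegative
     everywhere. *)
  rewrite (@ae_eq_Rintegral _ _ _ mu _ (fun x => `|J x + th x + n / 4 * kk x|)) //.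
  - by apply: Rintegral_ge0.
  - exact: measurableT_comp.
  apply: (ae_imp (ae_and Vi0 kV)) => x [h1 h2]; rewrite ger0_norm//.
  exact: form_pointwise_ge0.
rewrite RintegralD// in pos; [|exact: integrable_add|exact: integrable_scale].
rewrite RintegralD// RintegralZl// in pos.
have n_eq0 : n = 0 by apply: (form_coercive n0 Kh tot); rewrite mulrA.
have /andP[/eqP cr0 /eqP ci0] : (cr == 0) && (ci == 0).
  by move: n_eq0 => /eqP; rewrite /n paddr_eq0 ?sqr_ge0// !sqrf_eq0.
have th0 : \int[mu]_x th x = 0.
  rewrite (_ : th = cst 0); first by rewrite Rintegral_cst// mul0r.
  by apply/funext => x; rewrite /th cr0 ci0 !mul0r addr0 subr0 !mulr0 subr0.
have J0 : \int[mu]_x J x = 0 by move: tot; rewrite n_eq0 mulr0 add0r th0 addr0.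
have Jge : {ae mu, forall x, 0 <= J x}.
  apply: (ae_imp Vi0) => x hx; rewrite /J -!mulrA -!expr2.
  by rewrite addr_ge0// mulr_ge0// sqr_ge0.
split; first by rewrite -/cr -/ci cr0 ci0.
apply: (ae_imp (ae_and (Rintegral_eq0_ae iJ Jge J0) Vi0)) => x [].
rewrite /J -!mulrA -!expr2 -mulrDr -/v -/q => /eqP; rewrite mulf_eq0 => /orP[/eqP -> _|].
  by rewrite mul0r.
rewrite paddr_eq0 ?sqr_ge0// !sqrf_eq0 => /andP[_ /eqP ->] _.
by rewrite mulr0.
Qed.

End SchrodingerOperator.

(** * Vanishing of the selfadjoint part *)

Section NonSelfadjoint.
Context (R : realType).
Implicit Types (V : R -> R[i]) (f g k : L2 R) (h : R[i]).

Local Notation mu := (@lebesgue_measure R).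

(** [V_I im f = 0] is what decouples the real part of the equation from the imaginary part. *)
Lemma A_op_volterra V h k f v : V \in Lp_fun +oo%E ->
  {ae mu, forall x, re_part V x = v x} ->
  dom (A_op V h k) f -> value_at0 f = 0 ->
  {ae mu, forall x, im_part V x * im_part f x = 0} ->
  volterra v (re_part f) (re_part (act (A_op V h k) f)).
Proof.
move=> VL Vv /dom_A_op[f1 [f2 [ff1 ff2 hbc ->]]] f0 Vf0.
have [mr _] := mulop_parts f VL.
have [wr wi] := weak_derivative_parts ff1; have [wr1 wi1] := weak_derivative_parts ff2.
have rL (g : L2 R) := re_part_Lfun2 g; have iL (g : L2 R) := im_part_Lfun2 g.
have [F [F1 [[cF cF1] eF eF1 hF hF1]]] := weak_deriv_rep2 (rL f) (rL f1) (rL f2) wr wr1.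
have [G [G1 [[cG cG1] eG eG1 _ _]]] := weak_deriv_rep2 (iL f) (iL f1) (iL f2) wi wi1.
move: hbc; rewrite f0 mulr0 (value_at0E cF1 cG1 eF1 eG1) => /eqP.
rewrite eq_complex /= => /andP[/eqP F10 _].
move: (f0); rewrite (value_at0E cF cG eF eG) => /eqP.
rewrite eq_complex /= => /andP[/eqP F00 _].
exists F, F1, (re_part f2); split => //.
  by split=> x; [rewrite {1}hF F00 add0r|rewrite {1}hF1 F10 add0r].
have lr := re_part_lin_ae (0 : R[i]) k (mulop V f - f2).
have br := re_partB_ae (mulop V f) f2.
apply: (ae_imp (ae_and (ae_and lr br) (ae_and (ae_and mr Vv) Vf0))) => x.
move=> [[-> ->] [[-> <-] ->]] _ /=; ring.
Qed.

Lemma L2_Re_sqr_le f : \int[mu]_x (re_part f x ^+ 2) <= hnorm (@L2ip R) f ^+ 2.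
Proof.
rewrite (hnorm_sqr (L2_hilbert R)) L2_nsqE lerDl.
by apply: Rintegral_ge0 => x _; exact: sqr_ge0.
Qed.

Lemma L2_eq0_parts f : {ae mu, forall x, 0 < x -> re_part f x = 0} ->
  {ae mu, forall x, 0 < x -> im_part f x = 0} -> f = 0.
Proof.
have rz := re_partB_ae f f; have iz := im_partB_ae f f; rewrite subrr in rz iz.
move=> r0 i0; apply: L2_ext_parts; apply: ae_imp.
- exact: (ae_and r0 rz).
- by move=> x [h ->] x0; rewrite subrr h.
- exact: (ae_and i0 iz).
- by move=> x [h ->] x0; rewrite subrr h.
Qed.

Lemma hnorm_eq0 f : hnorm (@L2ip R) f = 0 -> f = 0.
Proof.
move=> f0; have := hnorm_sqr (L2_hilbert R) f.
rewrite f0 expr0n L2_nsqE /= => /esym/eqP.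
have sq0 (u : R -> R) : u \in Lfun mu 2%:E -> \int[mu]_x (u x ^+ 2) = 0 ->
    {ae mu, forall x, u x = 0}.
  move=> /Lfun2P[_ u2] /(Rintegral_eq0_ae u2)-/(_ (aeW _ (fun x => sqr_ge0 _))) e.
  by apply: (ae_imp e) => x /eqP; rewrite sqrf_eq0 => /eqP.
rewrite paddr_eq0; try by apply: Rintegral_ge0 => x _; exact: sqr_ge0.
move=> /andP[/eqP /(sq0 _ (re_part_Lfun2 f)) r0 /eqP /(sq0 _ (im_part_Lfun2 f)) i0].
by apply: L2_eq0_parts; [apply: (ae_imp r0)|apply: (ae_imp i0)] => x -> .
Qed.

(** In [N r^2 f = w 0 - u] the chain bounds the primitive of [w 0], and the L^2 norm bounds that of
    the error [u]. Division by [N r] removes [N], which depends on [m]. *)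
Lemma selfadjoint_volterra_bound (M : set (L2 R)) (B : operator (L2 R))
    (v : R -> R) (C r : R) f (x : R) m :
  Defs.subspace M -> hclosed (@L2ip R) M -> selfadjoint_in (@L2ip R) M B ->
  measurable_fun setT v -> (forall y, `|v y| <= C) ->
  (forall g, dom B g -> volterra v (re_part g) (re_part (act B g))) ->
  dom B f -> 0 < r -> 0 <= x ->
  r * `|prim (re_part f) x| <= 2 * (hnorm (@L2ip R) (act B f) + 1) *
    (2^-1 ^+ m.+1 * expR ((1 + 2 * C + 4 * r) * x) + (1 + x)).
Proof.
(* This [l] is at least 1, so [l <= l ^+ 2], and both [2 * C] and [4 * r] are at most [l ^+ 2]. *)
move=> Msub Mcl Bsa mv vC vol Df r0 x0; set l := 1 + 2 * C + 4 * r.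
have C0 : 0 <= C := le_trans (normr_ge0 _) (vC 0).
have l1 : 1 <= l by rewrite /l; lra.
have ll : l <= l ^+ 2 by rewrite expr2 ler_peMr// (le_trans ler01 l1).
have lC : 2 * C <= l ^+ 2 by rewrite (le_trans _ ll)// /l; lra.
have lr : 4 * r <= l ^+ 2 by rewrite (le_trans _ ll)// /l; lra.
have [N [+ [N0]]] := sa_chain (L2_hilbert R) Msub Mcl Bsa m Df r0.
move=> w; move: (w : nat -> L2 R) => {}w Dw Bw wm w0.
(* The shift to [G = g + 1] makes the bounds strictly positive, as [prim_le_L2] requires. *)
set g := hnorm _ (act B f) in wm w0 *; pose G := g + 1.
have g0 : 0 <= g by exact: (hnorm_ge0 (@L2ip R)).
have G0 : 0 < G by rewrite /G; lra.
have gG : g <= G by rewrite /G; lra.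
have Np : 0 < N%:R :> R by rewrite ltr0n.
have sqle (u : L2 R) (s : R) : 0 <= s -> hnorm (@L2ip R) u <= s ->
    \int[mu]_t (re_part u t ^+ 2) <= s ^+ 2.
  move=> s0 us; apply: (le_trans (L2_Re_sqr_le u)).
  by rewrite ler_pXn2r// ?nnegrE// (hnorm_ge0 (@L2ip R)).
pose s := N%:R * 2 * r ^+ m.+2 * G; pose s0 := N%:R * 2 * r * G.
have N2 : 0 < N%:R * 2 :> R by rewrite mulr_gt0.
have sp : 0 < s := mulr_gt0 (mulr_gt0 N2 (exprn_gt0 _ r0)) G0.
have s0p : 0 < s0 := mulr_gt0 (mulr_gt0 N2 r0) G0.
have b1 : `|prim (re_part (w 0%N)) x| <= (2 / l ^+ 2) ^+ m.+1 * s * expR (l * x).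
  apply: (@volterra_chain _ v (fun j => re_part (w j)) C l s x m.+1) => //.
  - by move=> j; exact: re_part_Lfun2.
  - by move=> j jm; rewrite -Bw//; exact: vol.
  - apply: sqle; first exact: ltW.
    by rewrite (le_trans wm)// ler_wpM2l// ltW// (mulr_gt0 N2 (exprn_gt0 _ r0)).
pose c : R := N%:R * r ^+ 2; pose u : L2 R := w 0%N - c%:C *: f.
have b2 : `|prim (re_part u) x| <= s0 * (1 + x).
  apply: prim_le_L2 => //; first exact: re_part_Lfun2.
  apply: sqle; first exact: ltW.
  by rewrite (le_trans w0)// ler_wpM2l// ltW// (mulr_gt0 N2 r0).
have e : prim (re_part u) x = prim (re_part (w 0%N)) x - c * prim (re_part f) x.
  have fi := Lfun2_locally_integrable (re_part_Lfun2 f).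
  have wi := Lfun2_locally_integrable (re_part_Lfun2 (w 0%N)).
  have cL : (fun t => c * re_part f t) \in Lfun mu 2%:E.
    apply: (@Lfun2_mul_bounded _ (cst c) _ `|c|) => //; exact: re_part_Lfun2.
  rewrite -primZ// -primB//; last exact: Lfun2_locally_integrable.
  apply: eq_prim; first exact: re_part_measurable.
    by apply: measurable_funB; [exact: re_part_measurable|exact: Lfun2_measurable cL].
  have h1 := re_part_lin_ae (- c%:C) f (w 0%N).
  apply: (ae_imp h1) => t + _.
  have -> : (- c%:C *: f + w 0%N : L2 R) = u by rewrite /u scaleNr addrC.
  by move=> -> /=; ring.
have b3 : c * `|prim (re_part f) x| <= s0 * (2^-1 ^+ m.+1 * expR (l * x) + (1 + x)).
  have c0 : 0 < c by rewrite /c mulr_gt0// exprn_gt0.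
  have -> : c * `|prim (re_part f) x| = `|prim (re_part (w 0%N)) x - prim (re_part u) x|.
    by rewrite e opprB addrCA subrr addr0 normrM gtr0_norm.
  rewrite (le_trans (ler_normB _ _))// mulrDr lerD// (le_trans b1)// [leRHS]mulrA.
  rewrite ler_wpM2r ?expR_ge0//.
  (* The growth [r] per link meets the gain [2 / l ^+ 2]; their product is at most 1/2 since
     [4 * r <= l ^+ 2]. *)
  have -> : (2 / l ^+ 2) ^+ m.+1 * s = s0 * (2 * r / l ^+ 2) ^+ m.+1.
    rewrite /s /s0 (exprS r m.+1) [2 * r]mulrC -[r * 2 / _]mulrA (exprMn _ r).
    by move: (r ^+ m.+1) (_ ^+ m.+1) => a b; ring.
  have l20 : 0 < l ^+ 2 by rewrite exprn_gt0// (lt_le_trans ltr01 l1).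
  have q0 : 0 <= 2 * r / l ^+ 2 by rewrite divr_ge0 ?(ltW l20)// mulr_ge0// ltW.
  rewrite ler_wpM2l ?(ltW s0p)// lerXn2r// ?nnegrE// ler_pdivrMr//; lra.
have cr : 0 < N%:R * r by rewrite mulr_gt0.
rewrite -(ler_pM2l cr).
move: b3; rewrite /c /s0 -/G; set P := `|prim _ _|; set Q := _ + (1 + x) => b3.
have -> : N%:R * r * (r * P) = N%:R * r ^+ 2 * P by ring.
by have -> : N%:R * r * (2 * G * Q) = N%:R * 2 * r * G * Q by ring.
Qed.

Lemma selfadjoint_volterra_re_eq0 (M : set (L2 R)) (B : operator (L2 R))
    (v : R -> R) (C : R) f :
  Defs.subspace M -> hclosed (@L2ip R) M -> selfadjoint_in (@L2ip R) M B ->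
  measurable_fun setT v -> (forall y, `|v y| <= C) ->
  (forall g, dom B g -> volterra v (re_part g) (re_part (act B g))) ->
  dom B f -> {ae mu, forall x, 0 < x -> re_part f x = 0}.
Proof.
move=> Msub Mcl Bsa mv vC vol Df.
apply: prim_ae_eq0; first exact: Lfun2_locally_integrable (re_part_Lfun2 f).
move=> x x0; set P := prim _ x; set G := hnorm (@L2ip R) (act B f) + 1.
have G0 : 0 < G by rewrite /G; have := hnorm_ge0 (@L2ip R) (act B f); lra.
have rP (r : R) : 0 < r -> r * `|P| <= 2 * G * (1 + x).
  move=> r0; apply: (@ler_geometric_limit _ _ _ (G * expR ((1 + 2 * C + 4 * r) * x))) => m.
  have := selfadjoint_volterra_bound m Msub Mcl Bsa mv vC vol Df r0 x0.
  rewrite -/P -/G; move=> h; apply: (le_trans h).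
  rewrite mulrDr lerD2r exprS le_eqVlt; apply/orP; left; apply/eqP.
  by move: (2^-1 ^+ m) (expR _) => a b; field.
apply/eqP; rewrite -normr_le0 leNgt; apply/negP => P0.
set q := 2 * G * (1 + x) in rP.
have q0 : 0 <= q / `|P| by rewrite divr_ge0// /q !mulr_ge0// ?(ltW G0)//; lra.
(* At this [r] the left side is [q + |P|], which exceeds [q]. *)
have := rP (q / `|P| + 1) (ltr_wpDl q0 ltr01).
by rewrite (mulrDl (q / _) 1) mul1r divfK ?gt_eqF// gerDl leNgt P0.
Qed.

End NonSelfadjoint.

Theorem theorem3p6 (R : realType) (V : R -> R[i]) (h : R[i]) (k : L2 R)
    (V_Linfty : V \in Lp_fun +oo%E)
    (VI_ge0 : {ae @lebesgue_measure R, forall x, 0 < x -> 0 <= cIm (V x)})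
    (h_gt0 : 0 < cIm h)
    (k_ran : range (mulop (fun x => (Num.sqrt (cIm (V x)))%:C)) k)
    (k_lt : ((4^-1 : R)%:E *
        \int[@lebesgue_measure R]_(x in [set x : R | (0 < x)%R /\ cIm (V x) != 0%R])
          (cRe (`|k x| ^+ 2) / cIm (V x))%R%:E < (cIm h)%:E)%E) :
  completely_nonselfadjoint (@L2ip R) (A_op V h k).
Proof.
move=> [M [[Msub Mcl _ _ _] M0 Bsa]]; apply: M0.
have hH := L2_hilbert R; have /andP[VrL _] := V_Linfty.
have [v [C [mv vC Vv]]] := Lfunoo_bounded VrL.
pose B : operator (L2 R) := restrict_op (A_op V h k) M.
rewrite -/B in Bsa.
have vol (g : L2 R) : dom B g -> volterra v (re_part g) (re_part (act B g)).
  move=> Dg; have [Ag _] := Dg.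
  have [g0 Vg0] := A_op_real_form V_Linfty VI_ge0 h_gt0 k_ran k_lt Ag (sa_real hH Bsa Dg).
  exact: A_op_volterra.
have D0 (f : L2 R) : dom B f -> f = 0.
  move=> Df; have re0 g := @selfadjoint_volterra_re_eq0 _ M B v C g Msub Mcl Bsa mv vC vol.
  apply: L2_eq0_parts; first exact: re0.
  (* The real part of [i f + f] is [re f - im f], so two vanishing real parts give [im f = 0]. *)
  have [Dif _] := sa_lin hH Msub Bsa 'i%C Df Df.
  apply: (ae_imp (ae_and (ae_and (re0 _ Df) (re0 _ Dif)) (re_part_lin_ae 'i%C f f))).
  move=> x [[h1 h2] h3] x0; move: (h2 x0).
  by rewrite h3 h1//= mul0r mul1r addr0 sub0r => /eqP; rewrite oppr_eq0 => /eqP.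
apply/seteqP; split => x; last by move=> ->; case: Msub.
move=> Mx; apply: hnorm_eq0; apply/eqP.
rewrite eq_le (hnorm_ge0 (@L2ip R)) andbT leNgt; apply/negP => x0.
(* The radius is the norm of [x] itself: the approximant can only be 0, at distance exactly that
   norm. *)
case: Bsa => _ _ dense _; have [y /D0 ->] := dense x Mx _ x0.
by rewrite subr0 ltxx.
Qed.
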